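(* Assume that $\mathbf V_h(t)=\mathrm{Op}_h(V(t,\cdot))$ with $V\in\mathcal C^\infty(\mathbb R\times T^*\mathbb T^d)$ bounded. Let $\mu\in\widetilde{\mathcal M}(1/h)$, let $\bar\mu$ be the image of $\mu(t,\cdot)$ under the projection $(x,\xi)\mapsto\xi$ (which does not depend on $t$), and denote by $\mu_\xi(t,\cdot)$ the disintegration of $\mu(t,\cdot)$ with respect to the variable $\xi$, i.e. for every $\theta\in L^1(\mathbb R)$ and every bounded measurable function $f$, $$\int_{\mathbb R}\theta(t)\int_{\mathbb T^d\times\mathbb R^d}f(x,\xi)\,\mu(t,dx,d\xi)\,dt=\int_{\mathbb R}\theta(t)\int_{\mathbb R^d}\Big(\int_{\mathbb T^d}f(x,\xi)\,\mu_\xi(t,dx)\Big)\bar\mu(d\xi)\,dt .$$ Then for $\bar\mu$-almost every $\xi$ where $d^2H(\xi)$ is definite, the measure $\mu_\xi(t,\cdot)$ is absolutely continuous (with respect to Lebesgue measure on $\mathbb T^d$, for a.e. $t$).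
   Context: $\mathbb T^d=(\mathbb R/2\pi\mathbb Z)^d$, $T^*\mathbb T^d=\mathbb T^d\times(\mathbb R^d)^*$, $D_x=-i\partial_x$; $H\in\mathcal C^\infty((\mathbb R^d)^*;\mathbb R)$. The perturbation $\mathbf V_h(t)$ is a bounded self-adjoint operator on $L^2(\mathbb T^d)$, with $t\mapsto\|\mathbf V_h(t)\|$ in $L^1_{loc}(\mathbb R)\cap L^\infty(\mathbb R)$ uniformly in $h$. $S_h^t$ is the unitary propagator, starting at time $0$, of $ih\partial_t\psi=(H(hD_x)+h^2\mathbf V_h(t))\psi$ on $L^2(\mathbb T^d)$. $\mathrm{Op}_h$ is the semiclassical Weyl quantization: $\langle u,\mathrm{Op}_h(a)u\rangle=(2\pi)^{-d/2}\sum_{k,j\in\mathbb Z^d}\widehat u(k)\overline{\widehat u(j)}\,\widehat a_{j-k}(\tfrac h2(k+j))$, with $\widehat f(k)=\int_{\mathbb T^d}f(x)e^{-ik\cdot x}(2\pi)^{-d/2}dx$ and $\widehat a_k(\xi)$ the Fourier coefficients of $a(\cdot,\xi)$. The Wigner distribution $w_u^h\in\mathcal D'(T^*\mathbb T^d)$ is $\langle w_u^h,a\rangle=\langle u,\mathrm{Op}_h(a)u\rangle_{L^2(\mathbb T^d)}$, $a\in\mathcal C_c^\infty(T^*\mathbb T^d)$. $\widetilde{\mathcal M}(1/h)$ is the set of all weak-$*$ accumulation points, in $L^\infty(\mathbb R;\mathcal D'(T^*\mathbb T^d))$, of $t\mapsto w^h_{S_h^{t/h}u_h}$ as $h\to0^+$,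 where $(u_h)$ ranges over all sequences with $\|u_h\|_{L^2(\mathbb T^d)}=1$ ($h$ running along sequences tending to $0^+$). Its elements lie in $L^\infty(\mathbb R;\mathcal M_+(T^*\mathbb T^d))$, $\mathcal M_+$ denoting positive Radon measures. *)

(* Defs.v *)
From HB Require Import structures.
From mathcomp Require Import all_boot all_order all_algebra finmap complex.
From mathcomp Require Import all_classical all_reals all_analysis.
From mathcomp Require Import showcase.summability.

Set Implicit Arguments.
Unset Strict Implicit.
Unset Printing Implicit Defensive.

Import Order.TTheory GRing.Theory Num.Theory.
Import numFieldNormedType.Exports.

Local Open Scope classical_set_scope.
Local Open Scope ring_scope.
Local Open Scope complex_scope.

Definition mx_display : measure_display -> measure_display.
Proof. exact. Qed.

(* The product sigma-algebra; on 'rV[R]_d it is the Borel one. *)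
Section measurable_matrix.
Context {d} {T : sigmaRingType d}.
Variables m n : nat.

Definition mx_preimages : set (set 'M[T]_(m, n)) :=
  [set B | exists i j A, measurable A /\ B = [set M : 'M[T]_(m, n) | A (M i j)]].

Let mx_set0 : <<s mx_preimages >> set0.
Proof. exact: sigma_algebra0. Qed.

Let mx_setC A : <<s mx_preimages >> A -> <<s mx_preimages >> (~` A).
Proof. exact: sigma_algebraC. Qed.

Let mx_bigcup (F : (set 'M[T]_(m, n))^nat) : (forall i, <<s mx_preimages >> (F i)) ->
  <<s mx_preimages >> (\bigcup_i (F i)).
Proof. exact: sigma_algebra_bigcup. Qed.

HB.instance Definition _ := @isMeasurable.Build (mx_display d)
  'M[T]_(m, n) <<s mx_preimages >> mx_set0 mx_setC mx_bigcup.

End measurable_matrix.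

Section torus_measure.
Variable R : realType.

Definition circle_cell : set (measurableTypeR R) := [set` `[0, 2 * pi[%R].

Let measurable_circle_cell : measurable circle_cell.
Proof. exact: measurable_itv. Qed.

Let circle_cell_fin : (lebesgue_measure circle_cell < +oo)%E.
Proof. by rewrite /circle_cell lebesgue_measure_itv /=; case: ifP; rewrite ltry. Qed.

Definition circle_measure : set (measurableTypeR R) -> \bar R :=
  mfrestr (f := lebesgue_measure) measurable_circle_cell circle_cell_fin.

HB.instance Definition _ := FiniteMeasure.on circle_measure.

Definition cons_row (n : nat) (p : measurableTypeR R * 'rV[R]_n) : 'rV[R]_n.+1 :=
  row_mx (const_mx p.1 : 'rV_1) p.2.

Lemma measurable_cons_row n : measurable_fun setT (@cons_row n).
Proof.
apply: (measurability (@mx_preimages _ R 1 n.+1)) => //.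
move=> _ [_ [i [j [A [mA ->]]]] <-]; rewrite setTI.
case: (splitP (j : 'I_(1 + n))) => k jk.
  have -> : cons_row (n := n) @^-1` [set M | A (M i j)] = fst @^-1` A.
    have -> : j = lshift n k by exact: val_inj.
    apply/funext => -[x y]; rewrite /preimage /mkset; congr A.
    by apply: etrans (row_mxEl _ _ _ _) _; rewrite mxE.
  by rewrite -[X in measurable X]setTI; apply: measurable_fst.
have -> : cons_row (n := n) @^-1` [set M | A (M i j)] =
    snd @^-1` [set y : 'rV[R]_n | A (y i k)].
  have -> : j = rshift 1 k by exact: val_inj.
  apply/funext => -[x y]; rewrite /preimage /mkset; congr A.
  exact: row_mxEr.
rewrite -[X in measurable X]setTI; apply: measurable_snd => //.
by apply: sub_sigma_algebra; exists i, k, A.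
Qed.

Section torus_step.
Variables (n : nat) (m : {finite_measure set 'rV[R]_n -> \bar R}).

Definition torus_step : set 'rV[R]_n.+1 -> \bar R :=
  pushforward (circle_measure \x m)%E (@cons_row n).

Let torus_step0 : torus_step set0 = 0%E.
Proof. by rewrite /torus_step /pushforward preimage_set0 measure0. Qed.

Let torus_step_ge0 A : (0 <= torus_step A)%E.
Proof. by rewrite /torus_step /pushforward measure_ge0. Qed.

Let torus_step_sigma_additive : semi_sigma_additive torus_step.
Proof.
move=> F mF tF mUF; rewrite /torus_step /pushforward preimage_bigcup.
have mpre A : measurable A -> measurable (@cons_row n @^-1` A).
  by move=> mA; rewrite -[X in measurable X]setTI; exact: measurable_cons_row.
apply: measure_semi_sigma_additive.
- by move=> k; exact: mpre.
- apply/trivIsetP => /= i j _ _ ij; rewrite -preimage_setI.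
  by move/trivIsetP : tF => /(_ _ _ _ _ ij) ->//; rewrite preimage_set0.
- by rewrite -preimage_bigcup; exact: mpre.
Qed.

HB.instance Definition _ := isMeasure.Build _ _ _ torus_step
  torus_step0 torus_step_ge0 torus_step_sigma_additive.

Let torus_step_fin : fin_num_fun torus_step.
Proof.
apply: lty_fin_num_fun.
suff : ((circle_measure \x m) (setT `*` setT) < +oo)%E by rewrite setXTT.
rewrite product_measure1E//.
by rewrite lte_mul_pinfty// ?fin_num_measure// -ge0_fin_numE ?fin_num_measure.
Qed.

HB.instance Definition _ := Measure_isFinite.Build _ _ _ torus_step torus_step_fin.

End torus_step.

(* Lebesgue measure of T^d, total mass (2 pi)^d *)
Fixpoint torus_measure (n : nat) : {finite_measure set 'rV[R]_n -> \bar R} :=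
  match n with
  | 0 => (\d_(0 : 'rV[R]_0) : {finite_measure set 'rV[R]_0 -> \bar R})
  | n.+1 => torus_step (torus_measure n)
  end.

End torus_measure.

Section complex_integrals.
Variable R : realType.

Definition cintegral {dT} {T : measurableType dT} (mu : {measure set T -> \bar R})
    (D : set T) (f : T -> R[i]) : R[i] :=
  (\int[mu]_(x in D) complex.Re (f x)) +i* (\int[mu]_(x in D) complex.Im (f x)).

Definition cintegrable {dT} {T : measurableType dT} (mu : {measure set T -> \bar R})
    (D : set T) (f : T -> R[i]) : Prop :=
  mu.-integrable D (EFin \o (fun x => complex.Re (f x))) /\
  mu.-integrable D (EFin \o (fun x => complex.Im (f x))).

(* unconditional sum *)
Definition csum {I : choiceType} (f : I -> R[i]) : R[i] :=
  summability.sum (fun i => complex.Re (f i) : R^o) +i*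
  summability.sum (fun i => complex.Im (f i) : R^o).

Definition expi (x : R) : R[i] := cos x +i* sin x.

End complex_integrals.

Section smoothness.
Variables (R : realType) (U : normedModType R).

Fixpoint Ck (n : nat) (f : U -> R^o) : Prop :=
  continuous f /\
  if n is m.+1 then
    forall v, (forall x, derivable f x v) /\ Ck m (fun x => 'D_v f x)
  else True.

Definition smooth (f : U -> R^o) : Prop := forall n, Ck n f.

Definition csmooth (f : U -> R[i]) : Prop :=
  smooth (fun x => complex.Re (f x)) /\ smooth (fun x => complex.Im (f x)).

End smoothness.

Section torus.
Variables (R : realType) (d : nat).
Local Notation V := 'rV[R]_d.
Local Notation Z := 'rV[int]_d.
Local Notation C := R[i].
Local Notation haar := (torus_measure R d).
Local Notation leb := (@lebesgue_measure R).

(* The torus is represented by the cell [0, 2 pi[^d: measures on T^d are Borel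
   measures carried by the cell, functions on T^d are 2 pi Z^d-periodic functions
   on R^d, and L^2(T^d) only sees the values on the cell. *)
Definition torus_cell : set V := [set x | forall i, circle_cell (x ord0 i)].

Definition toZ (k : Z) : V := map_mx intr k.

Definition torus_periodic {A B : Type} (f : V -> A -> B) : Prop :=
  forall (k : Z) x y, f (x + (2 * pi) *: toZ k) y = f x y.

Definition dotZ (k : Z) (x : V) : R := \sum_i toZ k ord0 i * x ord0 i.

Definition fourier (u : V -> C) (k : Z) : C :=
  cintegral haar setT
    (fun x => ((2 * pi) `^ (- (d%:R / 2)))%:C * (u x * expi (- dotZ k x))).

Definition L2 (u : V -> C) : Prop :=
  (fun x => complex.Re (u x)) \in Lfun haar 2%:E /\
  (fun x => complex.Im (u x)) \in Lfun haar 2%:E.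

Definition L2eq (u v : V -> C) : Prop := ae_eq haar setT u v.

Definition L2dot (u v : V -> C) : C :=
  cintegral haar setT (fun x => (u x)^* * v x).

Definition L2norm (u : V -> C) : R := Num.sqrt (complex.Re (L2dot u u)).

Definition trig_poly (u : V -> C) : Prop :=
  L2 u /\ exists s : seq Z, forall k, k \notin s -> fourier u k = 0.

Definition operator := (V -> C) -> (V -> C).

Definition bounded_operator (A : operator) : Prop :=
  [/\ forall u, L2 u -> L2 (A u),
      forall (c : C) u v, L2 u -> L2 v ->
        L2eq (A (fun x => c * u x + v x)) (fun x => c * A u x + A v x) &
      exists M : R, forall u, L2 u -> L2norm (A u) <= M * L2norm u].

Definition opnorm (A : operator) : R :=
  sup [set L2norm (A u) | u in [set u | L2 u /\ L2norm u <= 1]].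

Definition self_adjoint (A : operator) : Prop :=
  forall u v, L2 u -> L2 v -> L2dot u (A v) = L2dot (A u) v.

Definition unitary (A : operator) : Prop :=
  [/\ bounded_operator A,
      forall u v, L2 u -> L2 v -> L2dot (A u) (A v) = L2dot u v &
      forall v, L2 v -> exists u, L2 u /\ L2eq (A u) v].

Definition weyl_form (h : R) (a : V * V -> C) (u : V -> C) : C :=
  ((2 * pi) `^ (- (d%:R / 2)))%:C *
  csum (fun kj : Z * Z =>
    fourier u kj.1 * (fourier u kj.2)^* *
    fourier (fun x => a (x, (h / 2) *: toZ (kj.1 + kj.2))) (kj.2 - kj.1)).

(* A = Op_h(a): a bounded operator is determined by its quadratic form on
   trigonometric polynomials, for which the sum in weyl_form is finite. *)
Definition is_Op (h : R) (a : V * V -> C) (A : operator) : Prop :=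
  forall u, trig_poly u -> L2dot u (A u) = weyl_form h a u.

Definition wigner (h : R) (u : V -> C) (a : V * V -> C) : C := weyl_form h a u.

Definition Cc_infty (a : V * V -> C) : Prop :=
  [/\ csmooth a, torus_periodic (fun x xi => a (x, xi)) &
      exists M : R, forall x xi, M < `|xi| -> a (x, xi) = 0].

Definition admissible_perturbation (h0 : R) (Vh : R -> R -> operator) : Prop :=
  [/\ forall h t, 0 < h < h0 -> bounded_operator (Vh h t) /\ self_adjoint (Vh h t),
      forall h, 0 < h < h0 -> measurable_fun setT (fun t => opnorm (Vh h t)),
      forall K : set R, compact K -> exists M : R, forall h, 0 < h < h0 ->
        (\int[leb]_(t in K) (opnorm (Vh h t))%:E <= M%:E)%E &
      exists M : R, forall h, 0 < h < h0 ->
        {ae leb, forall t, opnorm (Vh h t) <= M}].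

(* i h d_t psi = (H(h D_x) + h^2 V_h(t)) psi, tested against exp(i k . x) and
   integrated in time; H(h D_x) is the Fourier multiplier H(h k). *)
Definition solves_schrodinger (H : V -> R) (h : R) (Vh : R -> operator)
    (psi : R -> V -> C) : Prop :=
  forall (k : Z) (s t : R), s <= t ->
    let rhs r := (H (h *: toZ k))%:C * fourier (psi r) k +
                 (h ^+ 2)%:C * fourier (Vh r (psi r)) k in
    cintegrable leb `[s, t] rhs /\
    'i%C * h%:C * (fourier (psi t) k - fourier (psi s) k) = cintegral leb `[s, t] rhs.

Definition propagator (H : V -> R) (h : R) (Vh : R -> operator)
    (S : R -> operator) : Prop :=
  [/\ forall t, unitary (S t),
      forall u, L2 u -> L2eq (S 0 u) u,
      forall u, L2 u -> forall t0,
        L2norm (fun x => S t u x - S t0 u x) @[t --> t0] --> (0 : R) &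
      forall u, L2 u -> solves_schrodinger H h Vh (fun t => S t u)].

(* Accumulation points of t |-> w^h_{S_h^{t/h} u_h}: neighbourhoods are given by
   finitely many pairs (theta, a) in L^1(R) x C_c^oo(T^* T^d), which generate the
   weak-* topology of L^oo(R; D') on bounded sets. A finite kernel is a measurable
   representative of an element of L^oo(R; M_+(T^* T^d)). *)
Definition Mtilde (h0 : R) (S : R -> R -> operator)
    (mu : R.-fker (measurableTypeR R) ~> (V * V)%type) : Prop :=
  (forall t, mu t (~` (torus_cell `*` setT)) = 0%E) /\
  exists (h : nat -> R) (u : nat -> V -> C),
    [/\ forall n, 0 < h n < h0,
        h @ \oo --> (0 : R),
        forall n, L2 (u n) /\ L2norm (u n) = 1 &
        forall (m : nat) (theta : 'I_m -> R -> R) (a : 'I_m -> V * V -> C),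
          (forall i, leb.-integrable setT (EFin \o theta i)) ->
          (forall i, Cc_infty (a i)) ->
          forall e : R, 0 < e -> forall N, exists2 n, (N <= n)%N &
            forall i, complex.Re `| cintegral leb setT (fun t =>
                (theta i t)%:C * wigner (h n) (S (h n) (t / h n) (u n)) (a i))
              - cintegral leb setT (fun t =>
                (theta i t)%:C * cintegral (mu t) setT (a i)) | < e].

Definition is_xi_marginal (mu : R.-fker (measurableTypeR R) ~> (V * V)%type)
    (mubar : {measure set V -> \bar R}) : Prop :=
  {ae leb, forall t, forall B, measurable B -> pushforward (mu t) snd B = mubar B}.

Definition is_disintegration (mu : R.-fker (measurableTypeR R) ~> (V * V)%type)
    (mubar : {measure set V -> \bar R})
    (muxi : R.-sfker (measurableTypeR R * V)%type ~> V) : Prop :=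
  forall (theta : R -> R) (f : V * V -> R),
    leb.-integrable setT (EFin \o theta) ->
    measurable_fun setT f -> (exists M : R, forall p, `|f p| <= M) ->
    (\int[leb]_t ((theta t)%:E * \int[mu t]_p (f p)%:E) =
     \int[leb]_t ((theta t)%:E *
       \int[mubar]_xi \int[muxi (t, xi)]_x (f (x, xi))%:E))%E.

Definition hessian (H : V -> R) (xi v : V) : R :=
  'D_v (fun eta => 'D_v (H : V -> R^o) eta : R^o) xi.

Definition definite (q : V -> R) : Prop :=
  (forall v, v != 0 -> 0 < q v) \/ (forall v, v != 0 -> q v < 0).

End torus.

(* Main.v *)
(* Sampling the solution at the lattice points h k of a small ball around a frequency where
   d^2 H is definite, the Fourier coefficients satisfy a Schroedinger system on Z^d whose
   potential only enters through its bounded operator norm. In the rotating frame the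
   coefficients move by O(delta) on a time window of length delta, so up to this error they
   may be frozen at the initial time, and the time average kills every pair of frequencies
   that is not nearly resonant. Definiteness makes the gradient of H strongly monotone on the
   ball, which forces the clusters of near-resonant frequencies to have uniformly bounded
   cardinality Q. On a sum of at most Q waves, Cauchy-Schwarz bounds the mass of a nonnegative
   observable by Q times the mass of its average over the torus. In the limit this gives, at
   almost every time and for every eps, some K with
     mu(t, w 1_E) <= K (dx (x) mubar)(w 1_E) + eps   for every Borel set E,
   where w is a bump function around the frequency; disintegrating, almost every conditional
   measure is absolutely continuous. *)

Require Import Defs.
From HB Require Import structures.
From mathcomp Require Import all_boot all_order all_algebra finmap complex.
From mathcomp Require Import boolp zify ring lra.

Set Implicit Arguments.
Unset Strict Implicit.
Unset Printing Implicit Defensive.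

Import Order.TTheory GRing.Theory Num.Theory.

Local Open Scope ring_scope.

(** * Clusters of near-resonant lattice points *)

Section l1_norm.
Variables (R : realFieldType) (d : nat).
Implicit Types u v w : 'rV[R]_d.

(** The obstacle is an order of quantifiers. Being near resonant depends on a threshold [N], which
    has to exceed the frequencies of the test symbol and to grow as the time window shrinks; the
    factor [Q] has to be fixed before the symbol, or no inequality survives the passage to Borel
    sets. Clusters have finite diameter for every [N], but with a bound that depends on [N]. What
    does not depend on [N] is the number of points of a cluster whose [near_rank], the largest
    dimension spanned by the steps of a near-resonant path, is already attained at a fixed threshold
    [N0]. This rank is an integer at most [d] and nondecreasing in the threshold, so its average
    against the mass of the wave stabilizes along an ultrafilter: the remaining points carry little
    mass and go into the error [eps]. The same ultrafilter turns accumulation into convergence for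
    all tests at once. The test functions are generated from finitely many atoms by [1 - f g], an
    operation that preserves both trigonometric polynomials and values in [0, 1]; the latter is what
    the positivity argument on a cluster requires. *)

Definition l1 v : R := \sum_i `|v ord0 i|.
Definition dot u v : R := \sum_i u ord0 i * v ord0 i.

Lemma l1_ge0 v : 0 <= l1 v. Proof. exact: sumr_ge0. Qed.

Lemma l10 : l1 0 = 0.
Proof. by rewrite /l1 big1 // => i _; rewrite mxE normr0. Qed.

Lemma l1N v : l1 (- v) = l1 v.
Proof. by apply: eq_bigr => i _; rewrite mxE normrN. Qed.

Lemma le_l1 v i : `|v ord0 i| <= l1 v.
Proof. by rewrite /l1 (bigD1 i) //= lerDl sumr_ge0. Qed.

Lemma dotBl u v w : dot (u - v) w = dot u w - dot v w.
Proof. by rewrite /dot -sumrB; apply: eq_bigr => i _; rewrite !mxE mulrBl. Qed.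

Lemma dotC u v : dot u v = dot v u.
Proof. by apply: eq_bigr => i _; rewrite mulrC. Qed.

Lemma dotE u v : dot u v = (u *m v^T) ord0 ord0.
Proof. by rewrite mxE; apply: eq_bigr => i _; rewrite mxE. Qed.

End l1_norm.

Section step_matrix.
Variables (R : realFieldType) (d N : nat).

Let T := 'rV['I_(N + N).+1]_d.

(* One row for each integer vector with entries in [-N, N]. *)
Definition step_mx : 'M[R]_(#|T|, d) :=
  \matrix_(i, j) (((enum_val i : T) ord0 j)%:R - N%:R).

Lemma step_mxP (n : 'rV[int]_d) : l1 (map_mx intr n : 'rV[R]_d) <= N%:R ->
  exists i, row i step_mx = map_mx intr n.
Proof.
move=> nN.
have nb j : (`|n ord0 j| <= N)%N.
  have := le_trans (le_l1 (map_mx intr n : 'rV[R]_d) j) nN.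
  by rewrite mxE -intr_norm pmulrn ler_int -abszE lez_nat.
pose t : T := \row_j inord (absz (n ord0 j + N%:Z)).
exists (enum_rank t); apply/rowP => j; rewrite !mxE enum_rankK mxE.
have nge : 0 <= n ord0 j + N%:Z by have := nb j; lia.
rewrite inordK; last by have := nb j; lia.
by rewrite [X in X - _]pmulrn gez0_abs // rmorphD /= addrK.
Qed.

(** The row space collects the small integer steps along which a phase with gradient [g] varies by
    at most [K]; the rejected rows are set to zero so that all these matrices have the same
    shape. *)
Definition slow_space (K : R) (g : 'rV[R]_d) : 'M[R]_(#|T|, d) :=
  \matrix_(i, j) (if `|dot g (row i step_mx)| <= K then step_mx i j else 0).

Lemma slow_space_step K g (n : 'rV[int]_d) (v := map_mx intr n : 'rV[R]_d) :
  l1 v <= N%:R -> `|dot g v| <= K -> (v <= slow_space K g)%MS.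
Proof.
move=> nN gK; have [i iv] := step_mxP nN.
suff vE : row i (slow_space K g) = v by rewrite -vE; exact: row_sub.
apply/rowP => j; rewrite mxE mxE iv gK.
by have /rowP/(_ j) := iv; rewrite mxE.
Qed.

Lemma slow_space_le K K' g : K <= K' -> (slow_space K g <= slow_space K' g)%MS.
Proof.
move=> KK'; apply/row_subP => i.
have [gK|gK] := boolP (`|dot g (row i step_mx)| <= K).
  suff -> : row i (slow_space K g) = row i (slow_space K' g) by exact: row_sub.
  by apply/rowP => j; rewrite !mxE gK (le_trans gK KK').
suff -> : row i (slow_space K g) = 0 by exact: sub0mx.
by apply/rowP => j; rewrite !mxE (negbTE gK).
Qed.

(** [C] does not depend on [K] or [g]: a slow space is spanned by a subset of a fixed finite set of
    rows, so only finitely many pseudo-inverses occur. Writing [m] as a combination of these rows by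
    the pseudo-inverse bounds its coefficients by [l1 m], and [g] is at most [K] on each row. *)
Lemma slow_space_bound : exists2 C : R, 0 <= C &
  forall K g m, 0 <= K -> (m <= slow_space K g)%MS -> `|dot g m| <= C * K * l1 m.
Proof.
(* The matrix with the rows outside [S] set to zero: a slow space depends on [K] and [g] only
   through [S]. *)
pose B (S : {set 'I_#|T|}) : 'M[R]_(#|T|, d) :=
  \matrix_(i, j) (if i \in S then step_mx i j else 0).
pose c S : R := \sum_a \sum_b `|pinvmx (B S) a b|.
have c0 S : 0 <= c S by apply: sumr_ge0 => a _; apply: sumr_ge0.
exists (\sum_S c S); first by apply: sumr_ge0.
move=> K g m K0.
have -> : slow_space K g = B [set i | `|dot g (row i step_mx)| <= K].
  by apply/matrixP => i j; rewrite !mxE inE.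
set S := [set i | _] => mS.
apply: (@le_trans _ _ (c S * K * l1 m)); last first.
  rewrite ler_wpM2r ?l1_ge0 // ler_wpM2r //.
  by rewrite (bigD1 S) //= lerDl sumr_ge0.
rewrite dotC dotE -[X in X *m _](mulmxKpV mS) -(mulmxA _ (B S)) mxE.
apply: le_trans (ler_norm_sum _ _ _) _.
apply: (@le_trans _ _ (\sum_b `|(m *m pinvmx (B S)) ord0 b| * K)).
  apply: ler_sum => b _; rewrite normrM ler_wpM2l //.
  have -> : (B S *m g^T) b ord0 = if b \in S then dot g (row b step_mx) else 0.
    rewrite mxE; case: ifP => bS.
      by apply: eq_bigr => j _; rewrite !mxE bS mulrC.
    by rewrite big1 // => j _; rewrite !mxE bS mul0r.
  by case: ifP; rewrite ?normr0 // inE.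
rewrite -mulr_suml mulrAC ler_wpM2r //.
rewrite /c exchange_big mulr_suml /= ler_sum // => b _.
rewrite mxE; apply: le_trans (ler_norm_sum _ _ _) _.
rewrite mulr_suml ler_sum // => a _.
by rewrite normrM mulrC ler_wpM2l // le_l1.
Qed.

End step_matrix.

(** * Near-resonant clusters: rank, diameter and cardinality *)

Section clusters.
Variables (R : archiRealFieldType) (d : nat).

Section sector.
Variables (X : finType) (zz : X -> 'rV[int]_d) (K : pred X) (A : X -> R)
  (G : X -> 'rV[R]_d).
Local Notation kk x := (map_mx intr (zz x) : 'rV[R]_d).

(* [A] is a phase on lattice points, [G] its gradient: the last condition is the
   strong monotonicity which the definiteness of the Hessian provides. *)
Definition monotone_phase (L c : R) : Prop :=
  [/\ forall x y, K x -> K y ->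
        `|A y - A x - dot (G x) (kk y - kk x)| <= L * l1 (kk y - kk x) ^+ 2,
      forall x y m, K x -> K y ->
        `|dot (G x - G y) m| <= L * l1 (kk x - kk y) * l1 m &
      forall x y, K x -> K y ->
        c * l1 (kk x - kk y) ^+ 2 <= `|dot (G x - G y) (kk x - kk y)|].

Definition near_resonant (N : nat) : rel X := fun x y =>
  [&& K x, K y, l1 (kk y - kk x) <= N%:R & `|A y - A x| <= N%:R].

Lemma near_resonant_sym N : symmetric (near_resonant N).
Proof.
move=> x y; rewrite /near_resonant -(l1N (kk y - kk x)) opprB.
by rewrite (distrC (A y)) andbCA.
Qed.

Lemma near_resonant_le N N' x y : (N <= N')%N ->
  near_resonant N x y -> near_resonant N' x y.
Proof.
move=> NN' /and4P[Kx Ky xy Axy]; apply/and4P; split => //.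
  by rewrite (le_trans xy) // ler_nat.
by rewrite (le_trans Axy) // ler_nat.
Qed.

(** Paths may be arbitrarily long; it is the dimension of this span, at most [d], that drives the
    induction. *)
Fixpoint path_span (x : X) (s : seq X) : 'M[R]_d :=
  if s is y :: s' then ((kk y - kk x) + path_span y s')%MS else 0.

Lemma path_span_cat x s1 s2 :
  (path_span x (s1 ++ s2) :=: path_span x s1 + path_span (last x s1) s2)%MS.
Proof.
elim: s1 x => [|y s1 IH] x /=; first exact: eqmx_sym (adds0mx _ _).
apply: eqmx_trans (adds_eqmx (eqmx_refl _) (IH y)) _.
by rewrite addsmxA.
Qed.

Lemma path_span_rcons x s y :
  (path_span x (rcons s y) :=: path_span x s + (kk y - kk (last x s)))%MS.
Proof.
rewrite -cats1; apply: eqmx_trans (path_span_cat _ _ _) _ => /=.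
by apply: adds_eqmx => //; exact: addsmx0.
Qed.

Lemma last_sub_path_span x s : (kk (last x s) - kk x <= path_span x s)%MS.
Proof.
elim: s x => [|y s IH] x /=; first by rewrite subrr sub0mx.
rewrite -(subrKA (kk y)) addrC addmx_sub_adds //.
Qed.

(** The maximum runs over the finite type of ranks up to [d], since there may be infinitely many
    paths from [x]. *)
Definition near_rank (N : nat) (x : X) : nat :=
  \max_(r < d.+1 | `[< exists2 s, path (near_resonant N) x s &
                       (r <= \rank (path_span x s))%N >]) r.

Lemma near_rank_ge N x s : path (near_resonant N) x s ->
  (\rank (path_span x s) <= near_rank N x)%N.
Proof.
move=> ps; have rd : (\rank (path_span x s) < d.+1)%N by rewrite ltnS rank_leq_row.
by apply: (@leq_bigmax_cond _ _ (fun r : 'I_d.+1 => val r) (Ordinal rd)); apply/asboolP; exists s.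
Qed.

Lemma near_rank_attained N x : exists2 s, path (near_resonant N) x s &
  (near_rank N x <= \rank (path_span x s))%N.
Proof.
rewrite /near_rank.
pose P := [pred r : 'I_d.+1 | `[< exists2 s, path (near_resonant N) x s &
                                (r <= \rank (path_span x s))%N >]].
have P0 : (0 < #|P|)%N.
  by apply/card_gt0P; exists ord0; rewrite inE; apply/asboolP; exists [::].
have [i Pi] := eq_bigmax_cond (fun r : 'I_d.+1 => val r) P0.
have -> : \max_(j in P) val j = \max_(r < d.+1 | P r) r by apply: eq_bigl.
by rewrite /P /= => ->; move: Pi; rewrite inE => /asboolP.
Qed.

Lemma near_rank_le_dim N x : (near_rank N x <= d)%N.
Proof. by apply/bigmax_leqP => i _; rewrite -ltnS. Qed.

Lemma near_rank_homo N N' x : (N <= N')%N -> (near_rank N x <= near_rank N' x)%N.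
Proof.
move=> NN'; have [s ps] := near_rank_attained N x; move=> /leq_trans; apply.
by apply: near_rank_ge; apply: sub_path ps => u v; exact: near_resonant_le.
Qed.

(** A path from [u] to [v] can be prefixed to any path issued from [v], and this only enlarges the
    span. *)
Lemma near_rank_connect N x y : connect (near_resonant N) x y ->
  near_rank N x = near_rank N y.
Proof.
have le u v : connect (near_resonant N) u v -> (near_rank N v <= near_rank N u)%N.
  move=> /connectP[s ps ->]; have [s' ps'] := near_rank_attained N (last u s).
  move=> /leq_trans; apply; apply: leq_trans (near_rank_ge (s := s ++ s') _); last first.
    by rewrite cat_path ps.
  by apply: mxrankS; rewrite path_span_cat addsmxSr.
move=> xy; apply/eqP; rewrite eqn_leq !le //.
by rewrite (sym_connect_sym (near_resonant_sym N)).
Qed.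

(** At a point [y] where the rank has stabilized, an [N]-path from [y] of maximal rank is still of
    maximal rank among the [N']-paths. Prefixing an [N']-path from [x] to [y] therefore cannot
    enlarge its span, which must contain the displacement between [x] and [y]. *)
Lemma near_rank_disp N N' x y : (N <= N')%N -> connect (near_resonant N') x y ->
  near_rank N y = near_rank N' y ->
  exists2 s, path (near_resonant N) y s & (kk y - kk x <= path_span y s)%MS.
Proof.
move=> NN' xy rky; have [s ps rks] := near_rank_attained N y; exists s => //.
move/connectP: (xy) => [s0 ps0 yE].
have ps' : path (near_resonant N') y s.
  by apply: sub_path ps => u v; exact: near_resonant_le.
have := @near_rank_ge N' x (s0 ++ s); rewrite cat_path ps0 -yE ps' /=.
rewrite (near_rank_connect xy) -rky path_span_cat -yE => rkle.
have {}rkle := leq_trans (rkle isT) rks.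
apply: submx_trans (_ : (_ <= path_span x s0 + path_span y s)%MS) _.
  apply: submx_trans (addsmxSl _ _); rewrite [X in (map_mx intr (zz X) - _)%R]yE.
  exact: last_sub_path_span.
(* Inclusion and the comparison of ranks give equal spans. *)
by rewrite -(geq_leqif (mxrank_leqif_sup (addsmxSr _ _))).
Qed.

End sector.

(** Strong monotonicity bounds [c * l1 m ^+ 2] by the variation of the gradient along [m] between
    the two ends, and slowness at both ends bounds the latter by [2 * B * C * l1 m]. *)
Lemma slow_displacement N (L c : R) (C : R) : 0 < c -> 0 <= C -> exists2 D, 0 <= D &
  forall (X : finType) (zz : X -> 'rV[int]_d) K A G, monotone_phase zz K A G L c ->
  forall x y (m := map_mx intr (zz x) - map_mx intr (zz y) : 'rV[R]_d), K x -> K y ->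
    (m <= slow_space N C (G x))%MS -> (m <= slow_space N C (G y))%MS -> l1 m <= D.
Proof.
move=> c0 C0; have [B B0 HB] := slow_space_bound R d N.
exists (2 * B * C / c); first by rewrite divr_ge0 ?(ltW c0) // !mulr_ge0.
move=> X zz K A G [_ _ h3] x y m Kx Ky mx my.
have b1 := HB _ _ _ C0 mx; have b2 := HB _ _ _ C0 my.
have := h3 _ _ Kx Ky; rewrite -/m dotBl => h.
have {}h := le_trans h (ler_normB _ _).
have m0 := l1_ge0 m.
have [->|mn0] := eqVneq (l1 m) 0; first by rewrite divr_ge0 ?(ltW c0) // !mulr_ge0.
have mp : 0 < l1 m by rewrite lt0r mn0.
rewrite ler_pdivlMr // -(ler_pM2r mp); lra.
Qed.

(** Induction on the rank, not on the length. A step that raises the rank is adjacent to a portion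
    of smaller rank, whose ends are within [D] of each other by induction; carrying the slowness of
    the step from one end to the other costs [L * D * N]. Slowness at both ends then bounds the
    displacement by [slow_displacement]. The constants are chosen before the finite set of points
    and the phase. *)
Lemma path_span_control N (L c : R) r : 0 <= L -> 0 < c -> exists C D : R,
  [/\ 0 <= C, 0 <= D & forall (X : finType) (zz : X -> 'rV[int]_d) K A G,
    monotone_phase zz K A G L c ->
    forall x s, path (near_resonant zz K A N) x s ->
    (\rank (path_span zz x s) <= r)%N ->
    [/\ (path_span zz x s <= slow_space N C (G x))%MS,
        (path_span zz x s <= slow_space N C (G (last x s)))%MS &
        l1 (map_mx intr (zz (last x s)) - map_mx intr (zz x) : 'rV[R]_d) <= D]].
Proof.
move=> L0 c0; elim: r => [|r [C [D [C0 D0 IH]]]].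
  exists 0, 0; split=> // X zz K A G hG x s _.
  rewrite leqn0 mxrank_eq0 => /eqP s0; rewrite s0 !sub0mx; split=> //.
  have := last_sub_path_span zz x s; rewrite s0 submx0 => /eqP ->.
  by rewrite l10.
(* [N] and the quadratic term bound the derivative of the phase along one step, by Taylor's
   estimate; [L * D * N] is the cost of moving the base point by [D]. *)
pose C' := C + N%:R + 2 * (L * N%:R ^+ 2) + L * D * N%:R.
have N0 : 0 <= N%:R :> R by [].
have LN0 : 0 <= L * N%:R ^+ 2 by rewrite mulr_ge0 // exprn_ge0.
have LDN0 : 0 <= L * D * N%:R by rewrite !mulr_ge0.
have C'0 : 0 <= C' by rewrite /C'; lra.
have CC' : C <= C' by rewrite /C'; lra.
have [D' D'0 HD] := slow_displacement N L c0 C'0.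
exists C', D'; split=> //.
move=> X zz K A G hG.
set e := near_resonant zz K A N.
pose kk x : 'rV[R]_d := map_mx intr (zz x).
have [h1 h2 h3] := hG.
have kkB x y : kk y - kk x = map_mx intr (zz y - zz x) by rewrite map_mxB.
have step x y : e x y -> `|dot (G x) (kk y - kk x)| <= N%:R + L * N%:R ^+ 2.
  move=> /and4P[Kx Ky xyN AN].
  have := h1 x y Kx Ky; rewrite -/(kk x) -/(kk y).
  have lN : L * l1 (kk y - kk x) ^+ 2 <= L * N%:R ^+ 2.
    by rewrite ler_wpM2l // lerXn2r // nnegrE ?l1_ge0.
  move=> hh; have := le_trans hh lN; move: AN.
  by rewrite !ler_norml; move=> /andP[a1 a2] /andP[b1 b2]; apply/andP; split; lra.
have change x y m : K x -> K y -> l1 (kk y - kk x) <= D -> l1 m <= N%:R ->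
    `|dot (G x) m| <= `|dot (G y) m| + L * D * N%:R.
  move=> Kx Ky xyD mN; rewrite -lerBlDl.
  apply: le_trans (lerB_dist _ _) _; rewrite -dotBl.
  apply: le_trans (h2 _ _ _ Kx Ky) _; rewrite -/(kk x) -/(kk y).
  rewrite -(l1N (kk x - kk y)) opprB ler_pM ?mulr_ge0 ?l1_ge0 //.
  by rewrite ler_wpM2l.
have Klast x s : path e x s -> K x -> K (last x s).
  elim: s x => //= y s IHs x /andP[/and4P[_ Ky _ _] ps] _; exact: IHs.
(* The path is read from its end: only a last step outside the span of its predecessors needs an
   argument, and then the prefix has rank at most [r]. *)
have left x s : path e x s -> (\rank (path_span zz x s) <= r.+1)%N ->
    (path_span zz x s <= slow_space N C' (G x))%MS.
  elim/last_ind: s => [|s y IHs]; first by rewrite sub0mx.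
  rewrite rcons_path => /andP[ps sy].
  have rE := path_span_rcons zz x s y; rewrite rE => rk; rewrite rE.
  have [sub|nsub] := boolP (kk y - kk (last x s) <= path_span zz x s)%MS.
    have E := addsmx_idPl sub; rewrite E in rk; rewrite E; exact: IHs.
  have lt : (\rank (path_span zz x s) <
             \rank (path_span zz x s + (kk y - kk (last x s))%R)%MS)%N.
    apply: rank_ltmx; rewrite ltmxE addsmxSl /=.
    by apply: contra nsub; apply: submx_trans; exact: addsmxSr.
  have rk' : (\rank (path_span zz x s) <= r)%N by rewrite -ltnS (leq_trans lt).
  have [sC _ sD] := IH _ _ _ _ _ hG _ _ ps rk'.
  rewrite addsmx_sub (submx_trans sC (slow_space_le _ _ CC')) /=.
  have /and4P[Kl Ky lyN _] := sy.
  have Kx : K x by case: (s) ps Kl => [|z s'] //= /andP[/and4P[]].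
  rewrite kkB; apply: slow_space_step; rewrite -?kkB //.
  apply: le_trans (change _ _ _ Kx Kl sD lyN) _.
  by have := step _ _ sy; rewrite /C'; lra.
(* The mirror statement, with the path read from its start. *)
have right x s : path e x s -> (\rank (path_span zz x s) <= r.+1)%N ->
    (path_span zz x s <= slow_space N C' (G (last x s)))%MS.
  elim: s x => [|y s IHs] x; first by rewrite sub0mx.
  move=> /= /andP[xy ps] rk.
  have [sub|nsub] := boolP (kk y - kk x <= path_span zz y s)%MS.
    have E := addsmx_idPr sub; rewrite E in rk; rewrite E; exact: IHs.
  have lt : (\rank (path_span zz y s) <
             \rank ((kk y - kk x)%R + path_span zz y s)%MS)%N.
    apply: rank_ltmx; rewrite ltmxE addsmxSr /=.
    by apply: contra nsub; apply: submx_trans; exact: addsmxSl.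
  have rk' : (\rank (path_span zz y s) <= r)%N by rewrite -ltnS (leq_trans lt).
  have [_ sC sD] := IH _ _ _ _ _ hG _ _ ps rk'.
  rewrite addsmx_sub (submx_trans sC (slow_space_le _ _ CC')) andbT.
  have /and4P[Kx Ky xyN _] := xy.
  have Kl := Klast _ _ ps Ky.
  rewrite kkB; apply: slow_space_step; rewrite -?kkB //.
  have sD' : l1 (kk y - kk (last y s)) <= D by rewrite -l1N opprB.
  apply: le_trans (change _ _ _ Kl Ky sD' xyN) _.
  have yx : e y x by rewrite /e near_resonant_sym.
  have := step _ _ yx.
  have -> : dot (G y) (kk x - kk y) = - dot (G y) (kk y - kk x).
    by rewrite -opprB /dot -sumrN; apply: eq_bigr => i _; rewrite mxE mulrN.
  by rewrite normrN /C'; lra.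
move=> x s ps rk; have l := left _ _ ps rk; have rr := right _ _ ps rk.
split=> //; rewrite -/(kk x) -/(kk (last x s)); set m := kk (last x s) - kk x.
(* A point outside [K] has no neighbour, so its path is empty. *)
have [Kx|nKx] := boolP (K x); last first.
  have -> : m = 0.
    rewrite /m; case: (s) ps => [|y s'] /=; first by rewrite subrr.
    by move=> /andP[/and4P[Kx]]; rewrite Kx in nKx.
  by rewrite l10.
have Kl := Klast _ _ ps Kx.
have ms := last_sub_path_span zz x s; rewrite -/(kk x) -/(kk (last x s)) -/m in ms.
exact: HD (hG) _ _ Kl Kx (submx_trans ms rr) (submx_trans ms l).
Qed.

(** The rank never exceeds [d], so the control applies to all paths. Here [D] depends on [N]. *)
Lemma cluster_diam N (L c : R) : 0 <= L -> 0 < c -> exists2 D : R, 0 <= D &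
  forall (X : finType) (zz : X -> 'rV[int]_d) K A G, monotone_phase zz K A G L c ->
  forall x y, connect (near_resonant zz K A N) x y ->
    l1 (map_mx intr (zz y) - map_mx intr (zz x) : 'rV[R]_d) <= D.
Proof.
move=> L0 c0; have [C [D [_ D0 HC]]] := path_span_control N d L0 c0.
exists D => // X zz K A G hG x y /connectP[s ps ->].
by have [_ _] := HC _ _ _ _ _ hG _ _ ps (rank_leq_row _).
Qed.

Lemma lattice_card (X : finType) (zz : X -> 'rV[int]_d) M (S : {set X}) :
  injective zz -> (forall x y, x \in S -> y \in S ->
    l1 (map_mx intr (zz x) - map_mx intr (zz y) : 'rV[R]_d) <= M%:R) ->
  (#|S| <= #|{: 'rV['I_(M + M).+1]_d}|)%N.
Proof.
move=> zinj; have [->|[x0 x0S] SM] := set_0Vmem S; first by rewrite cards0.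
(* Coordinates relative to [x0], shifted by [M] to become natural numbers. *)
pose f x : 'rV['I_(M + M).+1]_d := \row_j inord (absz (zz x ord0 j - zz x0 ord0 j + M%:Z)).
suff finj : {in S &, injective f} by rewrite -(card_in_imset finj) max_card.
have bnd x j : x \in S -> (`|zz x ord0 j - zz x0 ord0 j| <= M)%N.
  move=> xS; have := SM x x0 xS x0S; rewrite -map_mxB => h.
  have := le_trans (le_l1 _ j) h.
  by rewrite !mxE -intr_norm pmulrn ler_int -abszE lez_nat.
move=> x y xS yS /rowP fxy; apply: zinj; apply/rowP => j.
have := fxy j; rewrite !mxE => /(congr1 val) /=.
have := bnd x j xS; have := bnd y j yS => bx bY.
rewrite !inordK; [|lia|lia]; rewrite -[zz x 0 j]/(zz x ord0 j) -[zz y 0 j]/(zz y ord0 j); lia.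
Qed.

(** [Q] depends on [N] but not on [N']. Between two points of stabilized rank in one [N']-cluster,
    the displacement lies in spans of [N]-paths issued from either point, hence in the slow spaces
    of both for a constant attached to [N], and [slow_displacement] bounds it. Lattice points at
    bounded mutual distance are boundedly many. *)
Lemma cluster_card N (L c : R) : 0 <= L -> 0 < c -> exists Q : nat,
  forall (X : finType) (zz : X -> 'rV[int]_d) K A G,
    monotone_phase zz K A G L c -> injective zz ->
  forall N' x0, (N <= N')%N ->
    (#|[set x | connect (near_resonant zz K A N') x0 x &&
               (near_rank zz K A N x == near_rank zz K A N' x)]| <= Q)%N.
Proof.
move=> L0 c0; have [C [D [C0 D0 HC]]] := path_span_control N d L0 c0.
have [D' D'0 HD] := slow_displacement N L c0 C0.
have [M DM] : exists M : nat, D' <= M%:R.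
  by exists (Num.bound D'); rewrite ltW // archi_boundP.
exists #|{: 'rV['I_(M + M).+1]_d}| => X zz K A G hG zinj N' x0 NN'.
apply: lattice_card zinj _ => x y; rewrite !inE => /andP[x0x /eqP rx] /andP[x0y /eqP ry].
have sym := sym_connect_sym (near_resonant_sym zz K A N').
have xy : connect (near_resonant zz K A N') x y.
  by apply: connect_trans x0y; rewrite sym.
have [->|nxy] := eqVneq x y; first by rewrite subrr l10.
have [s ps sE] := near_rank_disp NN' xy ry.
have yx : connect (near_resonant zz K A N') y x by rewrite sym.
have [t pt tE] := near_rank_disp NN' yx rx.
have Kc u v : connect (near_resonant zz K A N') u v -> u != v -> K u.
  by move=> /connectP[[|w p] /=]; [move=> _ -> /eqP|move=> /andP[/and4P[]]].
apply: le_trans DM; apply: (HD _ zz _ _ _ hG); first exact: Kc xy nxy.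
- by apply: Kc yx _; rewrite eq_sym.
- by have [h _ _] := HC _ _ _ _ _ hG _ _ pt (rank_leq_row _); exact: submx_trans h.
- have [h _ _] := HC _ _ _ _ _ hG _ _ ps (rank_leq_row _).
  by rewrite -opprB eqmx_opp; exact: submx_trans h.
Qed.

End clusters.

From mathcomp Require Import all_classical all_reals all_analysis.
From mathcomp Require Import showcase.summability measurable_realfun.

Import Order.TTheory GRing.Theory Num.Theory.
Import numFieldNormedType.Exports.

Local Open Scope classical_set_scope.
Local Open Scope ring_scope.
Local Open Scope complex_scope.

(** * Fourier analysis on the torus *)

Section real_integrable.
Context dT (T : measurableType dT) (R : realType) (mu : {measure set T -> \bar R}) (D : set T).
Hypothesis mD : measurable D.
Implicit Types f g : T -> R.

Lemma integrableZR k f : mu.-integrable D (EFin \o f) ->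
  mu.-integrable D (EFin \o (fun x => k * f x)).
Proof. exact: integrableZl. Qed.

Lemma integrableDR f g : mu.-integrable D (EFin \o f) -> mu.-integrable D (EFin \o g) ->
  mu.-integrable D (EFin \o (fun x => f x + g x)).
Proof. exact: integrableD. Qed.

Lemma integrableBR f g : mu.-integrable D (EFin \o f) -> mu.-integrable D (EFin \o g) ->
  mu.-integrable D (EFin \o (fun x => f x - g x)).
Proof. exact: integrableB. Qed.

Lemma integrable_sumR I (r : seq I) (f : I -> T -> R) :
  (forall i, mu.-integrable D (EFin \o f i)) ->
  mu.-integrable D (EFin \o (fun x => \sum_(i <- r) f i x)).
Proof.
move=> fi; elim: r => [|i r IH].
  by under eq_fun do rewrite big_nil; exact: integrable0.
by under eq_fun do rewrite big_cons; exact: integrableDR.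
Qed.

Lemma Rintegral_sum I (r : seq I) (f : I -> T -> R) :
  (forall i, mu.-integrable D (EFin \o f i)) ->
  \int[mu]_(x in D) (\sum_(i <- r) f i x) = \sum_(i <- r) \int[mu]_(x in D) f i x.
Proof.
move=> fi; elim: r => [|i r IH].
  by under eq_Rintegral do rewrite big_nil; rewrite big_nil Rintegral_cst // mul0r.
under eq_Rintegral do rewrite big_cons; rewrite big_cons -IH RintegralD //.
exact: integrable_sumR.
Qed.

End real_integrable.

Section torus_integrals.
Variable R : realType.
Local Notation leb := (@lebesgue_measure R).

Lemma bounded_integrable dT (T : measurableType dT)
    (mu : {finite_measure set T -> \bar R}) (f : T -> R) (M : R) :
  measurable_fun setT f -> (forall x, `|f x| <= M) ->
  mu.-integrable setT (EFin \o f).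
Proof.
move=> mf fM; apply: measurable_bounded_integrable => //.
  by rewrite ltey_eq fin_num_measure.
by exists M; split=> [|N MN x _ /=]; rewrite ?num_real // (le_trans (fM x)) // ltW.
Qed.

Lemma integral_circle (f : measurableTypeR R -> R) : measurable_fun setT f ->
    (exists M, forall x, `|f x| <= M) ->
  (\int[@circle_measure R]_x (f x)%:E = \int[leb]_(x in `[0%R, (2 * pi)%R[) (f x)%:E)%E.
Proof.
move=> mf [M fM].
have mD : measurable (@circle_cell R) by exact: measurable_itv.
rewrite (@negligible_integral _ _ _ _ _ (~` @circle_cell R)) //=; first last.
- by rewrite /circle_measure /mfrestr /mrestr /= setICl measure0.
- exact: bounded_integrable fM.
- exact: measurableC.
rewrite setTD setCK; apply: eq_measure_integral => A mA AD.
by rewrite /= /circle_measure /mfrestr /mrestr /= setIidl.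
Qed.

Lemma measurable_coord d (i : 'I_d) :
  measurable_fun setT (fun x : 'rV[R]_d => x ord0 i).
Proof.
move=> _ A mA; rewrite setTI; apply: sub_sigma_algebra.
by exists ord0, i, A.
Qed.

Lemma measurable_dotZ d (n : 'rV[int]_d) : measurable_fun setT (@dotZ R d n).
Proof.
apply: measurable_sum => i; apply: measurable_funM => //.
exact: measurable_coord.
Qed.

Lemma measurable_cos_dotZ d (n : 'rV[int]_d) c :
  measurable_fun setT (fun x : 'rV[R]_d => cos (dotZ n x + c)).
Proof.
apply: measurableT_comp; last by apply: measurable_funD => //; exact: measurable_dotZ.
by apply: continuous_measurable_fun; exact: continuous_cos.
Qed.

Lemma dotZ_cons_row d (n : 'rV[int]_d.+1) (x : R) y :
  dotZ n (cons_row (x, y)) =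
  (n ord0 ord0)%:~R * x + dotZ (\row_j n ord0 (lift ord0 j)) y.
Proof.
rewrite /dotZ big_ord_recl /=; congr (_ + _).
  congr (_ * _); first by rewrite mxE.
  have -> : ord0 = lshift d (ord0 : 'I_1) :> 'I_(1 + d) by exact: val_inj.
  by apply: etrans (row_mxEl _ _ _ _) _; rewrite mxE.
apply: eq_bigr => i _; congr (_ * _); first by rewrite !mxE.
have -> : lift ord0 i = rshift 1 i :> 'I_(1 + d) by exact: val_inj.
exact: row_mxEr.
Qed.

Lemma integral_cos_affine (a b w c : R) : a <= b -> w != 0 ->
  (\int[leb]_(x in `[a, b]) (cos (w * x + c))%:E =
   ((sin (w * b + c) - sin (w * a + c)) / w)%:E)%E.
Proof.
move=> ab w0; move: ab; rewrite le_eqVlt => /orP[/eqP ->|ab].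
  by rewrite set_itv1 integral_set1 subrr mul0r.
pose F x := sin (w * x + c) / w.
have dF (x : R) : is_derive x 1 F (cos (w * x + c)).
  have d1 : is_derive x 1 (fun x : R => w * x + c) w.
    by apply: is_derive_eq; rewrite addr0 /GRing.scale /= mulr1.
  have d2 := @is_derive1_comp _ sin (fun x : R => w * x + c) x _ _ (is_derive_sin _) d1.
  have -> : F = w^-1 \*: (sin \o (fun x : R => w * x + c)).
    by apply/funext => y; rewrite /F mulrC.
  by apply: is_derive_eq; rewrite /GRing.scale /=; field.
have cF : continuous F.
  move=> x; apply: differentiable_continuous; apply/derivable1_diffP.
  by have [] := dF x.
rewrite (@continuous_FTC2 _ _ F a b ab) //.
- by rewrite -EFinB /F -mulrBl.
- apply: continuous_subspaceT => x; apply: continuous_comp; last exact: continuous_cos.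
  by apply: cvgD; [apply: cvgM; [exact: cvg_cst|exact: cvg_id]|exact: cvg_cst].
- split; first by move=> x _; have [] := dF x.
  + by apply: cvg_at_right_filter; exact: cF.
  + by apply: cvg_at_left_filter; exact: cF.
- by move=> x _; rewrite derive1E; have [_ ->] := dF x.
Qed.

Lemma sin_int_period (m : int) (c : R) : sin (m%:~R * (2 * pi) + c) = sin c.
Proof.
rewrite (mulr_natl pi 2); have P n y : sin (y + n%:R * (pi *+ 2)) = sin y :> R.
  elim: n y => [|n IH] y; first by rewrite mul0r addr0.
  rewrite -natr1 mulrDl mul1r addrA.
  by rewrite sinD2pi IH.
case: m => n; first by rewrite addrC P.
by rewrite NegzE mulrNz mulNr addrC -[LHS](P n.+1) subrK.
Qed.

Lemma cos_circle (m : int) (c : R) :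
  (\int[@circle_measure R]_x (cos (m%:~R * x + c))%:E =
   (if m == 0 then 2 * pi * cos c else 0)%:E)%E.
Proof.
have mf : measurable_fun setT (fun x : R => cos (m%:~R * x + c)).
  apply: continuous_measurable_fun => x; apply: continuous_comp; last exact: continuous_cos.
  by apply: cvgD; [apply: cvgM; [exact: cvg_cst|exact: cvg_id]|exact: cvg_cst].
rewrite integral_circle //; last first.
  by exists 1 => x; rewrite ler_norml cos_geN1 cos_le1.
rewrite integral_itv_bndo_bndc; last by apply/measurable_EFinP/measurable_funTS.
have p0 : 0 < 2 * pi :> R by rewrite mulr_gt0 // pi_gt0.
have [->|m0] := eqVneq m 0.
  under eq_integral do rewrite mul0r add0r.
  by rewrite integral_cst //= lebesgue_measure_itv /= lte_fin p0 -EFinB -EFinM subr0 mulrC.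
rewrite integral_cos_affine ?intr_eq0 ?(ltW p0) //.
by rewrite sin_int_period mulr0 add0r subrr mul0r.
Qed.

(** The free phase [c] absorbs the contribution of the first coordinate, which makes the induction
    on [d] work; it also yields the sine, for [c = - (pi / 2)]. *)
Lemma torus_cos d (n : 'rV[int]_d) (c : R) :
  (\int[torus_measure R d]_x (cos (dotZ n x + c))%:E =
   (if n == 0 then (2 * pi) ^+ d * cos c else 0)%:E)%E.
Proof.
elim: d n c => [|d IH] n c.
  rewrite /= integral_dirac //; last first.
    by apply/measurable_EFinP; exact: measurable_cos_dotZ.
  by rewrite diracT mul1e /dotZ big_ord0 add0r expr0 mul1r [n]thinmx0 eqxx.
have bc : forall y, `|cos y : R| <= 1 by move=> y; rewrite ler_norml cos_geN1 cos_le1.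
have mc := measurable_cos_dotZ n c.
have mcr := @measurable_cons_row R d.
have icr : (@circle_measure R \x torus_measure R d)%E.-integrable setT
    (EFin \o (fun x : 'rV[R]_d.+1 => cos (dotZ n x + c)) \o (@cons_row R d)).
  apply: (@measurable_bounded_integrable _ _ _ _
    ((fun x : 'rV[R]_d.+1 => cos (dotZ n x + c)) \o (@cons_row R d))) => //.
  - suff : ((@circle_measure R \x torus_measure R d) (setT `*` setT) < +oo)%E by rewrite setXTT.
    rewrite product_measure1E //.
    by rewrite lte_mul_pinfty // ?fin_num_measure // -ge0_fin_numE ?fin_num_measure.
  - exact: measurableT_comp mcr.
  - by exists 1; split=> // M M1 x _ /=; rewrite (le_trans _ (ltW M1)).
rewrite /= /torus_step integral_pushforward //; last by apply/measurable_EFinP.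
rewrite preimage_setT -integral12_prod_meas1 //.
set n' : 'rV[int]_d := \row_j n ord0 (lift ord0 j).
transitivity (\int[@circle_measure R]_x (if n' == 0 then (2 * pi) ^+ d * cos ((n ord0 ord0)%:~R * x + c) else 0)%:E)%E.
  apply: eq_integral => x _; rewrite /fubini_F /=.
  under eq_integral do rewrite dotZ_cons_row addrAC addrC.
  by rewrite IH.
have nE : (n == 0) = (n' == 0) && (n ord0 ord0 == 0).
  apply/eqP/andP => [n0|[/eqP n'0 /eqP n0]].
    by split; apply/eqP; rewrite /n' n0 ?mxE //; apply/rowP => j; rewrite !mxE.
  apply/rowP => j; rewrite mxE; case: (unliftP ord0 j) => [k ->|->] //.
  by have /rowP/(_ k) := n'0; rewrite !mxE.
rewrite nE; case: (n' == 0) => /=; last by rewrite integral0.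
under eq_integral do rewrite EFinM.
rewrite integralZl //; last first.
  apply: (@bounded_integrable _ _ _ (fun x : measurableTypeR R =>
    cos ((n ord0 ord0)%:~R * x + c)) 1) => //.
  apply: continuous_measurable_fun => x; apply: continuous_comp; last exact: continuous_cos.
  by apply: cvgD; [apply: cvgM; [exact: cvg_cst|exact: cvg_id]|exact: cvg_cst].
rewrite cos_circle -EFinM; case: ifP => _; last by rewrite mulr0.
by rewrite exprSr !mulrA.
Qed.

End torus_integrals.

Section complex_linearity.
Variable R : realType.
Local Notation C := R[i].

(* [conjc] with a fixed structure on [R], so that rewriting does not have to
   unify different paths to the ring structure of [R] *)
Definition cj (z : C) : C := conjc z.
Arguments cj : simpl never.

Lemma Re_D (a b : C) : complex.Re (a + b) = complex.Re a + complex.Re b.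
Proof. by case: a; case: b. Qed.
Lemma Im_D (a b : C) : complex.Im (a + b) = complex.Im a + complex.Im b.
Proof. by case: a; case: b. Qed.
Lemma Re_M (a b : C) :
  complex.Re (a * b) = complex.Re a * complex.Re b - complex.Im a * complex.Im b.
Proof. by case: a; case: b. Qed.
Lemma Im_M (a b : C) :
  complex.Im (a * b) = complex.Re a * complex.Im b + complex.Im a * complex.Re b.
Proof. by case: a; case: b. Qed.
Lemma cjM (a b : C) : cj (a * b) = cj a * cj b.
Proof. exact: rmorphM. Qed.
Lemma cj_sum I (r : seq I) (P : pred I) (F : I -> C) :
  cj (\sum_(i <- r | P i) F i) = \sum_(i <- r | P i) cj (F i).
Proof. exact: rmorph_sum. Qed.
Lemma Re_sum I (r : seq I) (P : pred I) (F : I -> C) :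
  complex.Re (\sum_(i <- r | P i) F i) = \sum_(i <- r | P i) complex.Re (F i).
Proof. by apply: (big_morph _ Re_D). Qed.
Lemma Im_sum I (r : seq I) (P : pred I) (F : I -> C) :
  complex.Im (\sum_(i <- r | P i) F i) = \sum_(i <- r | P i) complex.Im (F i).
Proof. by apply: (big_morph _ Im_D). Qed.

Lemma expiD (a b : R) : expi (a + b) = expi a * expi b.
Proof. by apply/eqP; rewrite eq_complex /= sinD cosD eqxx addrC eqxx. Qed.

Lemma expiN (a : R) : expi (- a) = cj (expi a).
Proof. by rewrite /expi cosN sinN. Qed.

Lemma expi0 : expi (0 : R) = 1.
Proof. by rewrite /expi cos0 sin0. Qed.

Section any_measure.
Context dT (T : measurableType dT) (mu : {measure set T -> \bar R}) (D : set T).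
Hypothesis mD : measurable D.

Lemma cintegrableD (f g : T -> C) : cintegrable mu D f -> cintegrable mu D g ->
  cintegrable mu D (fun x => f x + g x).
Proof.
move=> [f1 f2] [g1 g2]; split.
  by apply: eq_integrable (integrableD mD f1 g1) => // x _ /=; rewrite Re_D.
by apply: eq_integrable (integrableD mD f2 g2) => // x _ /=; rewrite Im_D.
Qed.

Lemma cintegralD (f g : T -> C) : cintegrable mu D f -> cintegrable mu D g ->
  cintegral mu D (fun x => f x + g x) = cintegral mu D f + cintegral mu D g.
Proof.
move=> [f1 f2] [g1 g2]; rewrite /cintegral.
under eq_Rintegral do rewrite Re_D; under [in X in _ +i* X]eq_Rintegral do rewrite Im_D.
by rewrite !RintegralD.
Qed.

Lemma cintegrableZ (c : C) (f : T -> C) : cintegrable mu D f ->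
  cintegrable mu D (fun x => c * f x).
Proof.
move=> [f1 f2]; split.
  have := integrableB mD (integrableZl mD (complex.Re c) f1) (integrableZl mD (complex.Im c) f2).
  by apply: eq_integrable => // x _ /=; rewrite Re_M.
have := integrableD mD (integrableZl mD (complex.Re c) f2) (integrableZl mD (complex.Im c) f1).
by apply: eq_integrable => // x _ /=; rewrite Im_M.
Qed.

Lemma cintegralZ (c : C) (f : T -> C) : cintegrable mu D f ->
  cintegral mu D (fun x => c * f x) = c * cintegral mu D f.
Proof.
move=> [f1 f2]; rewrite /cintegral.
under eq_Rintegral do rewrite Re_M; under [in X in _ +i* X]eq_Rintegral do rewrite Im_M.
have i k g : mu.-integrable D (EFin \o g) -> mu.-integrable D (EFin \o (fun x => k * g x)).
  exact: integrableZl.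
rewrite (RintegralB mD (i _ _ f1) (i _ _ f2)) (RintegralD mD (i _ _ f2) (i _ _ f1)).
rewrite !RintegralZl //; case: (c) => a b /=; simpc; by [].
Qed.

Lemma cintegrable0 : cintegrable mu D (fun=> 0).
Proof. by split; exact: integrable0. Qed.

Lemma cintegral0 : cintegral mu D (fun=> 0) = 0.
Proof. by rewrite /cintegral /= Rintegral_cst // mul0r. Qed.

Lemma cintegrable_sum I (r : seq I) (f : I -> T -> C) :
  (forall i, cintegrable mu D (f i)) ->
  cintegrable mu D (fun x => \sum_(i <- r) f i x).
Proof.
move=> fi; elim: r => [|i r IH].
  by under eq_fun do rewrite big_nil; exact: cintegrable0.
by under eq_fun do rewrite big_cons; exact: cintegrableD.
Qed.

Lemma cintegral_sum I (r : seq I) (f : I -> T -> C) :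
  (forall i, cintegrable mu D (f i)) ->
  cintegral mu D (fun x => \sum_(i <- r) f i x) = \sum_(i <- r) cintegral mu D (f i).
Proof.
move=> fi; elim: r => [|i r IH].
  by under eq_fun do rewrite big_nil; rewrite big_nil; exact: cintegral0.
under eq_fun do rewrite big_cons; rewrite big_cons -IH; apply: cintegralD => //.
exact: cintegrable_sum.
Qed.

End any_measure.

Variable d : nat.
Local Notation haar := (torus_measure R d).

Lemma cintegrable_expi (n : 'rV[int]_d) :
  cintegrable haar setT (fun x => expi (dotZ n x)).
Proof.
have h c : haar.-integrable setT (EFin \o (fun x => cos (dotZ n x + c))).
  apply: (@bounded_integrable _ _ _ _ _ 1); first exact: measurable_cos_dotZ.
  by move=> x; rewrite ler_norml cos_geN1 cos_le1.
split.
  by apply: eq_integrable (h 0) => // x _ /=; rewrite addr0.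
by apply: eq_integrable (h (- (pi / 2))) => // x _ /=; rewrite cosBpihalf.
Qed.

Lemma cintegral_expi (n : 'rV[int]_d) :
  cintegral haar setT (fun x => expi (dotZ n x)) =
  if n == 0 then ((2 * pi) ^+ d)%:C else 0.
Proof.
rewrite /cintegral /expi /=.
have h c : \int[haar]_x cos (dotZ n x + c) =
    if n == 0 then (2 * pi) ^+ d * cos c else 0.
  by rewrite /Rintegral torus_cos.
under eq_Rintegral do rewrite -[dotZ n _]addr0.
under [in X in _ +i* X]eq_Rintegral do rewrite -cosBpihalf.
by rewrite !h cosN cos_pihalf mulr0 cos0 mulr1; case: ifP.
Qed.

Lemma cintegrable_trig (t : seq ('rV[int]_d * C)) :
  cintegrable haar setT (fun x => \sum_(q <- t) q.2 * expi (dotZ q.1 x)).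
Proof. by apply: cintegrable_sum => // q; apply: cintegrableZ => //; exact: cintegrable_expi. Qed.

Lemma cintegral_trig (t : seq ('rV[int]_d * C)) :
  cintegral haar setT (fun x => \sum_(q <- t) q.2 * expi (dotZ q.1 x)) =
  ((2 * pi) ^+ d)%:C * \sum_(q <- t | q.1 == 0) q.2.
Proof.
rewrite cintegral_sum //; last first.
  by move=> q; apply: cintegrableZ => //; exact: cintegrable_expi.
rewrite mulr_sumr [RHS]big_mkcond; apply: eq_bigr => q _.
rewrite cintegralZ //; last exact: cintegrable_expi.
by rewrite cintegral_expi; case: ifP => _; rewrite ?mulr0 // mulrC.
Qed.

(** The constant coefficient is the integral over the torus, up to the factor [(2 * pi) ^+ d]. *)
Lemma trig_ge0 (t : seq ('rV[int]_d * C)) :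
  (forall x : 'rV[R]_d, 0 <= \sum_(q <- t) q.2 * expi (dotZ q.1 x)) ->
  0 <= \sum_(q <- t | q.1 == 0) q.2.
Proof.
move=> t0.
have p0 : 0 < ((2 * pi) ^+ d)%:C :> C.
  by rewrite ltcR exprn_gt0 // mulr_gt0 // pi_gt0.
rewrite -(pmulr_rge0 _ p0) -cintegral_trig lecE /=; apply/andP; split.
  apply/eqP; transitivity (\int[haar]_(x in setT) (0 : R)); last by rewrite Rintegral_cst ?mul0r.
  by apply: eq_Rintegral => x _; have := t0 x; rewrite lecE => /andP[/eqP].
by apply: Rintegral_ge0 => x _; have := t0 x; rewrite lecE => /andP[].
Qed.

(* The [m]-th Fourier coefficient of [\sum_(p <- s) p.2 * expi (dotZ p.1 x)]. *)
Definition tcoef (s : seq ('rV[int]_d * C)) (m : 'rV[int]_d) : C :=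
  \sum_(p <- s | p.1 == m) p.2.

Definition tfun (s : seq ('rV[int]_d * C)) (x : 'rV[R]_d) : C :=
  \sum_(p <- s) p.2 * expi (dotZ p.1 x).

Lemma dotZD (m n : 'rV[int]_d) (x : 'rV[R]_d) : dotZ (m + n) x = dotZ m x + dotZ n x.
Proof.
rewrite /dotZ -big_split; apply: eq_bigr => i _.
by rewrite !mxE rmorphD mulrDl.
Qed.

Lemma dotZN (m : 'rV[int]_d) (x : 'rV[R]_d) : dotZ (- m) x = - dotZ m x.
Proof.
rewrite /dotZ -sumrN; apply: eq_bigr => i _.
by rewrite !mxE rmorphN mulNr.
Qed.

(** The form is the constant coefficient of [tfun s] times [|g|^2], where [g] is the trigonometric
    polynomial with frequencies [zz] and coefficients [z]. *)
Lemma toeplitz_ge0 (X : finType) (zz : X -> 'rV[int]_d) (z : X -> C)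
    (s : seq ('rV[int]_d * C)) : (forall x, 0 <= tfun s x) ->
  0 <= \sum_x \sum_y tcoef s (zz y - zz x) * z x * cj (z y).
Proof.
move=> s0.
pose t := [seq (p.1 + zz xy.1 - zz xy.2, p.2 * z xy.1 * cj (z xy.2)) |
  p <- s, xy <- enum {: X * X}].
suff -> : \sum_x \sum_y tcoef s (zz y - zz x) * z x * cj (z y) =
    \sum_(q <- t | q.1 == 0) q.2.
  apply: trig_ge0 => x.
  pose g : C := \sum_k z k * expi (dotZ (zz k) x).
  have gE : cj g = \sum_k cj (z k) * expi (- dotZ (zz k) x).
    by rewrite cj_sum; apply: eq_bigr => k _; rewrite cjM expiN.
  have -> : \sum_(q <- t) q.2 * expi (dotZ q.1 x) = tfun s x * (g * cj g).
    rewrite gE big_allpairs_dep /tfun mulr_suml; apply: eq_bigr => p _.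
    rewrite big_enum /= mulr_suml mulr_sumr -(pair_bigA _ (fun k l =>
      (p.2 * z k * cj (z l)) * expi (dotZ (p.1 + zz k - zz l) x))) /=.
    apply: eq_bigr => k _; rewrite mulr_sumr mulr_sumr; apply: eq_bigr => l _.
    by rewrite !dotZD dotZN !expiD; ring.
  by rewrite mulr_ge0 // mulcJ_ge0.
rewrite [RHS]big_mkcond big_allpairs_dep /= [RHS]exchange_big big_enum /=.
rewrite (pair_bigA _ (fun x y => tcoef s (zz y - zz x) * z x * cj (z y))) /=.
apply: eq_bigr => -[x y] _ /=.
rewrite /tcoef big_mkcond !mulr_suml; apply: eq_bigr => p _.
rewrite -(subr_eq0 p.1) opprB addrA; case: ifP => _; by rewrite ?mul0r.

Qed.

End complex_linearity.

Section finite_sums.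
Variable R : realType.

(** The net of partial sums is constant beyond the image of [g]. *)
Lemma sum_finite_support (I : choiceType) (Y : finType) (g : Y -> I) (f : I -> R^o) :
  injective g -> (forall i, f i != 0 -> i \in codom g) ->
  summability.sum f = \sum_y f (g y).
Proof.
move=> ginj fg; pose A := [fset x in codom g]%fset.
have EA : \sum_y f (g y) = \sum_(i <- A) f i.
  transitivity (\sum_(y <- enum Y) f (g y)); first by rewrite big_enum.
  rewrite -(big_map g xpredT f); apply: perm_big.
  apply: uniq_perm; [|exact: fset_uniq|move=> i; by rewrite !inE /= codomE].
  by rewrite map_inj_uniq //; exact: (enum_uniq Y).
apply: lim_near_cst; [exact: norm_hausdorff|exact: totally_filter|].
exists A => // B /= AB; rewrite /partial_sum.
rewrite EA -(big_seq_fsetE _ B xpredT f) /=; apply/esym; apply: big_fset_incl AB _.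
move=> i _ iA; apply/eqP; apply: contraNT iA => /fg; by rewrite !inE.
Qed.

Lemma csum_finite_support (I : choiceType) (Y : finType) (g : Y -> I) (f : I -> R[i]) :
  injective g -> (forall i, f i != 0 -> i \in codom g) ->
  csum f = \sum_y f (g y).
Proof.
move=> ginj fg; rewrite /csum !(sum_finite_support ginj).
- by rewrite -Re_sum -Im_sum; case: (\sum_y _).
- by move=> i; apply: contra_neqT => ni; have /eqP -> : f i == 0
    by apply: contraNT ni => /fg.
- by move=> i; apply: contra_neqT => ni; have /eqP -> : f i == 0
    by apply: contraNT ni => /fg.
Qed.

End finite_sums.

Section fourier.
Variables (R : realType) (d : nat).
Local Notation C := R[i].
Local Notation haar := (torus_measure R d).
Local Notation V := 'rV[R]_d.
Local Notation Z := 'rV[int]_d.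

Definition sqn (z : C) : R := complex.Re z ^+ 2 + complex.Im z ^+ 2.

Lemma mul_cj (z : C) : z * cj z = (sqn z)%:C.
Proof.
case: z => a b; apply/eqP; rewrite eq_complex /sqn /=.
by apply/andP; split; apply/eqP; ring.
Qed.

Lemma realC_sum I (r : seq I) (P : pred I) (F : I -> R) :
  (\sum_(i <- r | P i) F i)%:C = \sum_(i <- r | P i) (F i)%:C :> C.
Proof. exact: rmorph_sum. Qed.

Lemma sqn_ge0 (z : C) : 0 <= sqn z.
Proof. by rewrite addr_ge0 // sqr_ge0. Qed.

Definition fnorm : R := (2 * pi) `^ (- (d%:R / 2)).

Lemma fnormK : fnorm * fnorm * (2 * pi) ^+ d = 1.
Proof.
have p0 : 0 < 2 * pi :> R by rewrite mulr_gt0 // pi_gt0.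
rewrite -powR_mulrn ?(ltW p0) // -!powRD ?(gt_eqF p0) ?implybT //.
by rewrite -opprD -splitr addNr powRr0.
Qed.

Lemma fourier_tfun (t : seq (Z * C)) m :
  fourier (tfun t) m = (fnorm * (2 * pi) ^+ d)%:C * tcoef t m.
Proof.
rewrite /fourier -/fnorm.
pose t' := [seq (p.1 - m, fnorm%:C * p.2) | p <- t].
have -> : (fun x : V => fnorm%:C * (tfun t x * expi (- dotZ m x))) =
    (fun x => \sum_(q <- t') q.2 * expi (dotZ q.1 x)).
  apply/funext => x; rewrite big_map /tfun mulr_suml mulr_sumr.
  by apply: eq_bigr => p _ /=; rewrite dotZD dotZN expiD !mulrA.
rewrite cintegral_trig big_map /= /tcoef mulr_sumr [RHS]mulr_sumr.
rewrite -[LHS]mulr_sumr.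
under eq_bigl do rewrite subr_eq0.
rewrite !mulr_sumr; apply: eq_bigr => p _.
by rewrite rmorphM /=; ring.
Qed.

Lemma cintegrable_L2_expi (u : V -> C) n : L2 u ->
  cintegrable haar setT (fun x => u x * expi (dotZ n x)).
Proof.
move=> [u1 u2].
have i (f : V -> R) c : f \in Lfun haar 2%:E ->
    haar.-integrable setT (EFin \o (fun x => cos (dotZ n x + c) * f x)).
  move=> fL; apply: (@integrableMr _ _ _ _ _ measurableT (fun x => cos (dotZ n x + c)) (EFin \o f)).
  - exact: measurable_cos_dotZ.
  - by exists 1; split=> // M M1 x _ /=; rewrite (le_trans _ (ltW M1)) // ler_norml cos_geN1 cos_le1.
  - by apply/Lfun1_integrable; apply: Lfun_subset12 fL; rewrite fin_num_measure.
split.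
  apply: eq_integrable (integrableB _ (i _ 0 u1) (i _ (- (pi / 2)) u2)) => // x _ /=.
  by rewrite Re_M /= cosBpihalf addr0 EFinB ![_ * complex.Re _]mulrC ![_ * complex.Im _]mulrC.
apply: eq_integrable (integrableD _ (i _ (- (pi / 2)) u1) (i _ 0 u2)) => // x _ /=.
by rewrite Im_M /= cosBpihalf addr0 EFinD ![_ * complex.Re _]mulrC ![_ * complex.Im _]mulrC.
Qed.

Lemma fourierE (u : V -> C) k : L2 u ->
  fourier u k = fnorm%:C * cintegral haar setT (fun x => u x * expi (dotZ (- k) x)).
Proof.
move=> uL; rewrite -cintegralZ //; last exact: cintegrable_L2_expi.
by rewrite /fourier; under [in RHS]eq_fun do rewrite dotZN.
Qed.

Lemma L2normE (u : V -> C) : L2 u -> L2norm u ^+ 2 = \int[haar]_x sqn (u x).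
Proof.
move=> uL; have -> : L2norm u = Num.sqrt (\int[haar]_x sqn (u x)).
  congr Num.sqrt; apply: eq_Rintegral => x _; case: (u x) => a b.
  by rewrite /sqn /=; ring.
by rewrite sqr_sqrtr // Rintegral_ge0 // => x _; exact: sqn_ge0.
Qed.

Lemma integrable_sqn (u : V -> C) : L2 u -> haar.-integrable setT (EFin \o (sqn \o u)).
Proof.
move=> [u1 u2]; have := integrableD measurableT (Lfun2_integrable_sqr u1) (Lfun2_integrable_sqr u2).
by apply: eq_integrable.
Qed.

Lemma sqnB (z w : C) : sqn (z - w) = sqn z - 2 * complex.Re (z * cj w) + sqn w.
Proof. by case: z => a b; case: w => a' b'; rewrite /sqn /cj /=; simpc => /=; ring. Qed.

(** The integral of [|u - g|^2] is nonnegative for [g] the orthogonal projection of [u] on the modes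
    [zz]; the product of [u] with the conjugate of [g] and the square of [g] both integrate to the
    sum of the squared coefficients. *)
Lemma bessel (X : finType) (zz : X -> Z) (u : V -> C) : injective zz -> L2 u ->
  \sum_x sqn (fourier u (zz x)) <= L2norm u ^+ 2.
Proof.
move=> zinj uL; rewrite L2normE //.
pose w x := fourier u (zz x).
pose t := [seq (zz x, fnorm%:C * w x) | x <- enum X].
pose g : V -> C := tfun t.
have gE x : g x = \sum_k (fnorm%:C * w k) * expi (dotZ (zz k) x).
  by rewrite /g /tfun big_map big_enum.
have cgE x : cj (g x) = \sum_k cj (fnorm%:C * w k) * expi (dotZ (- zz k) x).
  by rewrite gE cj_sum; apply: eq_bigr => k _; rewrite cjM dotZN expiN.
have cf : cj fnorm%:C = fnorm%:C by rewrite /cj /= oppr0.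
have fK : fnorm%:C * fnorm%:C * ((2 * pi) ^+ d)%:C = 1 :> C by rewrite -!rmorphM fnormK.
have i1 k : cintegrable haar setT (fun x => cj (fnorm%:C * w k) * (u x * expi (dotZ (- zz k) x))).
  by apply: cintegrableZ => //; exact: cintegrable_L2_expi.
have E1 : (fun x => u x * cj (g x)) =
    (fun x => \sum_k cj (fnorm%:C * w k) * (u x * expi (dotZ (- zz k) x))).
  by apply/funext => x; rewrite cgE mulr_sumr; apply: eq_bigr => k _; rewrite mulrCA.
have I1 : cintegral haar setT (fun x => u x * cj (g x)) = (\sum_x sqn (w x))%:C.
  rewrite E1 cintegral_sum // realC_sum; apply: eq_bigr => k _.
  rewrite cintegralZ //; last exact: cintegrable_L2_expi.
  by rewrite cjM cf mulrAC -fourierE // mul_cj.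
have J1 : cintegrable haar setT (fun x => u x * cj (g x)).
  by rewrite E1; exact: cintegrable_sum.
pose t2 := [seq (zz xy.1 - zz xy.2, (fnorm%:C * w xy.1) * cj (fnorm%:C * w xy.2)) | xy <- enum {: X * X}].
have E2 : (fun x => g x * cj (g x)) = (fun x => \sum_(q <- t2) q.2 * expi (dotZ q.1 x)).
  apply/funext => x; rewrite cgE gE big_map big_enum /= mulr_suml.
  rewrite -(pair_bigA _ (fun k l => (fnorm%:C * w k) * cj (fnorm%:C * w l) *
     expi (dotZ (zz k - zz l) x))) /=.
  apply: eq_bigr => k _; rewrite mulr_sumr; apply: eq_bigr => l _.
  by rewrite dotZD expiD; ring.
have I2 : cintegral haar setT (fun x => g x * cj (g x)) = (\sum_x sqn (w x))%:C.
  rewrite E2 cintegral_trig big_map big_mkcond big_enum /=.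
  rewrite -(pair_bigA _ (fun k l => if zz k - zz l == 0 then
     (fnorm%:C * w k) * cj (fnorm%:C * w l) else 0)).
  rewrite mulr_sumr realC_sum; apply: eq_bigr => k _.
  rewrite -big_mkcond (big_pred1 k); last first.
    by move=> l /=; rewrite subr_eq0 (inj_eq zinj) eq_sym.
  by rewrite cjM cf -mul_cj -[RHS]mul1r -fK; ring.
have J2 : cintegrable haar setT (fun x => g x * cj (g x)).
  by rewrite E2; exact: cintegrable_trig.
have sE x : sqn (u x - g x) = sqn (u x) - 2 * complex.Re (u x * cj (g x)) + complex.Re (g x * cj (g x)).
  by rewrite sqnB mul_cj.
have : 0 <= \int[haar]_x sqn (u x - g x) by apply: Rintegral_ge0 => x _; exact: sqn_ge0.
under eq_Rintegral do rewrite sE.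
have iu := integrable_sqn uL.
have ir : haar.-integrable setT (EFin \o (fun x => 2 * complex.Re (u x * cj (g x)))).
  by apply: integrableZR => //; case: J1.
rewrite RintegralD //; [|exact: integrableBR|by case: J2].
rewrite RintegralB // RintegralZl //; last by case: J1.
have -> : \int[haar]_x complex.Re (u x * cj (g x)) = \sum_x sqn (w x).
  exact: (congr1 (@complex.Re R) I1).
have -> : \int[haar]_x complex.Re (g x * cj (g x)) = \sum_x sqn (w x).
  exact: (congr1 (@complex.Re R) I2).
by rewrite /w; lra.
Qed.

End fourier.

(** * Positive forms on a cluster *)

Section psd_cluster.
Variables (R : realFieldType) (X : finType) (p : X -> X -> R) (s : X -> R).

Let E (a b : X -> R) := \sum_x \sum_y a x * b y * p x y.

Let EDl a a' b : E (fun x => a x + a' x) b = E a b + E a' b.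
Proof.
rewrite /E -big_split; apply: eq_bigr => x _; rewrite -big_split.
by apply: eq_bigr => y _; rewrite !mulrDl.
Qed.

Let EDr a b b' : E a (fun x => b x + b' x) = E a b + E a b'.
Proof.
rewrite /E -big_split; apply: eq_bigr => x _; rewrite -big_split.
by apply: eq_bigr => y _; rewrite mulrDr !mulrDl.
Qed.

Let ENl a b : E (fun x => - a x) b = - E a b.
Proof.
rewrite /E -sumrN; apply: eq_bigr => x _; rewrite -sumrN.
by apply: eq_bigr => y _; rewrite !mulNr.
Qed.

Let ENr a b : E a (fun x => - b x) = - E a b.
Proof.
rewrite /E -sumrN; apply: eq_bigr => x _; rewrite -sumrN.
by apply: eq_bigr => y _; rewrite mulrN mulNr.
Qed.

Let Ed u v : E (fun x => (x == u)%:R) (fun x => (x == v)%:R) = p u v.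
Proof.
rewrite /E (bigD1 u) //= (bigD1 v) //= !eqxx !mul1r !big1 ?addr0 //.
  by move=> x xu; rewrite big1 // => y _; rewrite (negbTE xu) !mul0r.
by move=> y yv; rewrite (negbTE yv) mulr0 mul0r.
Qed.

Let Eset (A B : pred X) : E (fun x => (A x)%:R) (fun x => (B x)%:R) =
  \sum_(x | A x) \sum_(y | B y) p x y.
Proof.
rewrite /E [RHS]big_mkcond; apply: eq_bigr => x _; case: (A x); last first.
  by rewrite big1 // => y _; rewrite !mul0r.
rewrite [RHS]big_mkcond; apply: eq_bigr => y _.
by case: (B y); rewrite ?mulr1 ?mul1r ?mulr0 ?mul0r.
Qed.

Hypothesis E_ge0 : forall a, 0 <= E a a.
Hypothesis E_le : forall a, E a a <= \sum_x a x ^+ 2 * s x.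

(** Let [a] and [b] be the indicators of the good and bad parts of the cluster. Positivity of the
    form at [a - b] bounds its value at [a + b] by twice the sum of its values at [a] and [b]. The
    first value is at most [Q] times the trace, since [p x y + p y x <= p x x + p y y]; the second
    uses the diagonal majorant [s], so that the bad part may have any cardinality. *)
Lemma psd_cluster (C G : pred X) (Q : nat) :
  (#|[pred x | C x && G x]| <= Q)%N ->
  \sum_(x | C x) \sum_(y | C y) p x y <=
  2 * Q%:R * (\sum_(x | C x && G x) p x x) + 2 * \sum_(x | C x && ~~ G x) s x.
Proof.
move=> cardQ; rewrite -Eset.
pose a x : R := (C x && G x)%:R; pose b x : R := (C x && ~~ G x)%:R.
have -> : E (fun x => (C x)%:R) (fun x => (C x)%:R) = E a a + E a b + E b a + E b b.
  have ab : (fun x => (C x)%:R) = (fun x => a x + b x).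
    by apply/funext => x; rewrite /a /b; case: (C x); case: (G x); rewrite /= ?addr0 ?add0r.
  by rewrite ab EDl !EDr; ring.
have h1 : 0 <= E a a - E a b - E b a + E b b.
  have := E_ge0 (fun x => a x + - b x); rewrite EDl !EDr !ENl !ENr; lra.
have h2 : E b b <= \sum_(x | C x && ~~ G x) s x.
  apply: le_trans (E_le b) _; rewrite [leRHS]big_mkcond ler_sum // => x _.
  by rewrite /b; case: (C x && ~~ G x); rewrite ?expr1n ?mul1r // expr0n mul0r.
have dd x : 0 <= p x x by rewrite -Ed; exact: E_ge0.
set D := \sum_(x | C x && G x) p x x.
have D0 : 0 <= D by apply: sumr_ge0.
have h3 : E a a <= Q%:R * D.
  apply: (@le_trans _ _ (#|[pred x | C x && G x]|%:R * D)); last first.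
    by rewrite ler_wpM2r // ler_nat.
  set n := #|_|; rewrite Eset.
  have key x y : p x y + p y x <= p x x + p y y.
    have := E_ge0 (fun z => (z == x)%:R + - (z == y)%:R).
    rewrite EDl !EDr !ENl !ENr !Ed; lra.
  have : \sum_(x | C x && G x) \sum_(y | C y && G y) (p x y + p y x) <=
         \sum_(x | C x && G x) \sum_(y | C y && G y) (p x x + p y y).
    by apply: ler_sum => x _; apply: ler_sum => y _.
  have e1 : \sum_(x | C x && G x) \sum_(y | C y && G y) (p x y + p y x) =
     2 * \sum_(x | C x && G x) \sum_(y | C y && G y) p x y.
    under eq_bigr do rewrite big_split /=.
    rewrite big_split /= [X in _ + X]exchange_big /=; ring.
  have e2 : \sum_(x | C x && G x) \sum_(y | C y && G y) (p x x + p y y) = 2 * (n%:R * D).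
    under eq_bigr do rewrite big_split /= sumr_const.
    rewrite big_split /= sumr_const sumrMnl -/D -[#|_|]/n -!(mulr_natl D); ring.
  by rewrite e1 e2; lra.
by lra.
Qed.

End psd_cluster.

(** * Sesquilinear forms with finitely many diagonals *)

Section forms.
Variable R : realType.
Local Notation C := R[i].

Definition cabs (z : C) : R := complex.Re `|z|.

Lemma cabsE z : `|z| = (cabs z)%:C.
Proof. by rewrite /cabs normc_def. Qed.

Lemma cabs_ge0 z : 0 <= cabs z.
Proof. by rewrite -lecR -cabsE normr_ge0. Qed.

Lemma cabsM z w : cabs (z * w) = cabs z * cabs w.
Proof. by apply: complexI; rewrite rmorphM /= -!cabsE normrM. Qed.

Lemma cabsD z w : cabs (z + w) <= cabs z + cabs w.
Proof. by rewrite -lecR rmorphD /= -!cabsE ler_normD. Qed.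

Lemma cabsN z : cabs (- z) = cabs z.
Proof. by rewrite /cabs normrN. Qed.

Lemma cabs0 : cabs 0 = 0.
Proof. by rewrite /cabs normr0. Qed.

Lemma cabs_cj z : cabs (cj z) = cabs z.
Proof. by rewrite /cabs /cj normcJ. Qed.

Lemma Re_le_cabs z : `|complex.Re z| <= cabs z.
Proof. by rewrite -lecR -cabsE normc_ge_Re. Qed.

Lemma Im_le_cabs z : `|complex.Im z| <= cabs z.
Proof.
have := Re_le_cabs (z * 'i%C); rewrite ReiNIm normrN cabsM.
suff -> : cabs 'i%C = 1 by rewrite mulr1.
by rewrite /cabs normc_def /= expr0n add0r expr1n sqrtr1.
Qed.

Lemma sqn_cabs z : sqn z = cabs z ^+ 2.
Proof. by rewrite /cabs normc_def /= sqr_sqrtr // sqn_ge0. Qed.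

Lemma sqnM (z w : C) : sqn (z * w) = sqn z * sqn w.
Proof. by rewrite !sqn_cabs cabsM exprMn. Qed.

Lemma sqn_expi a : sqn (expi a : C) = 1.
Proof. by rewrite /sqn /= cos2Dsin2. Qed.

Lemma cabs_expi a : cabs (expi a : C) = 1.
Proof.
by apply/eqP; rewrite -(@eqrXn2 _ 2) ?cabs_ge0 // -sqn_cabs sqn_expi expr1n.
Qed.

Lemma sqnD_le (z w : C) : sqn (z + w) <= 2 * sqn z + 2 * sqn w.
Proof.
case: z => a b; case: w => a' b'; rewrite /sqn /=.
have := sqr_ge0 (a - a'); have := sqr_ge0 (b - b'); rewrite !sqrrB !sqrrD; lra.
Qed.

Lemma cabs_form_le b z w A : cabs b <= A ->
  cabs (b * z * cj w) <= A * ((sqn z + sqn w) / 2).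
Proof.
move=> bA; rewrite !cabsM cabs_cj -mulrA ler_pM ?mulr_ge0 ?cabs_ge0 //.
have := sqr_ge0 (cabs z - cabs w); rewrite !sqn_cabs sqrrB; lra.
Qed.

Lemma Re_form_le b z w A : cabs b <= A ->
  `|complex.Re (b * z * cj w)| <= A * ((sqn z + sqn w) / 2).
Proof. by move=> bA; apply: le_trans (Re_le_cabs _) (cabs_form_le _ _ bA). Qed.

Section bilinear.
Variables (X : finType) (d : nat) (zz : X -> 'rV[int]_d).
Hypothesis zinj : injective zz.
Implicit Types (b : X -> X -> C) (z w : X -> C).

Definition mass z : R := \sum_x sqn (z x).

Definition bform b z w : R := \sum_x \sum_y complex.Re (b x y * z x * cj (w y)).

(** A Schur test: each diagonal [zz y - zz x = n] meets every row and every column at most once,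
    because [zz] is injective. *)
Lemma banded_sum_le (F : seq 'rV[int]_d) (P : X -> X -> R) (A : R) z w : 0 <= A ->
  (forall x y, P x y <= if zz y - zz x \in F then A * ((sqn (z x) + sqn (w y)) / 2) else 0) ->
  \sum_x \sum_y P x y <= A * (size F)%:R * ((mass z + mass w) / 2).
Proof.
move=> A0 PF.
apply: (@le_trans _ _ (\sum_x \sum_y \sum_(n <- F)
    (if zz y - zz x == n then A * ((sqn (z x) + sqn (w y)) / 2) else 0))).
  apply: ler_sum => x _; apply: ler_sum => y _; apply: le_trans (PF x y) _.
  have pos : 0 <= A * ((sqn (z x) + sqn (w y)) / 2).
    by rewrite mulr_ge0 // divr_ge0 // addr_ge0 // sqn_ge0.
  elim: F {PF} => [|n F IH]; first by rewrite big_nil.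
  rewrite big_cons inE; case: eqP => //= _; last by rewrite add0r.
  by rewrite lerDl sumr_ge0 // => i _; case: ifP.
have -> : A * (size F)%:R * ((mass z + mass w) / 2) =
   \sum_(n <- F) (A * ((\sum_x sqn (z x)) / 2) + A * ((\sum_y sqn (w y)) / 2)).
  by rewrite big_const_seq count_predT iter_addr addr0 -mulr_natl /mass; ring.
under eq_bigr do rewrite exchange_big.
rewrite exchange_big /=; apply: ler_sum => n _.
have -> : \sum_x \sum_y (if zz y - zz x == n then A * ((sqn (z x) + sqn (w y)) / 2) else 0) =
   \sum_x \sum_y (if zz y - zz x == n then A * (sqn (z x) / 2) else 0) +
   \sum_y \sum_x (if zz y - zz x == n then A * (sqn (w y) / 2) else 0).
  rewrite [X in _ + X]exchange_big -big_split; apply: eq_bigr => x _.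
  rewrite -big_split; apply: eq_bigr => y _ /=; case: ifP; rewrite ?addr0 // => _.
  by rewrite mulrDl mulrDr.
have one (T : finType) (P' : pred T) (c : R) : 0 <= c ->
    {in P' &, forall s t, s = t} -> \sum_(t | P' t) c <= c.
  move=> c0 uP; rewrite sumr_const; case: (pickP P') => [t Pt|P0].
    rewrite (_ : #|_| = 1%N) ?mulr1n //; apply/eqP; rewrite -(card1 t); apply/eqP.
    by apply: eq_card => u; rewrite !inE; apply/idP/eqP => [Pu|->//]; exact: uP.
  by rewrite (eq_card0 P0).
rewrite !mulr_suml !mulr_sumr; apply: lerD; apply: ler_sum => x _.
  rewrite -big_mkcond; apply: one; first by rewrite mulr_ge0 // divr_ge0 // sqn_ge0.
  by move=> s t /eqP h1 /eqP h2; apply: zinj; apply: (addIr (- zz x)); rewrite h1 h2.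
rewrite -big_mkcond; apply: one; first by rewrite mulr_ge0 // divr_ge0 // sqn_ge0.
by move=> s t /eqP h1 /eqP h2; apply: zinj; apply: oppr_inj; apply: (addrI (zz x)); rewrite h1 h2.
Qed.

Lemma bform_le (F : seq 'rV[int]_d) b (A : R) z w : 0 <= A ->
  (forall x y, cabs (b x y) <= if zz y - zz x \in F then A else 0) ->
  `|bform b z w| <= A * (size F)%:R * ((mass z + mass w) / 2).
Proof.
move=> A0 bA; apply: (@le_trans _ _ (\sum_x \sum_y `|complex.Re (b x y * z x * cj (w y))|)).
  apply: le_trans (ler_norm_sum _ _ _) _; apply: ler_sum => x _; exact: ler_norm_sum.
apply: banded_sum_le A0 _ => x y.
by have := Re_form_le (z x) (w y) (bA x y); case: ifP => // _; rewrite mul0r.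
Qed.

Lemma bform_sub b z w : bform b z z - bform b w w =
  bform b (fun x => z x - w x) z + bform b w (fun x => z x - w x).
Proof.
rewrite /bform -sumrB -big_split; apply: eq_bigr => x _; rewrite -sumrB -big_split.
apply: eq_bigr => y _ /=; case: (b x y) (z x) (z y) (w x) (w y) => [b1 b2] [? ?] [? ?] [? ?] [? ?].
by rewrite /cj /=; ring.
Qed.

(* The factor [t] is kept to obtain a bound of size [t] when [w] is [t]-close to [z]. *)
Lemma bform_lipschitz (F : seq 'rV[int]_d) b (A t M : R) z w : 0 <= A -> 0 < t ->
  (forall x y, cabs (b x y) <= if zz y - zz x \in F then A else 0) ->
  mass z <= 1 -> mass w <= 1 -> mass (fun x => z x - w x) <= (M * t) ^+ 2 ->
  bform b z z <= bform b w w + t * (A * (size F)%:R * (M ^+ 2 + 1)).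
Proof.
move=> A0 t0 bA z1 w1 zw; rewrite -lerBlDl bform_sub.
pose e x := t^-1%:C * (z x - w x).
have eE : (fun x => z x - w x) = (fun x => t%:C * e x).
  apply/funext => x; rewrite /e mulrA -rmorphM divff ?gt_eqF //= mul1r; by [].
have me : mass e <= M ^+ 2.
  have -> : mass e = t^-1 ^+ 2 * mass (fun x => z x - w x).
    rewrite /mass mulr_sumr; apply: eq_bigr => x _.
    by rewrite /e sqnM /sqn /= expr0n addr0.
  rewrite exprVn mulrC ler_pdivrMr ?exprn_gt0 // -exprMn; exact: zw.
have sl z' : bform b (fun x => t%:C * e x) z' = t * bform b e z'.
  rewrite /bform mulr_sumr; apply: eq_bigr => x _; rewrite mulr_sumr.
  apply: eq_bigr => y _; case: (b x y) (e x) (z' y) => [b1 b2] [? ?] [? ?].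
  by rewrite /cj /=; ring.
have sr z' : bform b z' (fun x => t%:C * e x) = t * bform b z' e.
  rewrite /bform mulr_sumr; apply: eq_bigr => x _; rewrite mulr_sumr.
  apply: eq_bigr => y _; case: (b x y) (e y) (z' x) => [b1 b2] [? ?] [? ?].
  by rewrite /cj /=; ring.
rewrite eE sl sr -mulrDr ler_pM2l //.
have AF : 0 <= A * (size F)%:R by rewrite mulr_ge0.
have h1 := le_trans (ler_norm _) (bform_le e z A0 bA).
have h2 := le_trans (ler_norm _) (bform_le w e A0 bA).
apply: le_trans (lerD h1 h2) _; rewrite -mulrDr ler_wpM2l //; lra.
Qed.

End bilinear.

End forms.

(** * Time integrals of oscillating terms *)

Section oscillation.
Variable R : realType.
Local Notation leb := (@lebesgue_measure R).

Lemma integrable_cos_affine (a b w c : R) :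
  leb.-integrable `[a, b] (EFin \o (fun t => cos (w * t + c))).
Proof.
apply: continuous_compact_integrable; first exact: segment_compact.
apply: continuous_subspaceT => x; apply: continuous_comp; last exact: continuous_cos.
by apply: cvgD; [apply: cvgM; [exact: cvg_cst|exact: cvg_id]|exact: cvg_cst].
Qed.

Lemma integral_cos_affine_le (a b w c : R) : a <= b -> w != 0 ->
  `|\int[leb]_(t in `[a, b]) cos (w * t + c)| <= 2 / `|w|.
Proof.
move=> ab w0; rewrite /Rintegral integral_cos_affine //= normrM normfV.
rewrite ler_pM2r ?invr_gt0 ?normr_gt0 //.
apply: le_trans (ler_normB _ _) _; rewrite -[leRHS]/(1 + 1).
by apply: lerD; rewrite ler_norml sin_geN1 sin_le1.
Qed.

Definition osc (z : R[i]) (w t : R) : R := complex.Re (z * expi (- (t * w))).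

Lemma oscE z w t : osc z w t =
  complex.Re z * cos (w * t + 0) + complex.Im z * cos (w * t + - (pi / 2)).
Proof. by rewrite /osc Re_M /= sinN cosN cosBpihalf addr0 mulrC (mulrC t); ring. Qed.

Lemma integrable_osc z w a b : leb.-integrable `[a, b] (EFin \o osc z w).
Proof.
have -> : osc z w = fun t => complex.Re z * cos (w * t + 0) +
     complex.Im z * cos (w * t + - (pi / 2)) by apply/funext => t; exact: oscE.
by apply: integrableDR => //; apply: integrableZR => //; exact: integrable_cos_affine.
Qed.

Lemma integral_osc_le z w a b : a <= b -> w != 0 ->
  \int[leb]_(t in `[a, b]) osc z w t <= 4 * cabs z / `|w|.
Proof.
move=> ab w0; under eq_Rintegral do rewrite oscE.
rewrite RintegralD ?RintegralZl //;
  try by [apply: integrableZR => //; exact: integrable_cos_affine|exact: integrable_cos_affine].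
apply: le_trans (ler_norm _) _; apply: le_trans (ler_normD _ _) _; rewrite !normrM.
have h c := integral_cos_affine_le c ab w0.
have w1 : 0 <= 2 / `|w| by rewrite divr_ge0.
have -> : 4 * cabs z / `|w| = cabs z * (2 / `|w|) + cabs z * (2 / `|w|) by ring.
by apply: lerD; apply: ler_pM => //; [exact: Re_le_cabs|exact: Im_le_cabs].
Qed.

End oscillation.

(** * The estimate for finitely many modes *)

Section finite_estimate.
Variables (R : realType) (d : nat).
Local Notation C := R[i].
Local Notation V := 'rV[R]_d.
Local Notation Z := 'rV[int]_d.
Local Notation leb := (@lebesgue_measure R).

Lemma le_norm_l1 (v : V) : `|v| <= l1 v.
Proof.
rewrite [leLHS]mx_normrE; apply: bigmax_le => [|[i j] _ /=]; first exact: l1_ge0.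
by rewrite (ord1 i) le_l1.
Qed.
Lemma coord_le_norm (v : V) j : `|v ord0 j| <= `|v|.
Proof.
by rewrite [leRHS]mx_normrE; apply: (le_bigmax _ (fun ij : 'I_1 * 'I_d => `|v ij.1 ij.2|) (ord0, j)).
Qed.

(** A symbol is a list of frequencies in [x] with coefficients that are functions of [xi]; fixing
    [xi] leaves a trigonometric polynomial. A frequency may occur several times, and [tcoef] adds
    its coefficients. *)
Definition sval (s : seq (Z * (V -> C))) (xi : V) : seq (Z * C) :=
  [seq (p.1, p.2 xi) | p <- s].

Definition freqs (s : seq (Z * (V -> C))) : seq Z := [seq p.1 | p <- s].

Lemma tcoef_notin s xi m : m \notin freqs s -> tcoef (sval s xi) m = 0.
Proof.
move=> mF; rewrite /tcoef big_map big_seq_cond big1 // => p /andP[ps /eqP pm].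
by case/negP: mF; rewrite -pm; apply: map_f ps.
Qed.

Lemma toeplitz_psd (X : finType) (zz : X -> Z) (T : seq (Z * C)) (v : X -> C) a :
  (forall x, 0 <= tfun T x) ->
  0 <= \sum_x \sum_y a x * a y * complex.Re (tcoef T (zz y - zz x) * v x * cj (v y)).
Proof.
move=> T0; have := toeplitz_ge0 zz (fun x => (a x)%:C * v x) T0.
rewrite lecE => /andP[_]; congr (_ <= _); rewrite Re_sum; apply: eq_bigr => x _.
rewrite Re_sum; apply: eq_bigr => y _.
case: (tcoef _ _) (v x) (v y) => [b1 b2] [? ?] [? ?].
by rewrite /cj /=; ring.
Qed.

(** Positivity applied to [1 - tfun T], whose list of coefficients is [T']; the constant 1
    contributes the diagonal. *)
Lemma toeplitz_psd_le (X : finType) (zz : X -> Z) (T : seq (Z * C)) (v : X -> C) a :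
  injective zz -> (forall x, tfun T x <= 1) ->
  \sum_x \sum_y a x * a y * complex.Re (tcoef T (zz y - zz x) * v x * cj (v y)) <=
  \sum_x a x ^+ 2 * sqn (v x).
Proof.
move=> zinj T1; pose T' := (0, 1) :: [seq (p.1, - p.2) | p <- T].
have tc m : tcoef T' m = (m == 0)%:R - tcoef T m.
  rewrite /tcoef /T' big_cons big_map /= sumrN eq_sym.
  by case: (m == 0); rewrite // add0r.
have T'0 x : 0 <= tfun T' x.
  rewrite /tfun /T' big_cons big_map /=.
  under eq_bigr do rewrite mulNr.
  by rewrite sumrN mul1r /dotZ big1 ?expi0 ?subr_ge0 ?T1 // => i _; rewrite !mxE mul0r.
rewrite -subr_ge0; have := toeplitz_psd zz v a T'0; congr (_ <= _).
rewrite -sumrB; apply: eq_bigr => x _.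
under eq_bigr do rewrite tc.
have -> : a x ^+ 2 * sqn (v x) = \sum_y a x * a y * complex.Re ((zz y - zz x == 0)%:R * v x * cj (v y)).
  rewrite (bigD1 x) //= subrr eqxx mul1r mul_cj /= big1 ?addr0 -?expr2 // => y yx.
  by rewrite subr_eq0 (inj_eq zinj) (negbTE yx) !mul0r mulr0.
rewrite -sumrB; apply: eq_bigr => y _.
set b := (_ == _)%:R; case: b (tcoef _ _) (v x) (v y) => [? ?] [? ?] [? ?] [? ?].
by rewrite /cj /=; ring.
Qed.

Variables (s : seq (Z * (V -> C))) (A Lp : R).
Hypothesis A0 : 0 <= A.
Hypothesis Lp0 : 0 <= Lp.
Hypothesis sA : forall m xi, cabs (tcoef (sval s xi) m) <= A.
Hypothesis sL : forall m xi eta,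
  cabs (tcoef (sval s xi) m - tcoef (sval s eta) m) <= Lp * `|xi - eta|.
Hypothesis s0 : forall xi x, 0 <= tfun (sval s xi) x.
Hypothesis s1 : forall xi x, tfun (sval s xi) x <= 1.

Variables (X : finType) (zz : X -> Z) (h : R).
Hypothesis zinj : injective zz.
Hypothesis h0 : 0 <= h.

(* The matrix of the Weyl quantization in the basis of exponentials. *)
Definition weyl_mx (x y : X) : C :=
  tcoef (sval s ((h / 2) *: toZ R (zz x + zz y))) (zz y - zz x).

Lemma weyl_mx_le x y : cabs (weyl_mx x y) <= if zz y - zz x \in freqs s then A else 0.
Proof. by case: ifPn => [_|nF]; [exact: sA|rewrite /weyl_mx tcoef_notin // cabs0]. Qed.

Definition mean_at (x : X) : R := complex.Re (tcoef (sval s (h *: toZ R (zz x))) 0).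

Variables (e : rel X) (D : R) (good : pred X) (Q N : nat) (phase : X -> R).
Hypothesis e_sym : symmetric e.
Hypothesis D0 : 0 <= D.
Hypothesis eD : forall x y, connect e x y -> l1 (toZ R (zz y) - toZ R (zz x)) <= D.
Hypothesis goodQ : forall x, (#|[pred y | connect e x y && good y]| <= Q)%N.
Hypothesis N0 : (0 < N)%N.
Hypothesis eN : forall x y, weyl_mx x y != 0 -> ~~ connect e x y ->
  N%:R <= `|phase x - phase y|.

Let rho := fingraph.root e.
Let csym := sym_connect_sym e_sym.
Let rhoP x y : (rho x == rho y) = connect e x y.
Proof. exact: root_connect. Qed.

Let ksi x := h *: toZ R (zz x).
(** The Weyl matrix with its frequency frozen at the root of the cluster of [x]; within one cluster
    it is a Toeplitz matrix. *)
Let fz x y : C := tcoef (sval s (ksi (rho x))) (zz y - zz x).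

Lemma frozen_le (v : X -> C) :
  \sum_x \sum_(y | rho y == rho x) complex.Re (fz x y * v x * cj (v y)) <=
  2 * Q%:R * (\sum_(x | good x) sqn (v x) * complex.Re (tcoef (sval s (ksi (rho x))) 0)) +
  2 * \sum_(x | ~~ good x) sqn (v x).
Proof.
pose p r x y := complex.Re (tcoef (sval s (ksi r)) (zz y - zz x) * v x * cj (v y)).
rewrite (partition_big rho xpredT) //=.
rewrite [X in _ * X + _](partition_big rho xpredT) //= mulr_sumr.
rewrite [X in _ + _ * X](partition_big rho xpredT) //= mulr_sumr -big_split /=.
apply: ler_sum => r _.
have -> : \sum_(x | rho x == r) \sum_(y | rho y == rho x) complex.Re (fz x y * v x * cj (v y)) =
    \sum_(x | rho x == r) \sum_(y | rho y == r) p r x y.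
  apply: eq_bigr => x /eqP xr; rewrite xr; apply: eq_bigr => y _.
  by rewrite /fz /p xr.
have -> : \sum_(x | good x && (rho x == r)) sqn (v x) * complex.Re (tcoef (sval s (ksi (rho x))) 0) =
    \sum_(x | (rho x == r) && good x) p r x x.
  under eq_bigl do rewrite andbC.
  apply: eq_bigr => x /andP[/eqP -> _]; rewrite /p subrr -mulrA mul_cj.
  by rewrite Re_M /= mulr0 subr0 mulrC.
under [X in _ + _ * X]eq_bigl do rewrite andbC.
apply: psd_cluster.
- by move=> a; apply: toeplitz_psd.
- by move=> a; apply: toeplitz_psd_le.
- have [x0 x0r|none] := pickP (fun x => rho x == r); last first.
    by rewrite eq_card0 // => x; rewrite !inE none.
  apply: leq_trans (goodQ x0); apply: subset_leq_card; apply/fintype.subsetP => x.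
  by rewrite !inE -rhoP (eqP x0r) eq_sym.
Qed.

Let hkD x y : connect e x y -> `|ksi y - ksi x| <= h * D.
Proof.
move=> /eD xy; rewrite /ksi -scalerBr normrZ (ger0_norm h0) ler_wpM2l //.
exact: le_trans (le_norm_l1 _) xy.
Qed.

Let Fs := (size (freqs s))%:R : R.

(** Inside a cluster both points are within [h * D] of the root, so freezing changes each entry by
    at most [Lp * (h * D)], on the diagonals of [freqs s] only. *)
Lemma freeze_le (v : X -> C) : mass v <= 1 ->
  \sum_x \sum_(y | rho y == rho x) complex.Re ((weyl_mx x y - fz x y) * v x * cj (v y)) <=
  Lp * (h * D) * Fs.
Proof.
move=> v1; under eq_bigr do rewrite big_mkcond.
have B0 : 0 <= Lp * (h * D) by rewrite !mulr_ge0.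
apply: le_trans (banded_sum_le (F := freqs s) (z := v) (w := v) zinj B0 _) _.
  move=> x y; have [F|nF] := boolP (_ \in freqs s); last first.
    by case: ifP => _; rewrite /weyl_mx /fz // !tcoef_notin // subrr !mul0r.
  case: ifPn => [xy|_]; last by rewrite mulr_ge0 // divr_ge0 // addr_ge0 // sqn_ge0.
  apply: le_trans (ler_norm _) _; apply: Re_form_le.
  apply: le_trans (sL _ _ _) _; rewrite ler_wpM2l //.
  have cx : connect e (rho x) x by rewrite csym connect_root.
  have cy : connect e (rho x) y by rewrite -(eqP xy) csym connect_root.
  (* The Weyl symbol is evaluated at the midpoint of [ksi x] and [ksi y]. *)
  have -> : (h / 2) *: toZ R (zz x + zz y) - ksi (rho x) =
      2^-1 *: (ksi x - ksi (rho x)) + 2^-1 *: (ksi y - ksi (rho x)).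
    apply/rowP => j; rewrite /ksi !mxE rmorphD /=; by field.
  apply: le_trans (ler_normD _ _) _; rewrite !normrZ ger0_norm ?invr_ge0 //.
  have := hkD cx; have := hkD cy; lra.
rewrite -[leRHS]mulr1 ler_wpM2l ?mulr_ge0 //; lra.
Qed.

Let v (z : X -> C) (t : R) (x : X) : C := expi (- (t * phase x)) * z x.

Let massv z t : mass (v z t) = mass z.
Proof. by apply: eq_bigr => x _; rewrite /v sqnM sqn_expi mul1r. Qed.

(** The form splits into frozen cluster blocks, freezing errors, and pairs in different clusters.
    The first two are bounded at each time. The last oscillate at speed at least [N], so their
    integral is of size [A / N] whatever the length of the interval. The term [2 * Q] next to [Fs]
    pays for moving the mean of the symbol from the root of a cluster back to each of its points. *)
Lemma finite_estimate (z : X -> C) (a b : R) : a <= b -> mass z <= 1 ->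
  \int[leb]_(t in `[a, b]) bform weyl_mx (v z t) (v z t) <=
  (b - a) * (2 * Q%:R * (\sum_x sqn (z x) * mean_at x) +
             2 * (\sum_(x | ~~ good x) sqn (z x)) +
             h * (Lp * D * (Fs + 2 * Q%:R))) + 4 * A * Fs / N%:R.
Proof.
move=> ab z1.
pose c x y := weyl_mx x y * z x * cj (z y).
pose off t := \sum_x \sum_(y | rho y != rho x) osc (c x y) (phase x - phase y) t.
set K := 2 * Q%:R * _ + _ + _.
have vosc t x y : complex.Re (weyl_mx x y * v z t x * cj (v z t y)) = osc (c x y) (phase x - phase y) t.
  rewrite /osc /v /c; congr complex.Re.
  by rewrite cjM -expiN mulrBr opprB expiD opprK; ring.
have split_t t : bform weyl_mx (v z t) (v z t) <= K + off t.
  have -> : bform weyl_mx (v z t) (v z t) =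
     \sum_x \sum_(y | rho y == rho x) complex.Re (fz x y * v z t x * cj (v z t y)) +
     \sum_x \sum_(y | rho y == rho x) complex.Re ((weyl_mx x y - fz x y) * v z t x * cj (v z t y)) +
     off t.
    rewrite /bform -!big_split; apply: eq_bigr => x _ /=.
    rewrite (bigID (fun y => rho y == rho x)) /= -big_split; congr (_ + _).
      apply: eq_bigr => y _ /=.
      case: (weyl_mx x y) (fz x y) (v z t x) (v z t y) => [? ?] [? ?] [? ?] [? ?].
      by rewrite /cj /=; ring.
    apply: eq_bigr => y _; exact: vosc.
  apply: lerD => //.
  apply: le_trans (lerD (frozen_le _) (freeze_le _)) _; first by rewrite massv.
  have sv x : sqn (v z t x) = sqn (z x) by rewrite /v sqnM sqn_expi mul1r.
  under eq_bigr do rewrite sv; under [in X in _ + X + _]eq_bigr do rewrite sv.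
  have g1 : \sum_(x | good x) sqn (z x) * complex.Re (tcoef (sval s (ksi (rho x))) 0) <=
     \sum_x sqn (z x) * mean_at x + Lp * (h * D).
    have mean0 x : 0 <= mean_at x.
      by have := trig_ge0 (s0 (ksi x)); rewrite lecE => /andP[].
    have b0 : 0 <= Lp * (h * D) by rewrite !mulr_ge0.
    apply: (@le_trans _ _ (\sum_x sqn (z x) * (mean_at x + Lp * (h * D)))).
      rewrite big_mkcond; apply: ler_sum => x _; case: ifP => _; last first.
        by rewrite mulr_ge0 ?sqn_ge0 // addr_ge0.
      rewrite ler_wpM2l ?sqn_ge0 // -lerBlDl -raddfB /=.
      apply: le_trans (ler_norm _) _; apply: le_trans (Re_le_cabs _) _.
      apply: le_trans (sL _ _ _) _; rewrite ler_wpM2l //.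
      by apply: hkD; exact: connect_root.
    under eq_bigr do rewrite mulrDr.
    rewrite big_split lerD2l /= -mulr_suml -[leRHS]mul1r ler_wpM2r //.
  have Q0 : 0 <= 2 * Q%:R :> R by rewrite mulr_ge0.
  have := ler_wpM2l Q0 g1; rewrite /K; lra.
have iosc x y : leb.-integrable `[a, b] (EFin \o osc (c x y) (phase x - phase y)).
  exact: integrable_osc.
have ibf : leb.-integrable `[a, b] (EFin \o (fun t => bform weyl_mx (v z t) (v z t))).
  have -> : (fun t => bform weyl_mx (v z t) (v z t)) =
      fun t => \sum_x \sum_y osc (c x y) (phase x - phase y) t.
    by apply/funext => t; apply: eq_bigr => x _; apply: eq_bigr => y _; exact: vosc.
  by apply: integrable_sumR => // x; exact: integrable_sumR.
have offE : off = fun t => \sum_x \sum_y (if rho y != rho x then osc (c x y) (phase x - phase y) t else 0).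
  by apply/funext => t; apply: eq_bigr => x _; rewrite big_mkcond.
have ioff' x y : leb.-integrable `[a, b] (EFin \o (fun t =>
    if rho y != rho x then osc (c x y) (phase x - phase y) t else 0)).
  by case: (rho y != rho x); [exact: iosc|exact: integrable0].
have ioff : leb.-integrable `[a, b] (EFin \o off).
  by rewrite offE; apply: integrable_sumR => // x; exact: integrable_sumR.
have iK : leb.-integrable `[a, b] (EFin \o (fun=> K)).
  apply: continuous_compact_integrable; first exact: segment_compact.
  by apply: continuous_subspaceT => x; exact: cvg_cst.
apply: le_trans (le_Rintegral _ ibf (integrableDR _ iK ioff) _) _ => //.
rewrite RintegralD // Rintegral_cst //= lebesgue_measure_itv /=.
have -> : fine (if ((a%:E < b%:E)%E) then (b%:E - a%:E)%E else 0%E) = b - a.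
  rewrite lte_fin; case: ltP => //= ba; apply/eqP; rewrite eq_sym subr_eq0 eq_le ab ba //.
rewrite mulrC lerD2l offE Rintegral_sum //; last by move=> x; exact: integrable_sumR.
under eq_bigr => x _ do rewrite Rintegral_sum //.
have NR : 0 < N%:R :> R by rewrite ltr0n.
have A4 : 0 <= 4 * A / N%:R by rewrite divr_ge0 ?mulr_ge0 // ltW.
(* The pairs in different clusters are summed after integration, by the same Schur test with
   [4 * A / N] as bound of the entries. *)
apply: le_trans (banded_sum_le (F := freqs s) (z := z) (w := z) zinj A4 _) _; last first.
  rewrite -[leRHS]mulr1 (_ : 4 * A * Fs / N%:R = 4 * A / N%:R * Fs) /Fs; last by ring.
  by rewrite ler_wpM2l ?mulr_ge0 //; lra.
move=> x y; have [xy|_] := boolP (rho y != rho x); last first.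
  rewrite Rintegral_cst // mul0r; case: ifP => // _.
  by rewrite mulr_ge0 // divr_ge0 // addr_ge0 // sqn_ge0.
have [w0|w0] := eqVneq (weyl_mx x y) 0.
  rewrite (_ : \int[_]_(t in _) _ = 0).
    by case: ifP => // _; rewrite mulr_ge0 // divr_ge0 // addr_ge0 // sqn_ge0.
  under eq_Rintegral do rewrite /osc /c w0 !mul0r /=.
  by rewrite Rintegral_cst // mul0r.
have nxy : ~~ connect e x y by rewrite -rhoP eq_sym.
have pN := eN w0 nxy.
have pp : 0 < `|phase x - phase y| by rewrite (lt_le_trans NR).
apply: le_trans (integral_osc_le _ ab _) _; first by rewrite -normr_gt0.
case: ifPn => F; last by rewrite /c /weyl_mx tcoef_notin // !mul0r cabs0 mulr0 mul0r.
apply: (@le_trans _ _ (4 * cabs (c x y) / N%:R)).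
  by rewrite ler_wpM2l ?mulr_ge0 ?cabs_ge0 // lef_pV2.
have -> : 4 * A / N%:R * ((sqn (z x) + sqn (z y)) / 2) =
    4 * (A * ((sqn (z x) + sqn (z y)) / 2)) / N%:R by ring.
rewrite ler_pM2r ?invr_gt0 // ler_pM2l //.
by apply: cabs_form_le; exact: sA.
Qed.

End finite_estimate.

Section almost_everywhere.
Context dT (T : measurableType dT) (R : realType) (mu : {measure set T -> \bar R}).
Implicit Types P Q : set T.

Lemma ae_imply P Q : P `<=` Q -> {ae mu, forall x, P x} -> {ae mu, forall x, Q x}.
Proof. by move=> PQ [A [mA A0 PA]]; exists A; split => // x nQ; apply: PA => /PQ. Qed.

Lemma ae_imply2 P P' Q : (forall x, P x -> P' x -> Q x) ->
  {ae mu, forall x, P x} -> {ae mu, forall x, P' x} -> {ae mu, forall x, Q x}.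
Proof.
move=> PQ N1 N2; apply: negligibleS (negligibleU N1 N2) => x /= nQ.
by have [Px|nPx] := pselect (P x); [right => P'x; apply: nQ; exact: PQ|left].
Qed.

End almost_everywhere.

(** * From the propagator to finitely many modes *)

Section duhamel.
Variable R : realType.
Local Notation C := R[i].
Local Notation leb := (@lebesgue_measure R).

Lemma sin_le_id (x : R) : 0 <= x -> `|sin x| <= x.
Proof.
move=> x0; have [c _] := @MVT_segment R sin cos 0 x x0 (fun c _ => is_derive_sin c)
  (continuous_subspaceT (@continuous_sin R)).
rewrite sin0 !subr0 => ->; rewrite normrM (ger0_norm x0) -[leRHS]mul1r ler_wpM2r //.
by rewrite ler_norml cos_geN1 cos_le1.
Qed.

Lemma one_sub_cos_le (x : R) : 0 <= x -> `|1 - cos x| <= x ^+ 2 /\ `|1 - cos x| <= x.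
Proof.
move=> x0; have [c] := @MVT_segment R cos (fun x => - sin x) 0 x x0 (fun c _ => is_derive_cos c)
  (continuous_subspaceT (@continuous_cos R)).
rewrite in_itv /= => /andP[c0 cx]; rewrite cos0 subr0 distrC => ->.
rewrite normrM normrN (ger0_norm x0); split.
  by rewrite expr2 ler_wpM2r // (le_trans (sin_le_id c0)).
by rewrite -[leRHS]mul1r ler_wpM2r // ler_norml sin_geN1 sin_le1.
Qed.

Lemma id_sub_sin_le (x : R) : 0 <= x -> `|x - sin x| <= x ^+ 2.
Proof.
move=> x0; have dg (c : R) : is_derive c 1 (id - sin) (1 - cos c) by apply: is_deriveB.
have [|c] := @MVT_segment R (id - sin) (fun c => 1 - cos c) 0 x x0 (fun c _ => dg c).
  apply: continuous_subspaceT => y; apply: differentiable_continuous; apply/derivable1_diffP.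
  by have [] := dg y.
rewrite in_itv /= => /andP[c0 cx]; rewrite !fctE sin0 !subr0 => ->.
rewrite normrM (ger0_norm x0) expr2 ler_wpM2r //.
by have [_] := one_sub_cos_le c0; move/le_trans; apply.
Qed.

Lemma expi_taylor (x : R) : cabs (1 - 'i%C * x%:C - expi (- x)) <= 2 * x ^+ 2.
Proof.
have cabs_le (z : C) : cabs z <= `|complex.Re z| + `|complex.Im z|.
  rewrite -(@ler_pXn2r _ 2) ?nnegrE ?cabs_ge0 ?addr_ge0 // -sqn_cabs /sqn.
  rewrite sqrrD !real_normK ?num_real //.
  by rewrite addrAC lerDl mulrn_wge0 // mulr_ge0.
apply: le_trans (cabs_le _) _; rewrite /expi /= cosN sinN.
have -> : 1 - (0 * x - 1 * 0) - cos x = 1 - cos x by ring.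
have -> : 0 - (0 * 0 + 1 * x) - - sin x = - (x - sin x) by ring.
rewrite normrN; have [x0|/ltW x0] := leP 0 x.
  by have [h _] := one_sub_cos_le x0; have := id_sub_sin_le x0; lra.
have nx0 : 0 <= - x by lra.
have [h _] := one_sub_cos_le nx0; have := id_sub_sin_le nx0.
have -> : - x - sin (- x) = - (x - sin x) by rewrite sinN; ring.
by move: h; rewrite cosN sqrrN normrN; lra.
Qed.

(** [f] is replaced by its minimum with [B], equal to it almost everywhere, in order to compare
    integrands everywhere. *)
Lemma Rintegral_ae_le (f : R -> R) (B s t : R) : s <= t ->
  leb.-integrable `[s, t] (EFin \o f) -> {ae leb, forall r, f r <= B} ->
  \int[leb]_(r in `[s, t]) f r <= B * (t - s).
Proof.
move=> st fi fB.
have mI : measurable (`[s, t]%classic : set (measurableTypeR R)) by exact: measurable_itv.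
have icst : leb.-integrable `[s, t] (EFin \o cst B).
  apply: continuous_compact_integrable; first exact: segment_compact.
  by apply: continuous_subspaceT => x; exact: cvg_cst.
have mf := measurable_int _ fi; have mB := measurable_int _ icst.
pose g r := Num.min (f r) B.
have mg : measurable_fun `[s, t] (EFin \o g).
  have /measurable_EFinP mf' := mf; have /measurable_EFinP mB' := mB.
  by apply/measurable_EFinP; exact: measurable_minr.
have fg : ae_eq leb (`[s, t]%classic : set (measurableTypeR R)) (EFin \o f) (EFin \o g).
  by apply: ae_imply fB => r frB _ /=; rewrite /g min_l.
have -> : \int[leb]_(r in `[s, t]) f r = \int[leb]_(r in `[s, t]) g r.
  by rewrite /Rintegral; congr fine; exact: (ae_eq_integral _ _ mI mf mg fg).
have ig : leb.-integrable `[s, t] (EFin \o g).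
  apply/integrableP; split => //.
  have /integrableP[_] := fi; congr (_ < _)%E.
  apply: (ae_eq_integral _ _ mI); [exact: measurableT_comp|exact: measurableT_comp|].
  by apply: ae_imply fg => r fgr /fgr /= [->].
have -> : B * (t - s) = \int[leb]_(r in `[s, t]) (cst B r).
  rewrite Rintegral_cst //= lebesgue_measure_itv /= lte_fin.
  case: ltP => //= ts; congr (_ * _); apply/eqP; rewrite subr_eq0 eq_le ts st //.
by apply: le_Rintegral => // r _; rewrite /g ge_min lexx orbT.
Qed.

End duhamel.

(** * Distance to the free evolution *)

Section duhamel_bound.
Variable R : realType.
Local Notation C := R[i].
Local Notation leb := (@lebesgue_measure R).

Lemma lipschitz_continuousR (f : R -> R) (L : R) :
  (forall s t, s <= t -> `|f t - f s| <= L * (t - s)) -> continuous f.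
Proof.
move=> fL x; have L0 : 0 <= L.
  have := fL 0 1 ler01; rewrite subr0 mulr1; exact: le_trans.
have fL' s t : `|f t - f s| <= L * `|t - s|.
  have [st|/ltW ts] := leP s t; first by rewrite (ger0_norm (_ : 0 <= t - s)) ?subr_ge0 // fL.
  by rewrite distrC (distrC t) (ger0_norm (_ : 0 <= s - t)) ?subr_ge0 // fL.
have L1 : 0 < L + 1 by rewrite ltr_wpDl.
apply/cvgrPdist_lt => e e0; apply/nbhs_ballP; exists (e / (L + 1)); first exact: divr_gt0.
move=> y; rewrite /ball /= ltr_pdivlMr // => xy.
apply: le_lt_trans (fL' _ _) _; apply: le_lt_trans xy.
by rewrite mulrC ler_wpM2l // lerDl.
Qed.

Lemma continuous_integrable (f : R -> R) s t : continuous f ->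
  leb.-integrable `[s, t] (EFin \o f).
Proof.
move=> cf; apply: continuous_compact_integrable; first exact: segment_compact.
exact: continuous_subspaceT.
Qed.

Variables (X : finType) (w : X -> R) (psi F : R -> X -> C) (M : R).
Hypothesis M0 : 0 <= M.
Hypothesis psi_eq : forall x s t, s <= t ->
  let rhs r := (w x)%:C * psi r x + F r x in
  cintegrable leb `[s, t] rhs /\
  'i%C * (psi t x - psi s x) = cintegral leb `[s, t] rhs.
Hypothesis psi1 : forall r x, cabs (psi r x) <= 1.
Hypothesis FM : {ae leb, forall r, mass (F r) <= M ^+ 2}.

Let rhs x r := (w x)%:C * psi r x + F r x.
Let L x := `|w x| + M.

Let psiE x s t : s <= t -> psi t x - psi s x = - 'i%C * cintegral leb `[s, t] (rhs x).
Proof.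
by move=> /(psi_eq x)[_ <-]; rewrite mulrA mulNr -expr2 sqr_i opprK mul1r.
Qed.

Let cabs_realC (a : R) : cabs a%:C = `|a|.
Proof. by rewrite /cabs normc_def /= expr0n addr0 sqrtr_sqr. Qed.

Let rhs_le x : {ae leb, forall r, cabs (rhs x r) <= L x}.
Proof.
apply: ae_imply FM => r Fr; apply: le_trans (cabsD _ _) _; apply: lerD.
  by rewrite cabsM cabs_realC -[leRHS]mulr1 ler_wpM2l.
rewrite -(@ler_pXn2r _ 2) ?nnegrE ?cabs_ge0 // -sqn_cabs; apply: le_trans Fr.
by rewrite /mass (bigD1 x) //= lerDl sumr_ge0 // => y _; exact: sqn_ge0.
Qed.

Let int_le (f : R -> R) B s t : s <= t -> leb.-integrable `[s, t] (EFin \o f) ->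
  {ae leb, forall r, `|f r| <= B} -> `|\int[leb]_(r in `[s, t]) f r| <= B * (t - s).
Proof.
move=> st fi fB; apply: le_trans (le_normr_Rintegral _ fi) _ => //.
by apply: Rintegral_ae_le => //; exact: integrable_norm.
Qed.

Let psi_lip x s t : s <= t ->
  `|complex.Re (psi t x) - complex.Re (psi s x)| <= L x * (t - s) /\
  `|complex.Im (psi t x) - complex.Im (psi s x)| <= L x * (t - s).
Proof.
move=> st; have [[i1 i2] _] := psi_eq x st.
have h (f : R -> R) : leb.-integrable `[s, t] (EFin \o f) ->
    (forall r, `|f r| <= cabs (rhs x r)) -> `|\int[leb]_(r in `[s, t]) f r| <= L x * (t - s).
  move=> fi fr; apply: int_le => //; apply: ae_imply (rhs_le x) => r.
  exact: le_trans.
have E := psiE x st.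
have -> : complex.Re (psi t x) - complex.Re (psi s x) =
    \int[leb]_(r in `[s, t]) complex.Im (rhs x r).
  by have := congr1 (@complex.Re R) E; rewrite raddfB /= => ->; ring.
have -> : complex.Im (psi t x) - complex.Im (psi s x) =
    - \int[leb]_(r in `[s, t]) complex.Re (rhs x r).
  by have := congr1 (@complex.Im R) E; rewrite raddfB /= => ->; ring.
by rewrite normrN; split; apply: h => // r; [exact: Im_le_cabs|exact: Re_le_cabs].
Qed.

Lemma duhamel_continuous x :
  continuous (fun r => complex.Re (psi r x)) /\ continuous (fun r => complex.Im (psi r x)).
Proof.
by split; apply: (lipschitz_continuousR (L := L x)) => s t /(psi_lip x)[].
Qed.

Let psi_int x s t : cintegrable leb `[s, t] (fun r => psi r x).
Proof. by have [c1 c2] := duhamel_continuous x; split; exact: continuous_integrable. Qed.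

Let F_int x s t : s <= t -> cintegrable leb `[s, t] (fun r => F r x).
Proof.
move=> st; have [i _] := psi_eq x st.
have -> : (fun r => F r x) = (fun r => rhs x r + (- (w x)%:C) * psi r x).
  by apply/funext => r; rewrite /rhs mulNr addrAC subrr add0r.
by apply: cintegrableD => //; apply: cintegrableZ.
Qed.

(** The deviation at time [t] from the free evolution started at time [s]. *)
Let E s t x := psi t x - expi (- ((t - s) * w x)) * psi s x.

Let cint_cst (c : C) s t : s <= t ->
  cintegrable leb `[s, t] (fun=> c) /\ cintegral leb `[s, t] (fun=> c) = (t - s)%:C * c.
Proof.
move=> st; have i (a : R) : leb.-integrable `[s, t] (EFin \o (fun=> a)).
  by apply: continuous_integrable => ?; exact: cvg_cst.
split; first by split; exact: i.
have m : fine (leb `[s, t]%classic) = t - s.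
  rewrite lebesgue_measure_itv /= lte_fin; case: ltP => //= ts.
  by apply/eqP; rewrite eq_sym subr_eq0 eq_le ts st.
rewrite /cintegral !Rintegral_cst // m; case: (c) => a b /=.
by apply/eqP; rewrite eq_complex /=; apply/andP; split; apply/eqP; ring.
Qed.

(** The two terms without [F] are of order [(t - s) ^+ 2] on each mode, with constants that depend
    on [w]. *)
Let EE s t x : s <= t -> E s t x =
  - 'i%C * (w x)%:C * cintegral leb `[s, t] (fun r => psi r x - psi s x) +
  - 'i%C * cintegral leb `[s, t] (fun r => F r x) +
  (1 - 'i%C * ((t - s) * w x)%:C - expi (- ((t - s) * w x))) * psi s x.
Proof.
move=> st; have [ic cc] := cint_cst (- psi s x) st.
have ip := psi_int x s t; have iF := F_int x st.
rewrite cintegralD // cc /E.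
have -> : psi t x = psi s x + - 'i%C * cintegral leb `[s, t] (rhs x).
  by rewrite -psiE // addrC subrK.
rewrite /rhs cintegralD //; last exact: cintegrableZ.
by rewrite cintegralZ // rmorphM /=; ring.
Qed.

Definition pairing (e v : X -> C) : R := \sum_x complex.Re (e x * cj (v x)).

Lemma pairing_le e v l : 0 < l -> pairing e v <= (l * mass e + mass v / l) / 2.
Proof.
move=> l0; rewrite /pairing /mass mulr_sumr mulr_suml -big_split mulr_suml /=.
apply: ler_sum => x _; apply: le_trans (ler_norm _) _; apply: le_trans (Re_le_cabs _) _.
rewrite cabsM cabs_cj !sqn_cabs.
have := sqr_ge0 (l * cabs (e x) - cabs (v x)).
rewrite sqrrB exprMn => h.
rewrite ler_pdivlMr // -(ler_pM2l l0).
have -> : l * (l * cabs (e x) ^+ 2 + cabs (v x) ^+ 2 / l) =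
    l ^+ 2 * cabs (e x) ^+ 2 + cabs (v x) ^+ 2 by field; rewrite gt_eqF.
lra.
Qed.

(** [B] depends on [v] through its moduli only, because the telescoping below tests against rotated
    copies of one vector. The linear term carries the sharp constant in [M]; the quadratic one,
    however large in [w], disappears under subdivision. *)
Let step_bound (v : X -> C) l : 0 < l -> exists2 B, 0 <= B & forall (v' : X -> C) s t,
  (forall x, cabs (v' x) = cabs (v x)) -> s <= t ->
  pairing (E s t) v' <= (l * M ^+ 2 + mass v / l) / 2 * (t - s) + B * (t - s) ^+ 2.
Proof.
move=> l0.
pose Bx x := (`|w x| * (2 * L x) + 2 * w x ^+ 2) * cabs (v x).
have L0 x : 0 <= L x by rewrite addr_ge0.
exists (\sum_x Bx x).
  apply: sumr_ge0 => x _; rewrite mulr_ge0 ?cabs_ge0 // addr_ge0 //; by [rewrite !mulr_ge0|rewrite mulr_ge0 ?sqr_ge0].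
move=> v' s t vv st.
have mv : mass v' = mass v by apply: eq_bigr => x _; rewrite !sqn_cabs vv.
have ts : 0 <= t - s by rewrite subr_ge0.
pose P x := complex.Re (- 'i%C * cintegral leb `[s, t] (fun r => F r x) * cj (v' x)).
have -> : pairing (E s t) v' = \sum_x P x + \sum_x (complex.Re (E s t x * cj (v' x)) - P x).
  by rewrite -big_split; apply: eq_bigr => x _ /=; rewrite addrC subrK.
apply: lerD.
  pose f r := \sum_x complex.Re (- 'i%C * F r x * cj (v' x)).
  have fx r x : complex.Re (- 'i%C * F r x * cj (v' x)) =
      complex.Re (- 'i%C * cj (v' x)) * complex.Re (F r x) -
      complex.Im (- 'i%C * cj (v' x)) * complex.Im (F r x).
    by case: (F r x) (v' x) => [? ?] [? ?]; rewrite /cj /=; ring.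
  have iz k g : leb.-integrable `[s, t] (EFin \o g) ->
      leb.-integrable `[s, t] (EFin \o (fun x : R => k * g x)) by exact: integrableZR.
  have ifx x : leb.-integrable `[s, t] (EFin \o (fun r => complex.Re (- 'i%C * F r x * cj (v' x)))).
    rewrite (funext (fun r => fx r x)).
    have [j1 j2] := F_int x st.
    by apply: integrableBR => //; exact: iz.
  have -> : \sum_x P x = \int[leb]_(r in `[s, t]) f r.
    rewrite Rintegral_sum //; apply: eq_bigr => x _; rewrite /P.
    under eq_Rintegral do rewrite fx.
    have [j1 j2] := F_int x st.
    rewrite RintegralB // ?RintegralZl //; try exact: iz.
    by rewrite /cintegral; case: (v' x) => [? ?]; rewrite /cj /=; ring.
  apply: Rintegral_ae_le => //; first exact: integrable_sumR.
  apply: ae_imply FM => r Fr.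
  have -> : f r = pairing (fun x => - 'i%C * F r x) v' by [].
  apply: le_trans (pairing_le _ _ l0) _; rewrite mv.
  have -> : mass (fun x => - 'i%C * F r x) = mass (F r).
    apply: eq_bigr => x _; rewrite sqnM.
    have -> : sqn (- 'i%C) = 1 :> R by rewrite /sqn /= oppr0 expr0n add0r sqrrN expr1n.
    by rewrite mul1r.
  by rewrite ler_pM2r // lerD2r ler_pM2l.
rewrite mulr_suml; apply: ler_sum => x _.
rewrite /P EE //.
set I1 := cintegral leb _ (fun r : measurableTypeR R => psi r x - psi s x); set I2 := cintegral leb _ (F^~ x).
set T := 1 - _ - _.
have -> : complex.Re ((- 'i%C * (w x)%:C * I1 + - 'i%C * I2 + T * psi s x) * cj (v' x)) -
    complex.Re (- 'i%C * I2 * cj (v' x)) =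
    complex.Re ((- 'i%C * (w x)%:C * I1 + T * psi s x) * cj (v' x)).
  by rewrite -raddfB /=; congr complex.Re; ring.
apply: le_trans (ler_norm _) _; apply: le_trans (Re_le_cabs _) _.
rewrite cabsM cabs_cj vv /Bx [leRHS]mulrAC ler_wpM2r ?cabs_ge0 //.
apply: le_trans (cabsD _ _) _; rewrite [leRHS]mulrDl; apply: lerD.
  have ci : cabs (- 'i%C : C) = 1.
    by rewrite cabsN /cabs normc_def /= expr0n add0r expr1n sqrtr1.
  rewrite !cabsM ci mul1r cabs_realC -mulrA ler_wpM2l //.
  have cabs_le (z : C) : cabs z <= `|complex.Re z| + `|complex.Im z|.
    rewrite -(@ler_pXn2r _ 2) ?nnegrE ?cabs_ge0 ?addr_ge0 // -sqn_cabs /sqn.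
    rewrite sqrrD !real_normK ?num_real //.
    by rewrite addrAC lerDl mulrn_wge0 // mulr_ge0.
  apply: le_trans (cabs_le _) _.
  have h (f : R -> R) : leb.-integrable `[s, t] (EFin \o f) ->
      (forall r, s <= r -> `|f r - f s| <= L x * (r - s)) ->
      `|\int[leb]_(r in `[s, t]) (f r - f s)| <= L x * (t - s) ^+ 2.
    move=> fi fL.
    have ifs : leb.-integrable `[s, t] (EFin \o (fun r => f r - f s)).
      by apply: integrableBR => //; apply: continuous_integrable => ?; exact: cvg_cst.
    apply: le_trans (le_normr_Rintegral _ ifs) _ => //.
    apply: (@le_trans _ _ (\int[leb]_(r in `[s, t]) (L x * (t - s)))).
      apply: le_Rintegral => //.
      - exact: integrable_norm.
      - by apply: continuous_integrable => ?; exact: cvg_cst.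
      - move=> r /=; rewrite in_itv /= => /andP[sr rt].
        apply: le_trans (fL r sr) _; rewrite ler_wpM2l // lerD2r //.
    rewrite Rintegral_cst //= lebesgue_measure_itv /= lte_fin.
    case: ltP => /= _; first by rewrite expr2 mulrA.
    by rewrite mulr0 mulr_ge0 // sqr_ge0.
  have [c1 c2] := psi_int x s t.
  rewrite -mulrA (mulr_natl _ 2) mulr2n; apply: lerD.
    have -> : complex.Re I1 = \int[leb]_(r in `[s, t]) (complex.Re (psi r x) - complex.Re (psi s x)).
      by apply: eq_Rintegral => r _; rewrite raddfB.
    by apply: h => // r /(psi_lip x)[].
  have -> : complex.Im I1 = \int[leb]_(r in `[s, t]) (complex.Im (psi r x) - complex.Im (psi s x)).
    by apply: eq_Rintegral => r _; rewrite raddfB.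
  by apply: h => // r /(psi_lip x)[].
rewrite cabsM -[leRHS]mulr1 ler_pM ?cabs_ge0 //.
by apply: le_trans (expi_taylor _) _; rewrite exprMn; lra.
Qed.

(** Duhamel's bound by duality and subdivision, from the equation in integrated form. Short steps
    are telescoped, the free evolution being moved to the test vector; the quadratic errors vanish
    as the steps shrink. Testing with the deviation itself and [l = t - s] gives
    [m <= ((M * (t - s)) ^+ 2 + m) / 2] for its mass [m]. *)
Lemma duhamel_bound s t : s <= t -> mass (E s t) <= (M * (t - s)) ^+ 2.
Proof.
rewrite le_eqVlt => /orP[/eqP ->|st].
  rewrite subrr mulr0 expr0n /= /mass big1 // => x _.
  by rewrite /E subrr mul0r oppr0 expi0 mul1r subrr /sqn /= expr0n addr0.
have l0 : 0 < t - s by rewrite subr_gt0.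
have [B B0 HB] := step_bound (E s t) l0.
set k := (_ * M ^+ 2 + _) / 2 in HB.
have tele n : forall (v' : X -> C) d, 0 <= d -> (forall x, cabs (v' x) = cabs (E s t x)) ->
    forall a, pairing (E a (a + n%:R * d)) v' <= n%:R * (k * d + B * d ^+ 2).
  elim: n => [|n IH] v' d d0 vv a.
    rewrite !mul0r addr0 /pairing big1 // => x _.
    by rewrite /E subrr mul0r oppr0 expi0 mul1r subrr mul0r.
  (* The adjoint of the free evolution over one step, applied to the test vector; it preserves
     moduli. *)
  pose v'' x := expi (d * w x) * v' x.
  have split_E : pairing (E a (a + n.+1%:R * d)) v' =
      pairing (E (a + n%:R * d) (a + n.+1%:R * d)) v' + pairing (E a (a + n%:R * d)) v''.
    rewrite /pairing -big_split; apply: eq_bigr => x _ /=; rewrite -raddfD /=; congr complex.Re.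
    rewrite /v'' cjM -expiN /E.
    have -> : a + n.+1%:R * d - (a + n%:R * d) = d by rewrite -natr1; ring.
    have -> : a + n.+1%:R * d - a = d + n%:R * d by rewrite -natr1; ring.
    have -> : a + n%:R * d - a = n%:R * d by ring.
    have -> : - ((d + n%:R * d) * w x) = - (d * w x) + - (n%:R * d * w x) by ring.
    by rewrite expiD; ring.
  have -> : n.+1%:R * (k * d + B * d ^+ 2) = n%:R * (k * d + B * d ^+ 2) + (k * d + B * d ^+ 2).
    by rewrite -natr1; ring.
  rewrite split_E addrC; apply: lerD.
    by apply: IH => // x; rewrite /v'' cabsM cabs_expi mul1r.
  have h := HB v' (a + n%:R * d) (a + n.+1%:R * d) vv.
  have e : a + n.+1%:R * d - (a + n%:R * d) = d by rewrite -natr1; ring.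
  by rewrite -subr_ge0 e d0 in h; apply: h.
have main : pairing (E s t) (E s t) <= k * (t - s).
  apply/ler_addgt0Pr => e e0.
  (* Enough steps for the total quadratic error [B * (t - s) ^+ 2 / n.+1] to be below [e]. *)
  have [n nB] : exists n : nat, B * (t - s) ^+ 2 / e < n.+1%:R.
    exists (Num.trunc (B * (t - s) ^+ 2 / e)).
    by have := truncnS_gt (B * (t - s) ^+ 2 / e).
  have n0 : 0 < n.+1%:R :> R by [].
  pose d := (t - s) / n.+1%:R.
  have nd : n.+1%:R * d = t - s by rewrite /d mulrC divfK ?gt_eqF.
  have := tele n.+1 (E s t) d _ (fun=> erefl) s; rewrite nd (addrC s) subrK => /(_ _)/le_trans; apply.
    by rewrite divr_ge0 // ltW.
  rewrite mulrDr mulrCA nd lerD2l.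
  have -> : n.+1%:R * (B * d ^+ 2) = B * (t - s) ^+ 2 / n.+1%:R.
    by rewrite /d; field; rewrite gt_eqF.
  by rewrite ler_pdivrMr // (mulrC e) -ler_pdivrMr // ltW.
have mE : pairing (E s t) (E s t) = mass (E s t).
  by apply: eq_bigr => x _; rewrite mul_cj.
move: main; rewrite mE /k exprMn.
set m := mass _; have -> : ((t - s) * M ^+ 2 + m / (t - s)) / 2 * (t - s) =
   ((t - s) ^+ 2 * M ^+ 2 + m) / 2 by field; rewrite gt_eqF.
lra.
Qed.

End duhamel_bound.

(** * The Fourier coefficients of the solution in rescaled time *)

Section propagation.
Variables (R : realType) (d : nat).
Local Notation C := R[i].
Local Notation V := 'rV[R]_d.
Local Notation Z := 'rV[int]_d.
Local Notation leb := (@lebesgue_measure R).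

Lemma le_opnorm (A : operator R d) (u : V -> C) : bounded_operator A -> L2 u ->
  L2norm u = 1 -> L2norm (A u) <= opnorm A.
Proof.
move=> [_ _ [M AM]] uL u1; apply: ub_le_sup; last by exists u => //=; split=> //; rewrite u1.
exists `|M| => _ [v [vL v1] <-]; apply: le_trans (AM v vL) _.
rewrite -[leRHS]mulr1; apply: (@le_trans _ _ (`|M| * L2norm v)).
  by rewrite ler_wpM2r ?ler_norm // sqrtr_ge0.
by rewrite ler_wpM2l.
Qed.

Lemma unitary_norm (A : operator R d) (u : V -> C) : unitary A -> L2 u ->
  L2 (A u) /\ L2norm (A u) = L2norm u.
Proof. by move=> [[AL _ _] Adot _] uL; split; [exact: AL|rewrite /L2norm Adot]. Qed.

Variables (H : V -> R) (h : R) (Vh S : R -> operator R d) (M : R) (u : V -> C).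
Hypothesis h_gt0 : 0 < h.
Hypothesis M0 : 0 <= M.
Hypothesis VhB : forall t, bounded_operator (Vh t).
Hypothesis VhM : {ae leb, forall t, opnorm (Vh t) <= M}.
Hypothesis SP : propagator H h Vh S.
Hypothesis uL : L2 u.
Hypothesis u1 : L2norm u = 1.

Variables (X : finType) (zz : X -> Z).
Hypothesis zinj : injective zz.

(** The coefficients at time [t / h]. In this time variable the free phases are [phase_at] and the
    potential acts with a strength independent of [h]. *)
Definition wave (t : R) (x : X) : C := fourier (S (t / h) u) (zz x).

Definition phase_at (x : X) : R := H (h *: toZ R (zz x)) / h ^+ 2.

Let SL t : L2 (S t u) /\ L2norm (S t u) = 1.
Proof. by rewrite -u1; apply: unitary_norm => //; case: SP. Qed.

Lemma wave_mass t : mass (wave t) <= 1.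
Proof.
have [sL s1] := SL (t / h); have := bessel zinj sL.
by rewrite s1 expr1n.
Qed.

Let psi t x : C := fourier (S t u) (zz x).
Let F t x : C := h%:C * fourier (Vh t (S t u)) (zz x).
Let w x := H (h *: toZ R (zz x)) / h.

Let psi1 r x : cabs (psi r x) <= 1.
Proof.
rewrite -(@ler_pXn2r _ 2) ?nnegrE ?cabs_ge0 // expr1n -sqn_cabs.
have [sL s1] := SL r; have := bessel zinj sL; rewrite s1 expr1n; apply: le_trans.
by rewrite (bigD1 x) //= lerDl sumr_ge0 // => y _; exact: sqn_ge0.
Qed.

Let FM : {ae leb, forall r, mass (F r) <= (h * M) ^+ 2}.
Proof.
apply: ae_imply VhM => r Vr; have [sL s1] := SL r.
have VL : L2 (Vh r (S r u)) by case: (VhB r) => + _ _; apply.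
have -> : mass (F r) = h ^+ 2 * \sum_x sqn (fourier (Vh r (S r u)) (zz x)).
  rewrite /mass mulr_sumr; apply: eq_bigr => x _.
  by rewrite /F sqnM /sqn /= expr0n addr0.
rewrite exprMn ler_wpM2l ?sqr_ge0 //; apply: le_trans (bessel zinj VL) _.
rewrite ler_pXn2r ?nnegrE ?sqrtr_ge0 //; apply: le_trans Vr.
exact: le_opnorm.
Qed.

Let psi_eq x s t : s <= t ->
  let rhs r := (w x)%:C * psi r x + F r x in
  cintegrable leb `[s, t] rhs /\
  'i%C * (psi t x - psi s x) = cintegral leb `[s, t] rhs.
Proof.
move=> st /=; have [_ _ _ /(_ u uL (zz x) s t st) [ri re]] := SP.
have hC : h%:C != 0 :> C by rewrite -(rmorph0 (real_complex R)) (inj_eq (@complexI R)) gt_eqF.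
have -> : (fun r => (w x)%:C * psi r x + F r x) = (fun r => h^-1%:C *
   ((H (h *: toZ R (zz x)))%:C * fourier (S r u) (zz x) + (h ^+ 2)%:C * fourier (Vh r (S r u)) (zz x))).
  apply/funext => r; rewrite /w /F /psi mulrDr !mulrA -!rmorphM /=.
  by congr (_%:C * _ + _%:C * _); field; rewrite gt_eqF.
split; first exact: cintegrableZ.
rewrite cintegralZ // -re /psi fmorphV /=.
by field.
Qed.

(** In the time of the propagator the forcing has size [h * M], over an interval of length
    [(t - s) / h]: the powers of [h] cancel. *)
Lemma wave_lipschitz s t : s <= t ->
  mass (fun x => wave t x - expi (- ((t - s) * phase_at x)) * wave s x) <= (M * (t - s)) ^+ 2.
Proof.
move=> st; have hM0 : 0 <= h * M by rewrite mulr_ge0 // ltW.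
have sth : s / h <= t / h by rewrite ler_pM2r // invr_gt0.
have := duhamel_bound hM0 psi_eq psi1 FM sth.
have -> : h * M * (t / h - s / h) = M * (t - s) by field; rewrite gt_eqF.
have pE x : (t / h - s / h) * w x = (t - s) * phase_at x.
  by rewrite /w /phase_at; field; rewrite gt_eqF.
by rewrite /mass; under eq_bigr do rewrite pE.
Qed.

Lemma wave_continuous x :
  continuous (fun t => complex.Re (wave t x)) /\ continuous (fun t => complex.Im (wave t x)).
Proof.
have hM0 : 0 <= h * M by rewrite mulr_ge0 // ltW.
have [c1 c2] := duhamel_continuous hM0 psi_eq psi1 FM x.
have ch : continuous (fun t : R => t / h).
  by move=> t; apply: cvgM; [exact: cvg_id|exact: cvg_cst].
split=> t.
- exact: (@continuous_comp _ _ _ (fun t : R => t / h) (fun r => complex.Re (psi r x)) t (ch t) (c1 _)).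
- exact: (@continuous_comp _ _ _ (fun t : R => t / h) (fun r => complex.Im (psi r x)) t (ch t) (c2 _)).
Qed.

End propagation.

(** * Accumulation points through ultrafilters *)

Section ultrafilter_tests.
Variables (R : realType) (T : Type) (P : T -> Prop) (D : nat -> T -> R).

(** The sets of large indices at which finitely many tests are small are nonempty by hypothesis, and
    two of them contain a third, obtained by concatenating the tests. An ultrafilter that contains
    them all makes every test small. *)
Lemma accumulation_ultrafilter :
  (forall m (t : 'I_m -> T), (forall i, P (t i)) ->
    forall e : R, 0 < e -> forall N, exists2 n, (N <= n)%N & forall i, D n (t i) < e) ->
  exists U : set_system nat, [/\ UltraFilter U,
    forall t, P t -> forall e, 0 < e -> U [set n | D n t < e] &
    forall N, U [set n | (N <= n)%N]].
Proof.
move=> acc.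
pose I := {m : nat & 'I_m -> T}.
pose dom := [set q : I * R * nat | (forall i, P (projT2 q.1.1 i)) /\ 0 < q.1.2].
pose base (q : I * R * nat) := [set n | (q.2 <= n)%N /\ forall i, D n (projT2 q.1.1 i) < q.1.2].
pose F := filter_from dom base.
have FF : ProperFilter F.
  apply: filter_from_proper; last first.
    move=> [[[m t] e] N] [/= Pt e0]; have [n Nn nD] := acc m t Pt e e0 N.
    by exists n; split.
  apply: filter_from_filter.
    have t0 : 'I_0 -> T by case.
    exists (existT (fun m => 'I_m -> T) 0%N t0, 1, 0%N); split => //= i; by case: i.
  move=> [[[m1 t1] e1] N1] [[[m2 t2] e2] N2] [/= P1 e10] [/= P2 e20].
  exists (existT (fun m => 'I_m -> T) (m1 + m2)%N (fun i => match fintype.split i with inl j => t1 j | inr j => t2 j end),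
    Num.min e1 e2, maxn N1 N2).
    split => /=; first by move=> i; case: (fintype.split i).
    by rewrite lt_min e10.
  move=> n [/=]; rewrite geq_max => /andP[n1 n2] nD; split; split => //= i.
    have := nD (lshift m2 i); rewrite (unsplitK (inl i)) lt_min => /andP[]; done.
  have := nD (rshift m1 i); rewrite (unsplitK (inr i)) lt_min => /andP[]; done.
have [U [uU FU]] := ultraFilterLemma FF.
exists U; split => //.
- move=> t Pt e e0; apply: FU.
  by exists (existT (fun m => 'I_m -> T) 1%N (fun=> t), e, 0%N) => //= n [_ /(_ ord0)].
- move=> N; apply: FU.
  have t0 : 'I_0 -> T by case.
  exists (existT (fun m => 'I_m -> T) 0%N t0, 1, N) => /=; last by move=> n [].
  by split => //= i; case: i.
Qed.

(** If no [N0] works, the ultrafilter contains the complementary events, and [f] can be raised by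
    [e] along it as often as desired, beyond [B]. *)
Lemma ultra_stabilize (U : set_system nat) (f : nat -> nat -> R) (B : R) :
  UltraFilter U -> (forall N n, 0 <= f N n <= B) ->
  forall e, 0 < e -> exists N0, forall N, (N0 <= N)%N -> U [set n | f N n <= f N0 n + e].
Proof.
move=> uU fB e e0; apply: contrapT => no.
have step N0 : exists2 N, (N0 <= N)%N & U [set n | f N0 n + e < f N n].
  apply: contrapT => noN; apply: no; exists N0 => N N0N.
  have [//|UC] := in_ultra_setVsetC [set n | f N n <= f N0 n + e] uU.
  case: noN; exists N => //; apply: filterS UC => n /= /negP; by rewrite -ltNge.
have climb k : exists N, U [set n | k%:R * e <= f N n].
  elim: k => [|k [N UN]].
    by exists 0%N; apply: filterS filterT => n _ /=; rewrite mul0r; case/andP: (fB 0%N n).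
  have [N' _ UN'] := step N; exists N'; apply: filterS2 UN UN' => n /= h1 h2.
  by rewrite -natr1 mulrDl mul1r ltW // (le_lt_trans _ h2) // lerD2r.
pose k := (Num.trunc (B / e)).+1.
have [N UN] := climb k; have [n /= nN] := filter_ex UN.
have /andP[_ fB'] := fB N n.
have : B < k%:R * e by rewrite -ltr_pdivrMr // truncnS_gt.
by rewrite ltNge (le_trans nN).
Qed.

End ultrafilter_tests.

Section cube.
Variables (R : realType) (d : nat).
Local Notation Z := 'rV[int]_d.

Definition cube_pt (m : nat) (x : 'rV['I_(m + m).+1]_d) : Z :=
  \row_j ((x ord0 j : nat)%:Z - m%:Z).

Lemma cube_pt_inj m : injective (@cube_pt m).
Proof.
move=> x y /rowP xy; apply/rowP => j; have := xy j; rewrite !mxE => h.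
by apply: val_inj => /=; rewrite -[0]/(ord0 : 'I_1); move: h; lia.
Qed.

Lemma cube_ptP m (k : Z) : `|toZ R k| <= m%:R -> k \in codom (@cube_pt m).
Proof.
move=> km; apply/codomP; exists (\row_j inord (absz (k ord0 j + m%:Z))).
have kb j : (`|k ord0 j| <= m)%N.
  have := le_trans (coord_le_norm (toZ R k) j) km.
  by rewrite mxE -intr_norm pmulrn ler_int -abszE lez_nat.
have cube (z : int) : (`|z| <= m)%N ->
    (absz (z + m%:Z)%R < (m + m).+1)%N /\ z = (absz (z + m%:Z)%R)%:Z - m%:Z by lia.
by apply/rowP => j; have [? ?] := cube _ (kb j); rewrite !mxE inordK.
Qed.

End cube.

(** * The Weyl form as a finite matrix *)

Section wigner_formula.
Variables (R : realType) (d : nat).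
Local Notation C := R[i].
Local Notation V := 'rV[R]_d.
Local Notation Z := 'rV[int]_d.

Definition symbol (s : seq (Z * (V -> C))) (p : V * V) : C := tfun (sval s p.2) p.1.

Variables (s : seq (Z * (V -> C))) (xi0 : V) (r : R).
Hypothesis s_supp : forall m xi, r <= `|xi - xi0| -> tcoef (sval s xi) m = 0.

Variables (X : finType) (zz : X -> Z) (h : R).
Hypothesis zinj : injective zz.
Hypothesis h_ge0 : 0 <= h.
Hypothesis cover : forall k : Z, `|h *: toZ R k - xi0| < 2 * r -> k \in codom zz.
Hypothesis h_small : forall m, m \in freqs s -> h * `|toZ R m| <= 2 * r.

Lemma toZD (k j : Z) : toZ R (k + j) = toZ R k + toZ R j.
Proof. by rewrite /toZ map_mxD. Qed.

Lemma toZN (k : Z) : toZ R (- k) = - toZ R k.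
Proof. by rewrite /toZ map_mxN. Qed.

(** A nonzero Weyl entry has its midpoint [h (k + j) / 2] in the ball of radius [r], while
    [h (j - k) / 2] has size at most [r]; so both ends lie in the ball of radius [2 * r], and
    finitely many modes suffice. *)
Lemma tcoef_supp (k j : Z) : tcoef (sval s ((h / 2) *: toZ R (k + j))) (j - k) != 0 ->
  [/\ j - k \in freqs s, `|h *: toZ R k - xi0| < 2 * r & `|h *: toZ R j - xi0| < 2 * r].
Proof.
move=> t0.
have Fm : j - k \in freqs s by apply: contraNT t0 => /tcoef_notin ->.
have small : `|(h / 2) *: toZ R (k + j) - xi0| < r.
  by rewrite ltNge; apply: contra t0 => /(s_supp (j - k)) ->.
have hm : `|(h / 2) *: toZ R (j - k)| <= r.
  rewrite normrZ ger0_norm ?divr_ge0 //; have := h_small Fm; lra.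
split => //.
- have -> : h *: toZ R k - xi0 = ((h / 2) *: toZ R (k + j) - xi0) - (h / 2) *: toZ R (j - k).
    by apply/rowP => i; rewrite !mxE rmorphD rmorphB /=; field.
  by apply: le_lt_trans (ler_normB _ _) _; rewrite mulr_natl ltr_leD.
- have -> : h *: toZ R j - xi0 = ((h / 2) *: toZ R (k + j) - xi0) + (h / 2) *: toZ R (j - k).
    by apply/rowP => i; rewrite !mxE rmorphD rmorphB /=; field.
  by apply: le_lt_trans (ler_normD _ _) _; rewrite mulr_natl ltr_leD.
Qed.

Lemma weyl_form_finite (u : V -> C) : weyl_form h (symbol s) u =
  \sum_x \sum_y weyl_mx s zz h x y * fourier u (zz x) * cj (fourier u (zz y)).
Proof.
rewrite /weyl_form -/(fnorm R d).
pose g (p : X * X) := (zz p.1, zz p.2).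
have ginj : injective g by move=> [x y] [x' y'] [/zinj -> /zinj ->].
have fE (k j : Z) : fourier (fun x => symbol s (x, (h / 2) *: toZ R (k + j))) (j - k) =
    (fnorm R d * (2 * pi) ^+ d)%:C * tcoef (sval s ((h / 2) *: toZ R (k + j))) (j - k).
  by rewrite -fourier_tfun.
rewrite (csum_finite_support ginj) //; last first.
  move=> [k j]; rewrite [_.1]/= [_.2]/= fE => ne.
  have /tcoef_supp[_ hk hj] : tcoef (sval s ((h / 2) *: toZ R (k + j))) (j - k) != 0.
    by apply: contraNneq ne => ->; rewrite !mulr0.
  have /codomP[x ->] := cover hk; have /codomP[y ->] := cover hj.
  by apply/codomP; exists (x, y).
rewrite pair_bigA mulr_sumr; apply: eq_bigr => -[x y] _.
rewrite [_.1]/= [_.2]/= fE /weyl_mx.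
change ((fourier u (zz y))^*) with (cj (fourier u (zz y))).
set T := tcoef _ _; set a := fourier _ _; set b := cj _.
have fC : (fnorm R d)%:C * (fnorm R d * (2 * pi) ^+ d)%:C = 1 :> C.
  by rewrite -rmorphM /= mulrA fnormK.
transitivity ((fnorm R d)%:C * (fnorm R d * (2 * pi) ^+ d)%:C * (T * a * b)); last by rewrite fC mul1r.
by ring.
Qed.

Lemma Re_weyl_form (u : V -> C) : complex.Re (weyl_form h (symbol s) u) =
  bform (weyl_mx s zz h) (fourier u \o zz) (fourier u \o zz).
Proof.
by rewrite weyl_form_finite Re_sum; apply: eq_bigr => x _; rewrite Re_sum.
Qed.

End wigner_formula.

Section mean_symbol.
Variables (R : realType) (d : nat).
Local Notation C := R[i].
Local Notation V := 'rV[R]_d.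
Local Notation Z := 'rV[int]_d.

Definition mean_symbol (s : seq (Z * (V -> C))) : seq (Z * (V -> C)) :=
  [:: (0, fun xi => tcoef (sval s xi) 0)].

Lemma tcoef_mean s xi m : tcoef (sval (mean_symbol s) xi) m =
  if m == 0 then tcoef (sval s xi) 0 else 0.
Proof. by rewrite /tcoef /= big_cons big_nil /= eq_sym; case: ifP => _; rewrite ?addr0. Qed.

Lemma symbol_mean s p : symbol (mean_symbol s) p = tcoef (sval s p.2) 0.
Proof.
rewrite /symbol /tfun /= big_cons big_nil /= addr0 /dotZ big1 ?expi0 ?mulr1 // => i _.
by rewrite !mxE mul0r.
Qed.

Lemma bform_mean s (X : finType) (zz : X -> Z) h (v : X -> C) : injective zz ->
  bform (weyl_mx (mean_symbol s) zz h) v v = \sum_x sqn (v x) * mean_at s zz h x.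
Proof.
move=> zinj; apply: eq_bigr => x _; rewrite (bigD1 x) //= big1 ?addr0; last first.
  move=> y yx; rewrite /weyl_mx tcoef_mean subr_eq0 (inj_eq zinj) (negbTE yx).
  by rewrite !mul0r.
rewrite /weyl_mx tcoef_mean subrr eqxx /mean_at -mulrA mul_cj Re_M /= mulr0 subr0 mulrC.
congr (_ * complex.Re (tcoef (sval s _) 0)).
by apply/rowP => j; rewrite !mxE rmorphD /=; field.
Qed.

End mean_symbol.

(** * Stabilization of the ranks *)

Section rank_stabilization.
Variables (R : realType) (d : nat) (X : nat -> finType).
Variables (zz : forall n : nat, X n -> 'rV[int]_d) (K : forall n, pred (X n)).
Variables (A p : forall n : nat, X n -> R).
Hypothesis p_ge0 : forall n (x : X n), 0 <= p x.
Hypothesis p_le1 : forall n, \sum_(x : X n) p x <= 1.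

(** The average rank is at most [d], hence stabilizes along the ultrafilter. Ranks are integers and
    nondecreasing in the threshold, so the growth of the average dominates the mass of the points
    where the rank still changes. *)
Lemma rank_stabilize (U : set_system nat) : UltraFilter U -> forall e, 0 < e ->
  exists N0, forall N, (N0 <= N)%N -> U [set n |
    \sum_(x | near_rank (@zz n) (@K n) (@A n) N0 x != near_rank (@zz n) (@K n) (@A n) N x) p x <= e].
Proof.
move=> uU e e0.
pose rk N n (x : X n) := near_rank (@zz n) (@K n) (@A n) N x.
pose f N n := \sum_(x : X n) p x * (rk N n x)%:R.
have fB N n : 0 <= f N n <= d%:R.
  apply/andP; split; first by apply: sumr_ge0 => x _; rewrite mulr_ge0.
  apply: (@le_trans _ _ (\sum_(x : X n) p x * d%:R)).
    by apply: ler_sum => x _; rewrite ler_wpM2l // ler_nat near_rank_le_dim.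
  by rewrite -mulr_suml -[leRHS]mul1r ler_wpM2r.
have [N0 N0P] := ultra_stabilize uU fB e0; exists N0 => N N0N.
apply: filterS (N0P N N0N) => n /= ; rewrite -lerBlDl; apply: le_trans.
rewrite /f -sumrB big_mkcond /=; apply: ler_sum => x _; rewrite -mulrBr.
have le : (rk N0 n x <= rk N n x)%N by apply: near_rank_homo.
rewrite -/(rk N0 n x) -/(rk N n x) -natrB //.
case: ifPn => [ne|_]; last by rewrite mulr_ge0.
by rewrite -[leLHS]mulr1 ler_wpM2l // ler1n subn_gt0 ltn_neqAle ne.
Qed.

End rank_stabilization.

Section form_continuity.
Variables (R : realType) (X : finType).
Local Notation C := R[i].

Lemma continuous_sumR (I : Type) (s : seq I) (P : pred I) (f : I -> R -> R) :
  (forall i, continuous (f i)) -> continuous (fun t => \sum_(i <- s | P i) f i t).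
Proof.
move=> fc; have addc : continuous (fun p : R * R => p.1 + p.2) by exact: add_continuous.
by apply: (continuous_big addc) => i _; exact: fc.
Qed.

Lemma continuous_bform (b : X -> X -> C) (v : R -> X -> C) :
  (forall x, continuous (fun t => complex.Re (v t x)) /\ continuous (fun t => complex.Im (v t x))) ->
  continuous (fun t => bform b (v t) (v t)).
Proof.
move=> vc; apply: continuous_sumR => x; apply: continuous_sumR => y.
have [x1 x2] := vc x; have [y1 y2] := vc y.
have -> : (fun t => complex.Re (b x y * v t x * cj (v t y))) = (fun t =>
  (complex.Re (b x y) * complex.Re (v t x) - complex.Im (b x y) * complex.Im (v t x)) * complex.Re (v t y)
  + (complex.Re (b x y) * complex.Im (v t x) + complex.Im (b x y) * complex.Re (v t x)) * complex.Im (v t y)).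
  by apply/funext => t; case: (b x y) (v t x) (v t y) => [? ?] [? ?] [? ?]; rewrite /cj /=; ring.
move=> t; apply: cvgD; apply: cvgM; try exact: y1; try exact: y2.
- by apply: cvgB; apply: cvgM; try exact: cvg_cst; [exact: x1|exact: x2].
- by apply: cvgD; apply: cvgM; try exact: cvg_cst; [exact: x2|exact: x1].
Qed.

Lemma continuous_expiM (z : C) (w s : R) :
  continuous (fun t => complex.Re (expi (- ((t - s) * w)) * z)) /\
  continuous (fun t => complex.Im (expi (- ((t - s) * w)) * z)).
Proof.
have a : continuous (fun t : R => - ((t - s) * w)).
  by move=> t; apply: cvgN; apply: cvgM; [apply: cvgB; [exact: cvg_id|exact: cvg_cst]|exact: cvg_cst].
have c : continuous (fun t : R => cos (- ((t - s) * w))).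
  by move=> t; apply: (continuous_comp (a t)); exact: continuous_cos.
have si : continuous (fun t : R => sin (- ((t - s) * w))).
  by move=> t; apply: (continuous_comp (a t)); exact: continuous_sin.
split=> t.
- under eq_fun do rewrite Re_M /=.
  by apply: cvgB; apply: cvgM; try exact: cvg_cst; [exact: c|exact: si].
- under eq_fun do rewrite Im_M /=.
  by apply: cvgD; apply: cvgM; try exact: cvg_cst; [exact: c|exact: si].
Qed.

End form_continuity.

Section test_symbols.
Variables (R : realType) (d : nat).
Local Notation C := R[i].
Local Notation V := 'rV[R]_d.
Local Notation Z := 'rV[int]_d.

(** The mean over the torus has to be an admissible test as well, since it appears on the right of
    the estimate. *)
Definition test_symbol (xi0 : V) (r : R) (s : seq (Z * (V -> C))) : Prop :=
  [/\ Cc_infty (symbol s) /\ Cc_infty (symbol (mean_symbol s)),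
      exists2 A, 0 <= A & forall m xi, cabs (tcoef (sval s xi) m) <= A,
      exists2 L, 0 <= L & forall m xi eta,
        cabs (tcoef (sval s xi) m - tcoef (sval s eta) m) <= L * `|xi - eta|,
      forall xi x, 0 <= tfun (sval s xi) x /\ tfun (sval s xi) x <= 1 &
      forall m xi, r <= `|xi - xi0| -> tcoef (sval s xi) m = 0].

End test_symbols.

Lemma Rintegral_segment_cst (R : realType) (a b c : R) : a <= b ->
  \int[lebesgue_measure]_(t in `[a, b]) c = c * (b - a).
Proof.
move=> ab; rewrite Rintegral_cst //= lebesgue_measure_itv /= lte_fin.
by case: ltP => //= ba; congr (_ * _); apply/eqP; rewrite eq_sym subr_eq0 eq_le ab ba.
Qed.

(** * The estimate for one value of [h] on a short time interval *)

Section slice_estimate.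
Variables (R : realType) (d : nat).
Local Notation C := R[i].
Local Notation V := 'rV[R]_d.
Local Notation Z := 'rV[int]_d.
Local Notation leb := (@lebesgue_measure R).

Variables (H : V -> R) (h : R) (Vh S : R -> operator R d) (M : R) (u : V -> C).
Hypothesis h_gt0 : 0 < h.
Hypothesis M0 : 0 <= M.
Hypothesis VhB : forall t, bounded_operator (Vh t).
Hypothesis VhM : {ae leb, forall t, opnorm (Vh t) <= M}.
Hypothesis SP : propagator H h Vh S.
Hypothesis uL : L2 u.
Hypothesis u1 : L2norm u = 1.

Variables (xi0 : V) (r : R) (X : finType) (zz : X -> Z).
Hypothesis r_gt0 : 0 < r.
Hypothesis zinj : injective zz.
Hypothesis cover : forall k : Z, `|h *: toZ R k - xi0| < 2 * r -> k \in codom zz.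

Let W := wave h S u zz.
Let ph := phase_at H h zz.
Let K : pred X := fun x => `|h *: toZ R (zz x) - xi0| < 2 * r.

Lemma wave_form_continuous b : continuous (fun t => bform b (W t) (W t)).
Proof.
apply: continuous_bform => x.
exact: (wave_continuous h_gt0 M0 VhB VhM SP uL u1 zinj).
Qed.

Let W_mass t : mass (W t) <= 1.
Proof. by have := wave_mass (zz := zz) SP uL u1 zinj (h := h) t. Qed.

Let free a t x : C := expi (- ((t - a) * ph x)) * W a x.

Let free_mass a t : mass (free a t) <= 1.
Proof.
apply: le_trans (W_mass a).
by apply: ler_sum => x _; rewrite sqnM sqn_expi mul1r.
Qed.

Let free_continuous b a : continuous (fun t => bform b (free a t) (free a t)).
Proof. by apply: continuous_bform => x; exact: continuous_expiM. Qed.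

Let free_close a t : a <= t -> mass (fun x => W t x - free a t x) <= (M * (t - a)) ^+ 2.
Proof. exact: wave_lipschitz. Qed.

Let sqnN (z : C) : sqn (- z) = sqn z.
Proof. by rewrite -mulN1r sqnM /sqn /=; ring. Qed.

Let massC (v w : X -> C) : mass (fun x => v x - w x) = mass (fun x => w x - v x).
Proof. by apply: eq_bigr => x _; rewrite -sqnN opprB. Qed.

(** The free evolution preserves the modulus of every coefficient, so mass enters a set of modes
    only through the deviation from it. *)
Lemma wave_mass_drift (P : pred X) s0 a : s0 <= a ->
  \sum_(x | P x) sqn (W a x) <= 2 * \sum_(x | P x) sqn (W s0 x) + 2 * (M * (a - s0)) ^+ 2.
Proof.
move=> sa; apply: (@le_trans _ _
    (\sum_(x | P x) (2 * sqn (free s0 a x) + 2 * sqn (W a x - free s0 a x)))).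
  apply: ler_sum => x _; rewrite {1}(_ : W a x = free s0 a x + (W a x - free s0 a x)); last by rewrite addrC subrK.
  exact: sqnD_le.
rewrite big_split /= -!mulr_sumr lerD //.
  by rewrite ler_wpM2l //; apply: ler_sum => x _; rewrite sqnM sqn_expi mul1r.
rewrite ler_wpM2l //; apply: le_trans (free_close sa).
by rewrite [leRHS]/mass [leRHS](bigID P) /= lerDl sumr_ge0 // => x _; exact: sqn_ge0.
Qed.

Variables (s : seq (Z * (V -> C))) (A L : R).
Hypothesis A0 : 0 <= A.
Hypothesis L0 : 0 <= L.
Hypothesis sA : forall m xi, cabs (tcoef (sval s xi) m) <= A.
Hypothesis sL : forall m xi eta,
  cabs (tcoef (sval s xi) m - tcoef (sval s eta) m) <= L * `|xi - eta|.
Hypothesis s01 : forall xi x, 0 <= tfun (sval s xi) x /\ tfun (sval s xi) x <= 1.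
Hypothesis s_supp : forall m xi, r <= `|xi - xi0| -> tcoef (sval s xi) m = 0.
Hypothesis h_small : forall m, m \in freqs s -> h * `|toZ R m| <= 2 * r.

Variables (N0 N Q : nat) (D e s0 : R).
Hypothesis N_gt0 : (0 < N)%N.
Hypothesis D0 : 0 <= D.
Hypothesis freqsN : forall m, m \in freqs s -> l1 (toZ R m) <= N%:R.
Let good x := near_rank zz K ph N0 x == near_rank zz K ph N x.
Hypothesis diamD : forall x y, connect (near_resonant zz K ph N) x y ->
  l1 (toZ R (zz y) - toZ R (zz x)) <= D.
Hypothesis goodQ : forall x, (#|[pred y | connect (near_resonant zz K ph N) x y && good y]| <= Q)%N.
Hypothesis bad_e : \sum_(x | ~~ good x) sqn (W s0 x) <= e.

Let F : R := (size (freqs s))%:R.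
Let LC := A * F * (M ^+ 2 + 1).
Let LC0 := A * (M ^+ 2 + 1).

(** A nonzero entry joins two points of [K] whose difference occurs in [freqs s], hence has length
    at most [N]; if they lie in distinct clusters, only their phases can separate them. *)
Let offcluster x y : weyl_mx s zz h x y != 0 -> ~~ connect (near_resonant zz K ph N) x y ->
  N%:R <= `|ph x - ph y|.
Proof.
move=> w0 /negP nc; have := tcoef_supp s_supp (ltW h_gt0) h_small w0 => -[Fm Kx Ky].
rewrite leNgt; apply/negP => lt; apply: nc; apply: connect1.
rewrite /near_resonant /K Kx Ky /=; apply/andP; split; last by rewrite distrC ltW.
by have := freqsN Fm; rewrite toZD toZN.
Qed.

Let Rwig t : complex.Re (wigner h (S (t / h) u) (symbol s)) = bform (weyl_mx s zz h) (W t) (W t).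
Proof. by rewrite /wigner (Re_weyl_form s_supp zinj (ltW h_gt0) cover h_small). Qed.

Let Rwig0 t : complex.Re (wigner h (S (t / h) u) (symbol (mean_symbol s))) =
  bform (weyl_mx (mean_symbol s) zz h) (W t) (W t).
Proof.
rewrite /wigner (@Re_weyl_form _ _ _ xi0 r _ _ zz) ?(ltW h_gt0) //.
- by move=> m xi rxi; rewrite tcoef_mean s_supp // if_same.
- move=> m; rewrite inE => /eqP ->.
  have -> : toZ R 0 = 0 :> V by apply/rowP => j; rewrite !mxE.
  by rewrite normr0 mulr0 mulr_ge0 ?(ltW r_gt0).
Qed.

(** The mean form is diagonal, hence constant along the free evolution; comparison with the true
    evolution turns its value at time [a] into a time integral, up to [LC0 * (b - a) ^+ 2]. *)
Let mean_drift a b : a < b -> (b - a) * \sum_x sqn (W a x) * mean_at s zz h x <=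
  \int[leb]_(t in `[a, b]) bform (weyl_mx (mean_symbol s) zz h) (W t) (W t) + LC0 * (b - a) ^+ 2.
Proof.
move=> ab; set b0 := weyl_mx _ _ _; set m := \sum_x _.
have pt t : a <= t -> t <= b -> m - LC0 * (b - a) <= bform b0 (W t) (W t).
  move=> at_ tb.
  have -> : m = bform b0 (free a t) (free a t).
    by rewrite bform_mean //; apply: eq_bigr => x _; rewrite sqnM sqn_expi mul1r.
  (* [bform_lipschitz] needs a positive time; at [t = a] the two waves coincide. *)
  have [ta|ta] := eqVneq t a.
    have -> : free a t = W a by apply/funext => x; rewrite /free ta subrr mul0r oppr0 expi0 mul1r.
    by rewrite ta lerBlDr lerDl !mulr_ge0 ?subr_ge0 ?(ltW ab) ?addr_ge0 ?sqr_ge0.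
  have ta0 : 0 < t - a by rewrite subr_gt0 lt_neqAle eq_sym ta.
  rewrite lerBlDr; apply: le_trans
    (@bform_lipschitz R X d zz zinj [:: 0] b0 A (t - a) M (free a t) (W t) A0 ta0 _ (free_mass a t) _ _) _.
  - move=> x y; rewrite /b0 /weyl_mx tcoef_mean inE.
    by case: ifP => // _; rewrite cabs0.
  - exact: W_mass.
  - by rewrite massC; exact: free_close.
  by rewrite lerD2l mulr1 mulrC ler_wpM2l ?lerB // mulr_ge0 // addr_ge0 // sqr_ge0.
have iW : leb.-integrable `[a, b] (EFin \o (fun t => bform b0 (W t) (W t))).
  by apply: continuous_integrable; exact: wave_form_continuous.
have ic : leb.-integrable `[a, b] (EFin \o (fun=> m - LC0 * (b - a))).
  by apply: continuous_integrable => t; exact: cvg_cst.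
have : \int[leb]_(t in `[a, b]) (m - LC0 * (b - a)) <= \int[leb]_(t in `[a, b]) bform b0 (W t) (W t).
  by apply: le_Rintegral => // t /=; rewrite in_itv /= => /andP[]; exact: pt.
rewrite (Rintegral_segment_cst _ (ltW ab)).
set I := \int[_]_(_ in _) _ => le; rewrite -lerBlDr; apply: le_trans le; rewrite le_eqVlt; apply/orP; left; apply/eqP; ring.
Qed.

(** The wave is replaced on the interval by the free evolution from time [a], at the cost of
    [LC * (b - a) ^+ 2], and [finite_estimate] applies to the latter. The mass of the bad points is
    known at the fixed time [s0], so that [N0] and [Q] can serve all the intervals that come later;
    [wave_mass_drift] carries the bound to time [a]. *)
Lemma slice_estimate a b : s0 <= a -> a < b ->
  \int[leb]_(t in `[a, b]) complex.Re (wigner h (S (t / h) u) (symbol s)) <=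
  2 * Q%:R * (\int[leb]_(t in `[a, b]) complex.Re (wigner h (S (t / h) u) (symbol (mean_symbol s)))) +
  (b - a) * (4 * (e + (M * (a - s0)) ^+ 2) + h * (L * D * (F + 2 * Q%:R))) +
  (LC + 2 * Q%:R * LC0) * (b - a) ^+ 2 + 4 * A * F / N%:R.
Proof.
move=> sa ab; rewrite [X in X <= _](congr1 (Rintegral leb `[a, b]) (funext Rwig)).
rewrite [X in _ <= _ * X + _ + _ + _](congr1 (Rintegral leb `[a, b]) (funext Rwig0)).
set b1 := weyl_mx _ _ _.
(* The wave pulled back freely to time 0, which is the origin of the evolution in
   [finite_estimate]. *)
pose z x := expi (a * ph x) * W a x.
have zfree t : (fun x => expi (- (t * ph x)) * z x) = free a t.
  by apply/funext => x; rewrite /z mulrA -expiD /free mulrBl opprB addrC.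
have pt t : a <= t -> t <= b -> bform b1 (W t) (W t) <= bform b1 (free a t) (free a t) + LC * (b - a).
  move=> at_ tb; have LCp : 0 <= LC by rewrite !mulr_ge0 ?addr_ge0 ?sqr_ge0 //.
  have [ta|ta] := eqVneq t a.
    have -> : free a t = W a by apply/funext => x; rewrite /free ta subrr mul0r oppr0 expi0 mul1r.
    by rewrite ta lerDl mulr_ge0 // subr_ge0 ltW.
  have ta0 : 0 < t - a by rewrite subr_gt0 lt_neqAle eq_sym ta.
  apply: le_trans
    (@bform_lipschitz R X d zz zinj (freqs s) b1 A (t - a) M (W t) (free a t) A0 ta0 _ _ (free_mass a t) (free_close at_)) _.
  - exact: weyl_mx_le.
  - exact: W_mass.
  by rewrite lerD2l mulrC ler_wpM2l // lerB.
have iW : leb.-integrable `[a, b] (EFin \o (fun t => bform b1 (W t) (W t))).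
  by apply: continuous_integrable; exact: wave_form_continuous.
have ifr : leb.-integrable `[a, b] (EFin \o (fun t => bform b1 (free a t) (free a t))).
  by apply: continuous_integrable; exact: free_continuous.
have ic : leb.-integrable `[a, b] (EFin \o (fun=> LC * (b - a))).
  by apply: continuous_integrable => t; exact: cvg_cst.
apply: le_trans (_ : _ <= \int[leb]_(t in `[a, b]) (bform b1 (free a t) (free a t) + LC * (b - a))) _.
  apply: le_Rintegral => //; first exact: integrableDR.
  by move=> t /=; rewrite in_itv /= => /andP[]; exact: pt.
rewrite RintegralD // (Rintegral_segment_cst _ (ltW ab)).
have s0' xi x : 0 <= tfun (sval s xi) x by case: (s01 xi x).
have s1' xi x : tfun (sval s xi) x <= 1 by case: (s01 xi x).
have zm : mass z <= 1.
  by have := free_mass a 0; rewrite -zfree /mass; under eq_bigr do rewrite sqnM sqn_expi mul1r.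
have := @finite_estimate R d s A L A0 L0 sA sL s0' s1' X zz h zinj (ltW h_gt0)
  (near_resonant zz K ph N) D good Q N ph (near_resonant_sym _ _ _ _) D0 diamD goodQ N_gt0
  offcluster z a b (ltW ab) zm.
have -> : (fun t => bform (weyl_mx s zz h) (fun x => expi (- (t * ph x)) * z x)
    (fun x => expi (- (t * ph x)) * z x)) = (fun t => bform b1 (free a t) (free a t)).
  by apply/funext => t; rewrite zfree.
move=> fe; have md := mean_drift ab.
have sqz x : sqn (z x) = sqn (W a x) by rewrite sqnM sqn_expi mul1r.
move: fe; under eq_bigr do rewrite sqz; under [X in _ + 2 * X + _]eq_bigr do rewrite sqz.
move=> fe.
have bad : \sum_(x | ~~ good x) sqn (W a x) <= 2 * e + 2 * (M * (a - s0)) ^+ 2.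
  by apply: le_trans (wave_mass_drift _ sa) _; rewrite lerD2r ler_wpM2l.
have ba : 0 < b - a by rewrite subr_gt0.
have bad' := ler_wpM2l (ltW ba) bad.
have Q0 : 0 <= 2 * Q%:R :> R by rewrite mulr_ge0.
have md' := ler_wpM2l Q0 md.
move: fe md' bad'.
set I1 := \int[_]_(_ in _) _; set I0 := \int[_]_(_ in _) _.
set m := \sum_x _; set bd := \sum_(_ | _) _; set n4 := 4 * A * F / _.
set hh := h * _.
move=> fe md' bad'.
rewrite !mulrDr in fe bad'.
nra.
Qed.

End slice_estimate.

(** * The limit inequality near a frequency *)

Section local_estimate.
Variables (R : realType) (d : nat).
Local Notation C := R[i].
Local Notation V := 'rV[R]_d.
Local Notation Z := 'rV[int]_d.
Local Notation leb := (@lebesgue_measure R).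

(** A property of a ball rather than of one frequency, so that balls with rational centres can be
    used in the end. *)
Definition monotone_gradient (H : V -> R) (xi0 : V) (r : R) : Prop :=
  exists Gr : V -> V, exists L : R, exists c : R, [/\ 0 <= L, 0 < c &
    forall xi eta, `|xi - xi0| < r -> `|eta - xi0| < r ->
    [/\ `|H eta - H xi - dot (Gr xi) (eta - xi)| <= L * l1 (eta - xi) ^+ 2,
        forall v, `|dot (Gr xi - Gr eta) v| <= L * l1 (xi - eta) * l1 v &
        c * l1 (xi - eta) ^+ 2 <= `|dot (Gr xi - Gr eta) (xi - eta)|]].

Lemma l1Z (a : R) (v : V) : l1 (a *: v) = `|a| * l1 v.
Proof. by rewrite /l1 mulr_sumr; apply: eq_bigr => i _; rewrite !mxE normrM. Qed.

Lemma dotZl (a : R) (v w : V) : dot (a *: v) w = a * dot v w.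
Proof. by rewrite /dot mulr_sumr; apply: eq_bigr => i _; rewrite !mxE mulrA. Qed.

Lemma dotZr (a : R) (v w : V) : dot v (a *: w) = a * dot v w.
Proof. by rewrite dotC dotZl [dot w v]dotC. Qed.

(** [L] and [c] do not depend on [h]: the square of the mesh [h] of the lattice compensates the
    division of [H] by [h ^+ 2]. This is the effect of the time scale [t / h]. *)
Lemma monotone_phase_at (H : V -> R) (xi0 : V) (r : R) : monotone_gradient H xi0 r ->
  exists L : R, exists c : R, [/\ 0 <= L, 0 < c & forall (h : R) (X : finType) (zz : X -> Z), 0 < h ->
    exists G, monotone_phase zz (fun x => `|h *: toZ R (zz x) - xi0| < r) (phase_at H h zz) G L c].
Proof.
move=> [Gr [L [c [L0 c0 mono]]]]; exists L, c; split => // h X zz h0.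
have hV : h != 0 by rewrite gt_eqF.
have ha : `|h| = h by rewrite gtr0_norm.
exists (fun x => h^-1 *: Gr (h *: toZ R (zz x))); rewrite /phase_at; split.
- move=> x y Kx Ky; have [+ _ _] := mono _ _ Kx Ky.
  rewrite -scalerBr l1Z ha dotZr dotZl -/(toZ R (zz y)) -/(toZ R (zz x)).
  set n := l1 _; set g := dot _ _ => le.
  have -> : H (h *: toZ R (zz y)) / h ^+ 2 - H (h *: toZ R (zz x)) / h ^+ 2 - h^-1 * g =
     (H (h *: toZ R (zz y)) - H (h *: toZ R (zz x)) - h * g) / h ^+ 2 by field.
  rewrite normrM [X in _ * X]ger0_norm ?invr_ge0 ?sqr_ge0 // ler_pdivrMr ?exprn_gt0 //.
  by apply: le_trans le _; rewrite exprMn; rewrite le_eqVlt; apply/orP; left; apply/eqP; ring.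
- move=> x y m Kx Ky; have [_ + _] := mono _ _ Kx Ky => /(_ m).
  rewrite -!scalerBr l1Z ha dotZl -/(toZ R (zz y)) -/(toZ R (zz x)) normrM => le.
  rewrite normfV ha ler_pdivrMl //; apply: le_trans le _.
  by rewrite le_eqVlt; apply/orP; left; apply/eqP; ring.
- move=> x y Kx Ky; have [_ _] := mono _ _ Kx Ky.
  rewrite -!scalerBr l1Z ha dotZr !dotZl -/(toZ R (zz y)) -/(toZ R (zz x)).
  set n := l1 _; set g := dot _ _ => le.
  rewrite normrM normfV ha ler_pdivlMl //.
  have : h * (h * (c * n ^+ 2)) <= h * `|g|.
    by move: le; rewrite normrM ha exprMn; apply: le_trans; rewrite le_eqVlt; apply/orP; left; apply/eqP; ring.
  by rewrite ler_pM2l.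
Qed.

(** Within the budget [8 * x], one [x] is for the two weak approximations, three are for [T] and one
    is for [N4]. *)
Lemma estimate_transfer (W I W0 I0 q k T B N4 x E : R) :
  `|W - I| < k -> `|W0 - I0| < k -> W <= q * W0 + T + B + N4 -> 0 <= q ->
  k * (1 + q) = x -> 0 < x -> T <= 3 * x -> N4 <= x -> E = 8 * x -> I <= q * I0 + E + B.
Proof.
rewrite !ltr_norml => /andP[n4 _] /andP[_ n5] sl q0 kE x0 Tx Nx ->.
have : q * W0 <= q * (I0 + k) by rewrite ler_wpM2l //; lra.
rewrite mulrDr mulr1 in kE; rewrite mulrDr => qW.
lra.
Qed.

Lemma estimate_budget (e x y : R) : x <= e / 32 -> y <= e / 8 ->
  4 * (e / 32 + x) + y <= 3 * (e / 8).
Proof. lra. Qed.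

Variables (H : V -> R) (h0 : R) (Vh S : R -> R -> operator R d).
Variable (mu : R.-fker (measurableTypeR R) ~> (V * V)%type).
Variables (M : R) (hs : nat -> R) (u : nat -> V -> C) (U : set_system nat).
Hypothesis M0 : 0 <= M.
Hypothesis VhB : forall h t, 0 < h < h0 -> bounded_operator (Vh h t).
Hypothesis VhM : forall h, 0 < h < h0 -> {ae leb, forall t, opnorm (Vh h t) <= M}.
Hypothesis SP : forall h, 0 < h < h0 -> propagator H h (Vh h) (S h).
Hypothesis hsP : forall n, 0 < hs n < h0.
Hypothesis uP : forall n, L2 (u n) /\ L2norm (u n) = 1.
Hypothesis uU : UltraFilter U.
Hypothesis U_small : forall e, 0 < e -> U [set n | hs n <= e].

Let wig (a : V * V -> C) n t : R := complex.Re (wigner (hs n) (S (hs n) (t / hs n) (u n)) a).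
Let mean (a : V * V -> C) t : R := complex.Re (cintegral (mu t) setT a).

Hypothesis U_weak : forall a b (f : V * V -> C), Cc_infty f -> forall e, 0 < e ->
  U [set n | `|\int[leb]_(t in `[a, b]) wig f n t - \int[leb]_(t in `[a, b]) mean f t| < e].

Variables (xi0 : V) (r : R).
Hypothesis r_gt0 : 0 < r.
Hypothesis gradH : monotone_gradient H xi0 (2 * r).

(** The order of the choices is the point: [delta] from [e], then [N0] and [Q] from [s0], then [B]
    from the symbol, and only then the interval, on which the threshold [N], the diameter [D] and
    the tolerance depend. For each interval a single index [n] taken in the ultrafilter transfers
    the slice estimate to [mu]; as [n] comes last, the terms in [h * D] can be made small. *)
Lemma local_estimate e : 0 < e -> exists2 delta, 0 < delta & forall s0, exists Q : nat,
  forall s, test_symbol xi0 r s -> exists B, forall a b, s0 <= a -> a < b -> b <= s0 + delta ->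
  \int[leb]_(t in `[a, b]) mean (symbol s) t <=
  2 * Q%:R * (\int[leb]_(t in `[a, b]) mean (symbol (mean_symbol s)) t) +
  (b - a) * e + B * (b - a) ^+ 2.
Proof.
move=> e0.
have [L [c [L0 c0 mono]]] := monotone_phase_at gradH.
(* Keeps the drift of the bad mass, [(M * (a - s0)) ^+ 2], below [e / 32] on the window. *)
pose delta := Num.min 1 (e / (32 * (M ^+ 2 + 1))).
have M1 : 0 < M ^+ 2 + 1 by rewrite ltr_wpDl // sqr_ge0.
have d0 : 0 < delta by rewrite lt_min ltr01 divr_gt0 // mulr_gt0.
have dM : (M * delta) ^+ 2 <= e / 32.
  have d1 : delta <= 1 by rewrite ge_min lexx.
  have d2 : delta * (32 * (M ^+ 2 + 1)) <= e by rewrite -ler_pdivlMr ?mulr_gt0 // ge_min lexx orbT.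
  have : M ^+ 2 * (delta * delta) <= (M ^+ 2 + 1) * delta.
    by rewrite ler_pM ?sqr_ge0 ?mulr_ge0 ?(ltW d0) ?lerDl // -[leRHS]mul1r ler_wpM2r // ltW.
  by rewrite exprMn [delta ^+ 2]expr2; lra.
exists delta => // s0.
(* Large enough for the cube of lattice points to contain every [k] with [h k] in the ball of radius
   [2 * r]. *)
pose m n := (Num.trunc ((`|xi0| + 2 * r) / hs n)).+1.
pose X n : finType := 'rV['I_(m n + m n).+1]_d.
pose zz n : X n -> Z := @cube_pt d (m n).
pose K n : pred (X n) := fun x => `|hs n *: toZ R (zz n x) - xi0| < 2 * r.
pose ph n := phase_at H (hs n) (zz n).
pose p n (x : X n) := sqn (wave (hs n) (S (hs n)) (u n) (zz n) s0 x).
have zinj n : injective (zz n) by exact: cube_pt_inj.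
have hn0 n : 0 < hs n by case/andP: (hsP n).
have cover n k : `|hs n *: toZ R k - xi0| < 2 * r -> k \in codom (zz n).
  move=> kK; apply: (@cube_ptP R); rewrite -[X in X <= _](@mulfK _ (hs n)) ?gt_eqF //.
  apply/ltW; apply: le_lt_trans (_ : _ <= (`|xi0| + 2 * r) / hs n) (truncnS_gt _).
  rewrite ler_pM2r ?invr_gt0 // mulrC -{1}(gtr0_norm (hn0 n)) -normrZ.
  by rewrite -[_ *: _](subrK xi0) addrC; apply: le_trans (ler_normD _ _) _; rewrite lerD2l ltW.
have p0 n x : 0 <= p n x by exact: sqn_ge0.
have p1 n : \sum_x p n x <= 1.
  have [uL u1] := uP n.
  exact: (wave_mass (SP (hsP n)) uL u1 (@zinj n) s0).
have e32 : 0 < e / 32 by rewrite divr_gt0.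
have [N0 N0P] := rank_stabilize (@zz) (@K) (@ph) p0 p1 uU e32.
have [Q QP] := cluster_card d N0 L0 c0.
exists Q => s [[sC smC] [A A0 sA] [Lp Lp0 sL] s01 s_supp].
exists (A * (size (freqs s))%:R * (M ^+ 2 + 1) + 2 * Q%:R * (A * (M ^+ 2 + 1))).
move=> a b sa ab bs; have ba : 0 < b - a by rewrite subr_gt0.
pose F : R := (size (freqs s))%:R.
pose l1m : R := \sum_(k <- freqs s) l1 (toZ R k).
have l1mP k : k \in freqs s -> l1 (toZ R k) <= l1m.
  by move=> kF; rewrite /l1m (big_rem k) //= lerDl sumr_ge0 // => ? _; exact: l1_ge0.
(* The three summands ensure in turn that [N] exceeds all frequencies of the symbol, that the
   oscillating pairs contribute at most [(b - a) * (e / 8)], and that [N0 <= N]. *)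
pose N := ((Num.trunc l1m).+1 + (Num.trunc (4 * A * F / ((b - a) * (e / 8)))).+1 + N0)%N.
have N_gt0 : (0 < N)%N by rewrite /N addSn.
have freqsN k : k \in freqs s -> l1 (toZ R k) <= N%:R.
  move=> kF; apply: le_trans (l1mP k kF) _; apply: le_trans (ltW (truncnS_gt _)) _.
  by rewrite ler_nat /N -addnA leq_addr.
have NF : 4 * A * F / N%:R <= (b - a) * (e / 8).
  have be : 0 < (b - a) * (e / 8) by rewrite mulr_gt0 // divr_gt0.
  rewrite ler_pdivrMr ?ltr0n // -ler_pdivrMl // [leLHS]mulrC; apply: le_trans (ltW (truncnS_gt _)) _.
  by rewrite ler_nat /N addnAC leq_addl.
have N0N : (N0 <= N)%N by rewrite leq_addl.
have [D D0 DP] := cluster_diam d N L0 c0.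
(* Tolerance of the two weak approximations, which enter with weights [1] and [2 * Q]. *)
pose k := (b - a) * (e / 8) / (1 + 2 * Q%:R).
have Q1 : 0 < 1 + 2 * Q%:R :> R by rewrite ltr_wpDr.
have k0 : 0 < k by rewrite divr_gt0 // mulr_gt0 // divr_gt0.
have kE : k * (1 + 2 * Q%:R) = (b - a) * (e / 8) by rewrite divfK // gt_eqF.
pose cst := Lp * D * (F + 2 * Q%:R).
have cst0 : 0 <= cst by rewrite !mulr_ge0 ?addr_ge0 ?mulr_ge0.
have small1 : 0 < e / 8 / (cst + 1) by rewrite divr_gt0 ?divr_gt0 // ltr_wpDl.
have small2 : 0 < 2 * r / (l1m + 1).
  by rewrite divr_gt0 ?mulr_gt0 // ltr_wpDl // sumr_ge0 // => ? _; exact: l1_ge0.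
have [n [[[[n1 n2] n3] n4] n5]] := filter_ex (filterI (filterI (filterI (filterI
  (N0P N N0N) (U_small small1)) (U_small small2)) (U_weak a b sC k0)) (U_weak a b smC k0)).
have [uL u1] := uP n.
have [G monoG] := mono (hs n) (X n) (zz n) (hn0 n).
have h_small j : j \in freqs s -> hs n * `|toZ R j| <= 2 * r.
  move=> jF; have := n3; rewrite /= ler_pdivlMr; last first.
    by rewrite ltr_wpDl // sumr_ge0 // => ? _; exact: l1_ge0.
  apply: le_trans; rewrite ler_wpM2l ?(ltW (hn0 n)) //.
  by apply: le_trans (le_norm_l1 _) _; apply: le_trans (l1mP j jF) _; rewrite lerDl.
have goodQ x : (#|[pred y | connect (near_resonant (zz n) (K n) (ph n) N) x y &
    near_rank (zz n) (K n) (ph n) N0 y == near_rank (zz n) (K n) (ph n) N y]| <= Q)%N.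
  have := QP (X n) (zz n) (K n) (ph n) G monoG (@zinj n) N x N0N.
  by rewrite cardsE.
have h_le : hs n * cst <= e / 8.
  have := n2; rewrite /= ler_pdivlMr ?ltr_wpDl //; apply: le_trans.
  by rewrite ler_wpM2l ?(ltW (hn0 n)) // lerDl.
have as0 : (M * (a - s0)) ^+ 2 <= e / 32.
  apply: le_trans dM; rewrite ler_pXn2r ?nnegrE ?mulr_ge0 ?subr_ge0 ?(ltW d0) //.
  by rewrite ler_wpM2l // lerBlDl (le_trans (ltW ab)).
have be : 0 < (b - a) * (e / 8) by rewrite mulr_gt0 // divr_gt0.
have t1 : (b - a) * (4 * (e / 32 + (M * (a - s0)) ^+ 2) + hs n * cst) <= 3 * ((b - a) * (e / 8)).
  rewrite [leRHS]mulrCA ler_pM2l //; exact: (estimate_budget as0 h_le).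
have Ee : (b - a) * e = 8 * ((b - a) * (e / 8)) by field.
have Q0 : 0 <= 2 * Q%:R :> R by rewrite mulr_ge0.
have sl := @slice_estimate R d H (hs n) (Vh (hs n)) (S (hs n)) M (u n) (hn0 n) M0
  (fun t => VhB t (hsP n)) (VhM (hsP n)) (SP (hsP n)) uL u1 xi0 r (X n) (zz n) r_gt0
  (@zinj n) (@cover n) s A Lp A0 Lp0 sA sL s01 s_supp h_small N0 N Q D (e / 32) s0
  N_gt0 D0 freqsN (DP _ _ _ _ _ monoG) goodQ n1 a b sa ab.
exact: (estimate_transfer n4 n5 sl Q0 kE be t1 NF Ee).
Qed.

End local_estimate.

(** * Strong monotonicity of the gradient *)

Section directional_calculus.
Variables (R : realType) (d : nat).
Local Notation V := 'rV[R]_d.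
Implicit Types (f : V -> R^o) (x v w : V).

Lemma derive_line f x v (s : R) : derivable f (x + s *: v) v ->
  is_derive s 1 (fun t : R => f (x + t *: v) : R^o) ('D_v f (x + s *: v)).
Proof.
move=> df.
have E : (fun h : R => h^-1 *: (((fun t : R => f (x + t *: v)) \o shift s) (h *: (1 : R^o)) - f (x + s *: v))) =
         (fun h : R => h^-1 *: ((f \o shift (x + s *: v)) (h *: v) - f (x + s *: v))).
  apply/funext => h /=; congr (_ *: (f _ - _)).
  by rewrite [h *: (1 : R^o)]mulr1 scalerDl addrCA.
apply: DeriveDef; first by rewrite /derivable E.
by rewrite /derive E.
Qed.

Lemma MVT_line f x v (t : R) : (forall y, derivable f y v) -> 0 < t ->
  exists2 c : R, 0 < c < t & f (x + t *: v) - f x = t * 'D_v f (x + c *: v).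
Proof.
move=> df t0.
have dE (s : R) : is_derive s (1 : R^o) (fun t : R => f (x + t *: v) : R^o) ('D_v f (x + s *: v)).
  exact: derive_line.
have [|c] := MVT t0 (fun s _ => dE s).
  apply: continuous_subspaceT => s; apply: differentiable_continuous.
  by apply/derivable1_diffP; have [] := dE s.
rewrite in_itv /= => c0t; rewrite subr0 scale0r addr0 mulrC => e.
by exists c.
Qed.

Lemma MVT_seg f x y : (forall z, derivable f z (y - x)) ->
  exists2 c : R, 0 < c < 1 & f y - f x = 'D_(y - x) f (x + c *: (y - x)).
Proof.
move=> df; have [c c01] := MVT_line x df ltr01.
by rewrite scale1r subrKC mul1r; exists c.
Qed.

(** Directional derivatives only, as in [Ck]; their linearity in the direction has to be derived. *)
Definition C1 f := continuous f /\
  forall v, (forall x, derivable f x v) /\ continuous (fun x => 'D_v f x).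

Lemma Ck1 n f : Ck n.+1 f -> C1 f.
Proof.
move=> [fc fd]; split => // v; have [? dc] := fd v; split => //.
by case: n dc {fd} => [|n] [].
Qed.

Lemma MVT_line_signed f x v (t : R) : (forall y, derivable f y v) ->
  exists2 c : R, `|c| <= `|t| & f (x + t *: v) - f x = t * 'D_v f (x + c *: v).
Proof.
move=> df; have [t0|t0|->] := ltrgt0P t.
- have [c /andP[c0 ct] e] := MVT_line x df t0; exists c => //.
  by rewrite gtr0_norm // ltW.
- have t0' : 0 < - t by rewrite oppr_gt0.
  have [c /andP[c0 ct] e] := MVT_line (x + t *: v) df t0'; exists (t + c).
    by rewrite ltr0_norm ?ltr0_norm //; lra.
  move: e; rewrite scaleNr addrK -addrA -scalerDl => e.
  by rewrite -[LHS]opprB e mulNr opprK.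
- by exists 0; [rewrite normr0|rewrite scale0r addr0 subrr mul0r].
Qed.

Lemma continuous_dist (g : V -> R^o) x (e : R) : continuous g -> 0 < e ->
  exists2 delta : R, 0 < delta & forall y, `|y - x| < delta -> `|g y - g x| < e.
Proof.
move=> gc e0; have /cvgrPdist_lt/(_ e e0)/nbhs_ballP[delta /= d0 dP] := gc x.
exists delta => // y yx; rewrite distrC; apply: dP.
by rewrite -ball_normE /= distrC.
Qed.

(** The increment along [t *: (a *: v + w)] is the sum of the increments along two sides of a
    parallelogram. The mean value theorem writes each of the three as a derivative at a point close
    to [x], and continuity of the derivatives concludes. *)
Lemma derive_lin f x v w (a : R) : C1 f ->
  'D_(a *: v + w) f x = a * 'D_v f x + 'D_w f x.
Proof.
move=> [fc fd]; set z := a *: v + w.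
have [dv cv] := fd v; have [dw cw] := fd w; have [dz cz] := fd z.
apply/eqP; rewrite -subr_eq0 -normr_le0; apply/ler_addgt0Pr => e e0; rewrite add0r.
have a2 : 0 < `|a| + 2 by rewrite ltr_wpDl.
have e' : 0 < e / (`|a| + 2) by rewrite divr_gt0.
have [r1 r10 h1] := continuous_dist x cv e'.
have [r2 r20 h2] := continuous_dist x cw e'.
have [r3 r30 h3] := continuous_dist x cz e'.
pose r := Num.min r1 (Num.min r2 r3).
have r0 : 0 < r by rewrite !lt_min r10 r20.
pose k := `|a| * `|v| + `|w| + 1.
have k0 : 0 < k by rewrite ltr_wpDl // addr_ge0 ?mulr_ge0.
(* Small enough for the three intermediate points to be within [r] of [x]. *)
pose t := r / (2 * k).
have t0 : 0 < t by rewrite divr_gt0 // mulr_gt0.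
have tk : t * k < r.
  have -> : t * k = r / 2 by rewrite /t; field; rewrite gt_eqF.
  by rewrite ltr_pdivrMr // ltr_pMr // ltr1n.
have tn : `|t| = t by rewrite gtr0_norm.
have tan_ : `|t * a| = t * `|a| by rewrite normrM tn.
have [c1 c1t e1] := MVT_line_signed x t dz.
have [c2 c2t e2] := MVT_line_signed x (t * a) dv.
have [c3 c3t e3] := MVT_line_signed (x + (t * a) *: v) t dw.
have key : 'D_z f (x + c1 *: z) = a * 'D_v f (x + c2 *: v) + 'D_w f (x + (t * a) *: v + c3 *: w).
  apply: (@mulfI _ t); first by rewrite gt_eqF.
  rewrite -e1 mulrDr mulrA -e2 -e3 /z scalerDr scalerA !addrA; ring.
have nz : `|z| <= `|a| * `|v| + `|w| by rewrite (le_trans (ler_normD _ _)) // normrZ.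
have n1 : `|x + c1 *: z - x| < r3.
  rewrite addrAC subrr add0r normrZ; apply: le_lt_trans (_ : t * k < r3).
    by rewrite -tn ler_pM // (le_trans nz) // lerDl.
  by rewrite (lt_le_trans tk) // !ge_min lexx !orbT.
have n2 : `|x + c2 *: v - x| < r1.
  rewrite addrAC subrr add0r normrZ; apply: le_lt_trans (_ : t * k < r1); last first.
    by rewrite (lt_le_trans tk) // !ge_min lexx.
  apply: (@le_trans _ _ (t * (`|a| * `|v|))).
    by rewrite mulrA ler_wpM2r // -tn -normrM.
  by rewrite ler_pM2l // /k -addrA lerDl addr_ge0.
have n3 : `|x + (t * a) *: v + c3 *: w - x| < r2.
  rewrite -(addrA x) [x + _]addrC addrK; apply: le_lt_trans (_ : t * k < r2); last first.
    by rewrite (lt_le_trans tk) // !ge_min lexx !orbT.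
  apply: le_trans (ler_normD _ _) _; rewrite (normrZ (t * a)) (normrZ c3) tan_.
  apply: (@le_trans _ _ (t * (`|a| * `|v|) + t * `|w|)).
    by rewrite mulrA lerD2l ler_wpM2r // -tn.
  by rewrite -mulrDr ler_pM2l // lerDl.
have := h1 _ n2; have := h2 _ n3; have := h3 _ n1; rewrite key.
set A := 'D_v f _; set B := 'D_w f _; set A' := 'D_v f _; set B' := 'D_w f _; set D := 'D_z f _.
move=> g3 g2 g1.
have -> : D - (a * A' + B') = - (a * A + B - D) + a * (A - A') + (B - B') by ring.
apply: le_trans (ler_normD _ _) _; apply: le_trans (lerD (ler_normD _ _) (lexx _)) _.
rewrite normrN normrM.
have -> : e = e / (`|a| + 2) + `|a| * (e / (`|a| + 2)) + e / (`|a| + 2) by field; rewrite gt_eqF.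
by rewrite !lerD // ?(ltW g3) ?(ltW g2) // ler_wpM2l // ltW.
Qed.

Definition partial f (i : 'I_d) : V -> R^o := fun x => 'D_(delta_mx ord0 i) f x.

Lemma derive_dot f x v : C1 f -> 'D_v f x = \sum_i v ord0 i * partial f i x.
Proof.
move=> fC; rewrite [in LHS](row_sum_delta v).
elim/big_rec2: _ => [|i y w _ <-].
  (* With zero directions, [derive_lin] says that ['D_0 f] is twice itself. *)
  have := derive_lin x 0 0 1 fC; rewrite scaler0 addr0 mul1r => e.
  by move: e; set D := 'D_0 f x => e; lra.
exact: derive_lin.
Qed.

End directional_calculus.

(** * Definite Hessians *)

Section hessian_geometry.
Variables (R : realType) (d : nat).
Local Notation V := 'rV[R]_d.
Implicit Types (x v w : V).

Lemma derive2_dot (f : V -> R^o) x v w : C1 f -> (forall i, C1 (partial f i)) ->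
  'D_w (fun y => 'D_v f y : R^o) x =
  \sum_i \sum_j v ord0 i * w ord0 j * partial (partial f i) j x.
Proof.
move=> fC pC.
have -> : (fun y => 'D_v f y : R^o) = \sum_(i < d) (v ord0 i *: partial f i).
  by apply/funext => y; rewrite fct_sumE derive_dot.
have pd i : derivable (partial f i) x w by have [_ /(_ w)[]] := pC i.
rewrite derive_sum; last by move=> i; exact: derivableZ.
apply: eq_bigr => i _; rewrite deriveZ // derive_dot // [LHS]mulr_sumr.
by apply: eq_bigr => j _; rewrite mulrA.
Qed.

Lemma ball_segment (x0 x y : V) (r c : R) : `|x - x0| < r -> `|y - x0| < r -> 0 <= c <= 1 ->
  `|x + c *: (y - x) - x0| < r.
Proof.
move=> xr yr /andP[c0 c1].
have -> : x + c *: (y - x) - x0 = (1 - c) *: (x - x0) + c *: (y - x0).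
  by apply/rowP => i; rewrite !mxE; ring.
apply: le_lt_trans (ler_normD _ _) _.
rewrite (normrZ (1 - c)) (normrZ c) (ger0_norm c0) ger0_norm ?subr_ge0 //.
apply: (@le_lt_trans _ _ (Num.max `|x - x0| `|y - x0|)); last by rewrite gt_max xr.
set m := Num.max _ _.
have h1 : (1 - c) * `|x - x0| <= (1 - c) * m by rewrite ler_wpM2l ?subr_ge0 // le_max lexx.
have h2 : c * `|y - x0| <= c * m by rewrite ler_wpM2l // le_max lexx orbT.
lra.
Qed.

Definition quad (h : 'I_d -> 'I_d -> R) w : R := \sum_i \sum_j w ord0 i * w ord0 j * h i j.

Lemma continuous_coord i : continuous (fun w : V => w ord0 i : R^o).
Proof. exact: coord_continuous. Qed.

(** The minimum of [|quad h|] on the compact unit sphere of [l1] is positive; the rest is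
    homogeneity. *)
Lemma definite_coercive h : definite (quad h) ->
  exists2 m : R, 0 < m & forall w, m * l1 w ^+ 2 <= `|quad h w|.
Proof.
move=> hdef.
have l1c : continuous (fun w : V => l1 w : R^o).
  apply: continuous_big => [|i _]; first exact: add_continuous.
  by move=> w; apply: (continuous_comp (@continuous_coord i w)); exact: norm_continuous.
have qc : continuous (fun w : V => quad h w : R^o).
  apply: continuous_big => [|i _]; first exact: add_continuous.
  apply: continuous_big => [|j _]; first exact: add_continuous.
  move=> w; exact: (cvgM (cvgM (@continuous_coord i w) (@continuous_coord j w)) (cvg_cst (h i j))).
have fc : continuous (fun w : V => `|quad h w| : R^o).
  by move=> w; apply: (continuous_comp (qc w)); exact: norm_continuous.
have scale w : l1 w != 0 -> l1 ((l1 w)^-1 *: w) = 1.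
  by move=> w0; rewrite l1Z ger0_norm ?invr_ge0 ?l1_ge0 // mulVf.
pose A : set V := [set w | l1 w = 1].
(* The sphere is empty when [d = 0], where the claim is trivial. *)
have [w1|A0] := pselect (A !=set0); last first.
  exists 1 => // w; have -> : l1 w = 0; last by rewrite expr0n mulr0.
  by apply/eqP/negP => /negP w0; apply: A0; exists ((l1 w)^-1 *: w); exact: scale.
have cA : compact A.
  apply: bounded_closed_compact.
    exists 1; split => // M M1 w /= w1'; apply: le_trans (le_norm_l1 w) _.
    by rewrite w1' ltW.
  have -> : A = (fun w : V => l1 w : R^o) @^-1` [set 1] by [].
  by apply: closed_comp => [w _|]; [exact: l1c|exact: closed_eq].
have [c cA' cmin] := compact_EVT_min w1 cA (continuous_subspaceT fc).
have c1 : l1 c = 1 by move: cA'; rewrite inE.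
exists `|quad h c|.
  have c0 : c != 0 by apply: contra_eq_neq c1 => ->; rewrite l10 eq_sym oner_eq0.
  by rewrite normr_gt0; case: hdef => /(_ c c0); [move/gt_eqF|move/lt_eqF] => ->.
move=> w; have [w0|w0] := eqVneq (l1 w) 0.
  by rewrite w0 expr0n mulr0.
have l0 : 0 < l1 w by rewrite lt_neqAle eq_sym w0 l1_ge0.
have := cmin ((l1 w)^-1 *: w); rewrite inE => /(_ (scale w w0)) => le.
have qZ a v : quad h (a *: v) = a ^+ 2 * quad h v.
  rewrite /quad mulr_sumr; apply: eq_bigr => i _; rewrite mulr_sumr.
  by apply: eq_bigr => j _; rewrite !mxE; ring.
move: le; rewrite qZ normrM ger0_norm ?sqr_ge0 // exprVn mulrC.
by rewrite ler_pdivlMr // exprn_gt0.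
Qed.

Lemma quad_close h k (e : R) w : (forall i j, `|h i j - k i j| <= e) ->
  `|quad h w - quad k w| <= e * l1 w ^+ 2.
Proof.
move=> hk; rewrite /quad -sumrB; apply: le_trans (ler_norm_sum _ _ _) _.
rewrite expr2 mulrC /l1 -mulrA mulr_suml; apply: ler_sum => i _.
rewrite -sumrB; apply: le_trans (ler_norm_sum _ _ _) _.
rewrite mulrC mulr_suml mulr_suml; apply: ler_sum => j _.
have -> : `|w ord0 j| * e * `|w ord0 i| = `|w ord0 i * w ord0 j| * e by rewrite normrM; ring.
by rewrite -mulrBr normrM ler_wpM2l.
Qed.

Lemma lipschitz_partial (f : V -> R^o) (x0 : V) (r B : R) : C1 f ->
  (forall j y, `|y - x0| < r -> `|partial f j y| <= B) ->
  forall x y, `|x - x0| < r -> `|y - x0| < r -> `|f y - f x| <= B * l1 (y - x).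
Proof.
move=> fC pB x y xr yr.
have [_ /(_ (y - x))[dyx _]] := fC.
have [c /andP[c0 c1] ->] := MVT_seg dyx.
rewrite derive_dot // /l1 mulr_sumr; apply: le_trans (ler_norm_sum _ _ _) _.
apply: ler_sum => j _; rewrite normrM mulrC ler_wpM2r //; apply: pB.
by apply: ball_segment => //; rewrite !ltW.
Qed.

Lemma ler_sum_term (I : finType) (F : I -> R) i : (forall k, 0 <= F k) -> F i <= \sum_k F k.
Proof. by move=> F0; rewrite (bigD1 i) //= lerDl sumr_ge0. Qed.

Lemma half_bound (m a p q : R) : m * a <= p -> p <= q + m / 2 * a -> m / 2 * a <= q.
Proof. lra. Qed.

(** With [m] the coercivity constant at [xs], take a ball on which the second derivatives differ
    from those at [xs] by less than [m / 2]. The mean value theorem along segments then gives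
    monotonicity with constant [m / 2], and a bound [B] of the second derivatives gives the
    Lipschitz and Taylor estimates. *)
Lemma definite_monotone (H : V -> R) xs : smooth (H : V -> R^o) -> definite (hessian H xs) ->
  exists2 rho : R, 0 < rho & forall xi0 r,
    (forall xi, `|xi - xi0| < r -> `|xi - xs| < rho) -> monotone_gradient H xi0 r.
Proof.
move=> smH Hdef.
have HC : C1 (H : V -> R^o) by exact: Ck1 (smH 1%N).
have C1p n (f : V -> R^o) i : Ck n.+2 f -> Ck n.+1 (partial f i).
  by move=> [_ /(_ (delta_mx ord0 i))[]].
have pC i : C1 (partial (H : V -> R^o) i) by exact: (Ck1 (C1p 0%N _ i (smH 2%N))).
pose h x i j := partial (partial (H : V -> R^o) i) j x.
have hc i j : continuous (fun x => h x i j : R^o).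
  by have [_ /(_ (delta_mx ord0 j))[]] := pC i.
have hE x v : hessian H x v = quad (h x) v by rewrite /hessian derive2_dot.
have hsE : hessian H xs = quad (h xs) by apply/funext.
have [m m0 mP] : exists2 m : R, 0 < m & forall w, m * l1 w ^+ 2 <= `|quad (h xs) w|.
  by apply: definite_coercive; rewrite -hsE.
have m2 : 0 < m / 2 by rewrite divr_gt0.
have [rho rho0 rhoP] : exists2 rho : R, 0 < rho & forall x i j, `|x - xs| < rho -> `|h x i j - h xs i j| < m / 2.
  have near1 i j := continuous_dist xs (hc i j) m2.
  have : \forall x \near xs, forall i j, `|h x i j - h xs i j| < m / 2.
    apply: (@filter_forall _ 'I_d (fun i x => forall j, `|h x i j - h xs i j| < m / 2) (nbhs xs)) => i.
    apply: (@filter_forall _ 'I_d (fun j x => `|h x i j - h xs i j| < m / 2) (nbhs xs)) => j.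
    have [delta d0 dP] := near1 i j; apply/nbhs_ballP; exists delta => // y.
    by rewrite -ball_normE /= distrC; exact: dP.
  move=> /nbhs_ballP[rho /= rho0 rhoP]; exists rho => // x i j xr.
  by apply: rhoP; rewrite -ball_normE /= distrC.
exists rho => // xi0 r sub.
pose B := \sum_i \sum_j `|h xs i j| + m / 2.
have B0 : 0 <= B by rewrite addr_ge0 ?(ltW m2) // sumr_ge0 // => i _; rewrite sumr_ge0.
have hB x i j : `|x - xi0| < r -> `|h x i j| <= B.
  move=> /sub xr; have := rhoP x i j xr => lt.
  rewrite -[h x i j](subrK (h xs i j)); apply: le_trans (ler_normD _ _) _.
  rewrite addrC /B; apply: lerD; last exact: ltW lt.
  apply: le_trans (ler_sum_term (F := fun j => `|h xs i j|) j _) _ => //.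
  by apply: (ler_sum_term (F := fun i => \sum_j `|h xs i j|)) => k; exact: sumr_ge0.
have plip i x y : `|x - xi0| < r -> `|y - xi0| < r ->
    `|partial (H : V -> R^o) i y - partial (H : V -> R^o) i x| <= B * l1 (y - x).
  by move=> xr yr; apply: (lipschitz_partial (pC i) _ xr yr) => j z zr; exact: hB.
pose Gr x : V := \row_i partial (H : V -> R^o) i x.
have GrE x v : dot (Gr x) v = 'D_v (H : V -> R^o) x.
  by rewrite derive_dot // /dot; apply: eq_bigr => i _; rewrite mxE mulrC.
have Glip x y v : `|x - xi0| < r -> `|y - xi0| < r ->
    `|dot (Gr x - Gr y) v| <= B * l1 (x - y) * l1 v.
  move=> xr yr; rewrite /dot /l1 mulr_sumr; apply: le_trans (ler_norm_sum _ _ _) _.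
  apply: ler_sum => i _; rewrite !mxE normrM ler_wpM2r //; exact: plip.
exists Gr, B, (m / 2); split => // x y xr yr; split.
- have [_ /(_ (y - x))[dyx _]] := HC.
  have [c /andP[c0 c1] ->] := MVT_seg dyx.
  rewrite -!GrE; have zr : `|x + c *: (y - x) - xi0| < r.
    by apply: ball_segment => //; rewrite !ltW.
  have -> : dot (Gr (x + c *: (y - x))) (y - x) - dot (Gr x) (y - x) =
      dot (Gr (x + c *: (y - x)) - Gr x) (y - x).
    by rewrite /dot -sumrB; apply: eq_bigr => i _; rewrite !mxE mulrBl.
  apply: le_trans (Glip _ _ _ zr xr) _; rewrite expr2 mulrA ler_wpM2r ?l1_ge0 // ler_wpM2l //.
  rewrite addrC addrA addNr add0r l1Z ger0_norm ?(ltW c0) // -[leRHS]mul1r.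
  by rewrite ler_wpM2r ?l1_ge0 // ltW.
- by move=> v; exact: Glip.
- set w := x - y.
  have -> : dot (Gr x - Gr y) w = 'D_w (H : V -> R^o) x - 'D_w (H : V -> R^o) y.
    by rewrite -!GrE /dot -sumrB; apply: eq_bigr => i _; rewrite !mxE mulrBl.
  have [_ /(_ w) dC] := HC.
  have dwC z : derivable (fun y => 'D_w (H : V -> R^o) y : R^o) z w.
    by have [_ /(_ w)[_ [_ /(_ w)[]]]] := smH 2%N.
  have [c /andP[c0 c1] ->] := MVT_seg dwC.
  rewrite derive2_dot // -/w.
  set z := y + c *: w.
  have zr : `|z - xi0| < r by apply: ball_segment => //; rewrite !ltW.
  have cl : `|quad (h z) w - quad (h xs) w| <= m / 2 * l1 w ^+ 2.
    by apply: quad_close => i j; apply/ltW/rhoP/sub.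
  have := mP w; rewrite -/(quad (h z) w) => mw.
  have le2 : `|quad (h xs) w| <= `|quad (h z) w| + m / 2 * l1 w ^+ 2.
    have := ler_normB (quad (h z) w) (quad (h z) w - quad (h xs) w).
    by rewrite opprB addrC subrK => le; apply: le_trans le _; rewrite lerD2l.
  exact: half_bound mw le2.
Qed.

End hessian_geometry.

(** [g k] is the [k]-th derivative of [f]: smoothness on the line in a form that composes with
    affine functions. *)
Definition tower (R : realType) (f : R -> R) (g : nat -> R -> R) : Prop :=
  (forall x, g 0%N x = f x) /\
  forall k (x : R), is_derive x 1 (g k : R -> R) (g k.+1 x).

(** * Test symbols *)

Section smooth_line.
Variable R : realType.
Local Notation derives f g := (forall x : R, is_derive x 1 (f : R -> R) (g x)).

(** Raise [y / n <= expR (y / n)] to the power [n]; the constant is [n ^+ n]. *)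
Lemma exp_dominates_pow (m : nat) : exists2 C : R, 0 <= C & forall y, 0 < y -> y ^+ m <= C * expR y.
Proof.
case: m => [|m].
  by exists 1 => // y y0; rewrite expr0 mul1r -expR0 ler_expR ltW.
exists (m.+1%:R ^+ m.+1); first exact: exprn_ge0.
move=> y y0; have m0 : 0 < m.+1%:R :> R by [].
have h : y / m.+1%:R <= expR (y / m.+1%:R).
  by apply: le_trans (expR_ge1Dx _); rewrite lerDr.
have -> : y = (y / m.+1%:R) * m.+1%:R by rewrite divfK // gt_eqF.
rewrite expRM_natr exprMn mulrC ler_wpM2l ?exprn_ge0 //.
by rewrite ler_pXn2r // nnegrE ?expR_ge0 // divr_ge0 // ltW.
Qed.

Lemma exp_dominates_poly (p : {poly R}) :
  exists2 C : R, 0 <= C & forall y, 0 < y -> `|p.[y]| <= C * expR y.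
Proof.
have [c cP] : exists c : nat -> R, forall i, 0 <= c i /\ forall y, 0 < y -> y ^+ i <= c i * expR y.
  have [c cP] := choice (fun i => let: ex_intro2 C C0 CP := exp_dominates_pow i in
    ex_intro (fun C => 0 <= C /\ forall y, 0 < y -> y ^+ i <= C * expR y) C (conj C0 CP)).
  by exists c.
exists (\sum_(i < size p) `|p`_i| * c i).
  by apply: sumr_ge0 => i _; rewrite mulr_ge0 //; case: (cP i).
move=> y y0; rewrite horner_coef mulr_suml; apply: le_trans (ler_norm_sum _ _ _) _.
apply: ler_sum => i _; rewrite normrM -mulrA ler_wpM2l // ger0_norm ?exprn_ge0 ?(ltW y0) //.
by case: (cP i) => _; apply.
Qed.

(** The products of [exp(-1/x)] with polynomials in [1/x], extended by 0: a family closed under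
    differentiation, which contains for [p = 1] the standard smooth function vanishing on a
    half-line. *)
Definition flat (p : {poly R}) (x : R) : R := if 0 < x then p.[x^-1] * expR (- x^-1) else 0.

Lemma flat_le p : exists2 C : R, 0 <= C & forall x, `|flat p x| <= C.
Proof.
have [C C0 CP] := exp_dominates_poly p; exists C => // x; rewrite /flat.
case: ifPn => x0; last by rewrite normr0.
rewrite normrM [X in _ * X]ger0_norm ?expR_ge0 // expRN -ler_pdivlMr ?invr_gt0 ?expR_gt0 // invrK.
by apply: CP; rewrite invr_gt0.
Qed.

Definition flat_next (p : {poly R}) : {poly R} := 'X^2 * (p - p^`()).

Lemma derive_flat p : derives (flat p) (flat (flat_next p)).
Proof.
move=> x; have [x0|x0|->] := ltrgt0P x.
- have E : flat p = fun x => if 0 < x then p.[x^-1] * expR (- x^-1) else 0 by [].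
  have xn0 : x != 0 by rewrite gt_eqF.
  have nE : \near x, (fun x => p.[x^-1] * expR (- x^-1) : R) x = (flat p : R -> R) x.
    near=> y; rewrite /flat ifT //; near: y; exact: lt_nbhsr.
  apply: (near_eq_is_derive nE); rewrite /flat x0 /flat_next.
  have dinv : is_derive x (1 : R) (fun x => x^-1) (- x ^- 2).
    have h := @is_deriveV R (fun x => x) x 1 1 xn0 (is_derive_id x 1).
    apply: (is_derive_eq h).
    by rewrite scaleNr /GRing.scale /= mulr1.
  have dpoly : is_derive x (1 : R) (fun x => p.[x^-1]  : R) ((- x ^- 2) * (p^`()).[x^-1]).
    have := @is_derive1_comp R (fun y => p.[y]) (fun x => x^-1) x _ _ (is_derive_poly p x^-1) dinv.
    by move=> h; apply: (is_derive_eq h); rewrite /GRing.scale /= mulrC.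
  have dexp : is_derive x (1 : R) (fun x => expR (- x^-1)  : R) (x ^- 2 * expR (- x^-1)).
    have dn : is_derive x (1 : R) (fun x => - x^-1  : R) (x ^- 2).
      by apply: (is_derive_eq (is_deriveN dinv)); rewrite opprK.
    have := @is_derive1_comp R (fun y => expR y) (fun x => - x^-1) x _ _ (is_derive_expR _) dn.
    by move=> h; apply: (is_derive_eq h); rewrite /GRing.scale /= mulrC.
  apply: (is_derive_eq (is_deriveM dpoly dexp)).
  by rewrite /GRing.scale /= !hornerE /= exprVn; ring.
- have nE : \near x, (fun=> 0 : R) x = (flat p : R -> R) x.
    near=> y; rewrite /flat ifF //; apply/negbTE; rewrite -leNgt ltW //; near: y; exact: lt_nbhsl.
  apply: (near_eq_is_derive nE).
  by rewrite /flat ltNge (ltW x0) /=; exact: is_derive_cst.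
- rewrite /flat ltxx.
  (* [flat p h / h ^+ 2] is [flat ('X^2 * p) h], which is bounded; hence the derivative at 0
     vanishes. *)
  have [C C0 CP] := exp_dominates_poly ('X^2 * p).
  have fC h : `|flat p h| <= C * h ^+ 2.
    rewrite /flat; case: ifPn => h0; last by rewrite normr0 mulr_ge0 // sqr_ge0.
    have hi : 0 < h^-1 by rewrite invr_gt0.
    have := CP _ hi; rewrite !hornerE /= normrM exprVn ger0_norm ?invr_ge0 ?sqr_ge0 //.
    rewrite ler_pdivrMl ?exprn_gt0 // => le.
    rewrite normrM [X in _ * X]ger0_norm ?expR_ge0 // expRN.
    rewrite ler_pdivrMr ?expR_gt0 //; apply: le_trans le _; rewrite le_eqVlt; apply/orP; left; apply/eqP; ring.
  have lim0 : (h^-1 *: ((flat p \o shift 0) (h *: (1 : R)) - flat p 0) : R) @[h --> 0^'] --> (0 : R).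
    apply/cvgrPdist_le => e e0; near=> h.
    have hn : h != 0 by near: h; exact: nbhs_dnbhs_neq.
    rewrite sub0r normrN /= addr0 {2}/flat ltxx subr0 normrM normfV [h *: 1]mulr1.
    rewrite ler_pdivrMl ?normr_gt0 //; apply: le_trans (fC h) _.
    rewrite -real_normK ?num_real // expr2 mulrA [leRHS]mulrC ler_wpM2r //.
    have : `|h| <= e / (C + 1).
      near: h; apply: dnbhs0_le; rewrite divr_gt0 // ltr_wpDl //.
    rewrite ler_pdivlMr ?ltr_wpDl // => le; apply: le_trans le.
    by rewrite mulrC ler_wpM2l // lerDl.
  by apply: DeriveDef; [apply/cvg_ex; exists 0|exact/cvg_lim].
Unshelve. all: by end_near.
Qed.

Lemma tower_flat p : tower (flat p) (fun k => flat (iter k flat_next p)).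
Proof. by split => // k; exact: derive_flat. Qed.

Lemma tower_cos : tower (@cos R) (fun k x => cos (x + k%:R * (pi / 2))).
Proof.
split=> [x|k x]; first by rewrite mul0r addr0.
have da : is_derive x (1 : R) (fun x => x + k%:R * (pi / 2) : R) 1.
  by apply: (is_derive_eq (is_deriveD (is_derive_id x 1) (is_derive_cst _ x 1))); rewrite addr0.
have := @is_derive1_comp R (@cos R) (fun x => x + k%:R * (pi / 2)) x _ _ (is_derive_cos _) da.
move=> h; apply: (is_derive_eq h).
have -> : x + k.+1%:R * (pi / 2) = x + k%:R * (pi / 2) + pi / 2.
  by rewrite -addn1 natrD; ring.
by rewrite mulr1 cosDpihalf.
Qed.

Lemma tower_sin : tower (@sin R) (fun k x => sin (x + k%:R * (pi / 2))).
Proof.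
split=> [x|k x]; first by rewrite mul0r addr0.
have da : is_derive x (1 : R) (fun x => x + k%:R * (pi / 2) : R) 1.
  by apply: (is_derive_eq (is_deriveD (is_derive_id x 1) (is_derive_cst _ x 1))); rewrite addr0.
have := @is_derive1_comp R (@sin R) (fun x => x + k%:R * (pi / 2)) x _ _ (is_derive_sin _) da.
move=> h; apply: (is_derive_eq h).
have -> : x + k.+1%:R * (pi / 2) = x + k%:R * (pi / 2) + pi / 2.
  by rewrite -addn1 natrD; ring.
by rewrite mulr1 sinDpihalf.
Qed.

End smooth_line.

(** * Smooth functions under sums, products and affine maps *)

Section smooth_functions.
Variables (R : realType).
Implicit Types (U W : normedModType R).

Lemma CkS U n (f : U -> R^o) : Ck n.+1 f -> Ck n f.
Proof.
elim: n f => [|n ih] f; first by case.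
move=> [fc fd]; split => // v; have [dv cv] := fd v; split => //; exact: ih.
Qed.

Lemma Ck_cst U n (c : R) : Ck n ((fun=> c) : U -> R^o).
Proof.
elim: n c => [|n ih] c; split => //; try by move=> x; exact: cvg_cst.
move=> v; split; first by move=> x; exact: derivable_cst.
have -> : (fun x => 'D_v ((fun=> c) : U -> R^o) x) = fun=> 0 by apply/funext => x; rewrite derive_cst.
exact: ih.
Qed.

Lemma CkD U n (f g : U -> R^o) : Ck n f -> Ck n g -> Ck n (fun x => f x + g x).
Proof.
elim: n f g => [|n ih] f g [fc fd] [gc gd]; split; try by move=> x; apply: cvgD; [exact: fc|exact: gc].
  by [].
move=> v; have [df cf] := fd v; have [dg cg] := gd v.
split; first by move=> x; exact: derivableD.
have -> : (fun x => 'D_v (fun x => f x + g x : R^o) x) = fun x => 'D_v f x + 'D_v g x.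
  by apply/funext => x; exact: deriveD.
exact: ih.
Qed.

Lemma CkM U n (f g : U -> R^o) : Ck n f -> Ck n g -> Ck n (fun x => f x * g x : R^o).
Proof.
elim: n f g => [|n ih] f g fC gC; have [fc fd] := fC; have [gc gd] := gC;
  split; try by move=> x; apply: cvgM; [exact: fc|exact: gc].
  by [].
move=> v; have [df cf] := fd v; have [dg cg] := gd v.
split; first by move=> x; exact: derivableM.
have -> : (fun x => 'D_v (fun x => f x * g x : R^o) x) = fun x => f x * 'D_v g x + g x * 'D_v f x.
  by apply/funext => x; exact: deriveM.
by apply: CkD; apply: ih => //; exact: CkS.
Qed.

Lemma derivable_line_comp U (l dl : U -> R) (g g' : R -> R) x v :
  (forall x v h, l (x + h *: v) = l x + h * dl v) ->
  (forall y : R, is_derive y 1 (g : R -> R) (g' y)) ->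
  is_derive x v (fun x => g (l x) : R^o) (dl v * g' (l x)).
Proof.
move=> lin dg.
pose k (h : R) := l x + h * dl v.
have dk : is_derive (0 : R) 1 (k : R -> R) (dl v).
  rewrite /k; apply: is_derive_eq.
  by rewrite /GRing.scale /=; ring.
have := @is_derive1_comp R g k 0 _ _ (dg (k 0)) dk => -[d1 e1].
have E : (fun h : R => h^-1 *: (((fun x => g (l x) : R^o) \o shift x) (h *: v) - g (l x))) =
         (fun h : R => h^-1 *: ((g \o k : R -> R^o) (h *: (1 : R^o) + 0) - (g \o k) 0)).
  apply/funext => h /=; congr (_ *: (g _ - g _)).
    by rewrite addr0 /k [h *: (1 : R^o)]mulr1 addrC lin.
  by rewrite /k mul0r addr0.
apply: DeriveDef; first by rewrite /derivable E; exact: d1.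
rewrite /derive E; move: e1; rewrite /derive => ->.
by rewrite /k mul0r addr0 /GRing.scale /= mulrC.
Qed.

(** All the [g k] are treated at once, because each derivative of [g k] composed with [l] is a
    constant times [g k.+1] composed with [l]. *)
Lemma smooth_line_comp U (l dl : U -> R) (f : R -> R) g :
  continuous (l : U -> R^o) -> (forall x v h, l (x + h *: v) = l x + h * dl v) ->
  tower f g -> smooth (fun x => f (l x) : R^o).
Proof.
move=> lc lin [g0 gd] n.
suff S k : Ck n (fun x => g k (l x) : R^o).
  by have -> : (fun x => f (l x) : R^o) = (fun x => g 0%N (l x) : R^o) by apply/funext => x; rewrite g0.
have gc j : continuous (fun x => g j (l x) : R^o).
  move=> x; apply: (continuous_comp (lc x)).
  by apply: differentiable_continuous; apply/derivable1_diffP; have [] := gd j (l x).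
elim: n k => [|n ih] k; split => // v.
have dE x := derivable_line_comp x v lin (gd k).
split; first by move=> x; have [] := dE x.
have -> : (fun x => 'D_v (fun x => g k (l x) : R^o) x) = fun x => (fun=> dl v) x * g k.+1 (l x).
  by apply/funext => x; exact: derive_val.
by apply: CkM; [exact: Ck_cst|exact: ih].
Qed.

Lemma Ck_snd U W n (f : W -> R^o) : Ck n f -> Ck n (fun p : U * W => f p.2).
Proof.
elim: n f => [|n ih] f [fc fd]; split => //; try by move=> x; apply: (continuous_comp (@cvg_snd _ _ _ _ _)); exact: fc.
move=> v; have [dv cv] := fd v.2.
have E x : (fun h : R => h^-1 *: (((fun p : U * W => f p.2) \o shift x) (h *: v) - f x.2)) =
  (fun h : R => h^-1 *: ((f \o shift x.2) (h *: v.2) - f x.2)) by apply/funext.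
split; first by move=> x; rewrite /derivable E; exact: dv.
have -> : (fun x => 'D_v (fun p : U * W => f p.2) x) = fun x => 'D_(v.2) f x.2.
  by apply/funext => x; rewrite /derive E.
exact: (ih (fun y => 'D_(v.2) f y) cv).
Qed.

Lemma smooth_snd U W (f : W -> R^o) : smooth f -> smooth (fun p : U * W => f p.2).
Proof. by move=> fS n; exact: Ck_snd. Qed.

Lemma smooth_cst U (c : R) : smooth ((fun=> c) : U -> R^o).
Proof. by move=> n; exact: Ck_cst. Qed.

Lemma smoothD U (f g : U -> R^o) : smooth f -> smooth g -> smooth (fun x => f x + g x).
Proof. by move=> fS gS n; exact: CkD. Qed.

Lemma smoothM U (f g : U -> R^o) : smooth f -> smooth g -> smooth (fun x => f x * g x : R^o).
Proof. by move=> fS gS n; exact: CkM. Qed.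

End smooth_functions.

Section test_terms.
Variables (R : realType) (d : nat).
Local Notation C := R[i].
Local Notation V := 'rV[R]_d.
Local Notation Z := 'rV[int]_d.

(** Closed under sums and products, and strong enough to give the bounds required of a test
    symbol. *)
Definition tame (f : V -> R) : Prop :=
  [/\ smooth (f : V -> R^o), exists2 B, 0 <= B & forall x, `|f x| <= B &
      exists2 L, 0 <= L & forall x y, `|f x - f y| <= L * `|x - y|].

Lemma tame_cst (c : R) : tame (fun=> c).
Proof.
split; first exact: smooth_cst; first by exists `|c|.
by exists 0 => // x y; rewrite subrr normr0 mul0r.
Qed.

Lemma tameD f g : tame f -> tame g -> tame (fun x => f x + g x).
Proof.
move=> [fS [B B0 fB] [L L0 fL]] [gS [B' B'0 gB] [L' L'0 gL]]; split; first exact: smoothD.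
  exists (B + B'); first exact: addr_ge0.
  by move=> x; rewrite (le_trans (ler_normD _ _)) // lerD.
exists (L + L'); first exact: addr_ge0.
move=> x y; rewrite opprD addrACA mulrDl.
by rewrite (le_trans (ler_normD _ _)) // lerD.
Qed.

Lemma tameM f g : tame f -> tame g -> tame (fun x => f x * g x).
Proof.
move=> [fS [B B0 fB] [L L0 fL]] [gS [B' B'0 gB] [L' L'0 gL]]; split; first exact: smoothM.
  exists (B * B'); first exact: mulr_ge0.
  by move=> x; rewrite normrM ler_pM.
exists (B * L' + L * B'); first by rewrite addr_ge0 ?mulr_ge0.
move=> x y.
have -> : f x * g x - f y * g y = f x * (g x - g y) + (f x - f y) * g y by ring.
apply: le_trans (ler_normD _ _) _; rewrite !normrM mulrDl lerD //.
  by rewrite -mulrA ler_pM.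
by rewrite mulrAC ler_pM.
Qed.

Lemma tame_line (l dl : V -> R) (a : R) (f : R -> R) g : 0 <= a -> continuous (l : V -> R^o) ->
  (forall x v h, l (x + h *: v) = l x + h * dl v) -> (forall x y, `|l x - l y| <= a * `|x - y|) ->
  tower f g -> (exists2 B, 0 <= B & forall x, `|f x| <= B) ->
  (exists2 B, 0 <= B & forall x, `|g 1%N x| <= B) -> tame (fun x => f (l x)).
Proof.
move=> a0 lc lin llip fg [B B0 fB] [B' B'0 gB]; split; last first.
- exists (B' * a); first exact: mulr_ge0.
  move=> x y; rewrite -mulrA; apply: le_trans (_ : B' * `|l x - l y| <= _); last by rewrite ler_wpM2l.
  have [g0 gd] := fg; rewrite -!g0.
  wlog le : x y / l x <= l y => [wl|].
    have [xy|/ltW yx] := leP (l x) (l y); first exact: wl.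
    by rewrite distrC [X in _ * X]distrC; exact: wl.
  move: le; rewrite le_eqVlt => /orP[/eqP ->|lt]; first by rewrite !subrr !normr0 mulr0.
  have [|c _] := MVT lt (fun s _ => gd 0%N s).
    apply: continuous_subspaceT => s; apply: differentiable_continuous.
    by apply/derivable1_diffP; have [] := gd 0%N s.
  rewrite distrC (distrC (l x)) => ->; rewrite normrM ler_wpM2r //.
- by exists B.
- exact: (smooth_line_comp lc lin fg).
Qed.

End test_terms.

(** * Symbols with tame coefficients *)

Section symbols.
Variables (R : realType) (d : nat).
Local Notation C := R[i].
Local Notation V := 'rV[R]_d.
Local Notation Z := 'rV[int]_d.
Implicit Types s : seq (Z * (V -> C)).

Definition ctame (c : V -> C) : Prop :=
  tame (fun x => complex.Re (c x)) /\ tame (fun x => complex.Im (c x)).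

Fixpoint tame_list s : Prop := if s is p :: s' then ctame p.2 /\ tame_list s' else True.

Lemma ctameD a b : ctame a -> ctame b -> ctame (fun x => a x + b x).
Proof.
move=> [a1 a2] [b1 b2]; split.
  by rewrite (_ : (fun x => _) = fun x => complex.Re (a x) + complex.Re (b x)); [exact: tameD|apply/funext => x; rewrite Re_D].
by rewrite (_ : (fun x => _) = fun x => complex.Im (a x) + complex.Im (b x)); [exact: tameD|apply/funext => x; rewrite Im_D].
Qed.

Lemma ctame_cst (c : C) : ctame (fun=> c).
Proof. by split; exact: tame_cst. Qed.

Lemma ctameM a b : ctame a -> ctame b -> ctame (fun x => a x * b x).
Proof.
move=> [a1 a2] [b1 b2]; split.
  under [X in tame X]eq_fun do rewrite Re_M -mulN1r.
  by apply: tameD; [exact: tameM|apply: tameM; [exact: tame_cst|exact: tameM]].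
under [X in tame X]eq_fun do rewrite Im_M.
by apply: tameD; exact: tameM.
Qed.

Lemma cabs_le (z : C) : cabs z <= `|complex.Re z| + `|complex.Im z|.
Proof.
have -> : z = (complex.Re z)%:C + 'i * (complex.Im z)%:C.
  by apply/eqP; rewrite eq_complex /=; apply/andP; split; apply/eqP; ring.
apply: le_trans (cabsD _ _) _; rewrite cabsM.
have c1 (x : R) : cabs x%:C = `|x| by rewrite /cabs normc_def /= expr0n addr0 sqrtr_sqr.
have -> : cabs 'i%C = 1 :> R by rewrite /cabs normc_def /= expr0n add0r expr1n sqrtr1.
rewrite mul1r !c1; case: z => a b /=.
by rewrite !(mulr0, mul0r, subr0, addr0, add0r, mul1r, mulr1).
Qed.

Lemma tcoef_cons (p : Z * (V -> C)) s xi m :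
  tcoef (sval (p :: s) xi) m = (if p.1 == m then p.2 xi else 0) + tcoef (sval s xi) m.
Proof. by rewrite /tcoef /= big_cons /=; case: ifP => // _; rewrite add0r. Qed.

Lemma tcoef_tame s m : tame_list s -> ctame (fun xi => tcoef (sval s xi) m).
Proof.
elim: s => [_|p s ih /= [pt st]].
  have -> : (fun xi => tcoef (sval [::] xi) m) = (fun=> 0) :> (V -> C).
    by apply/funext => xi; rewrite /tcoef big_nil.
  exact: ctame_cst.
have -> : (fun xi => tcoef (sval (p :: s) xi) m) =
    (fun xi => (if p.1 == m then p.2 xi else 0) + tcoef (sval s xi) m).
  by apply/funext => xi; rewrite tcoef_cons.
apply: (@ctameD (fun xi => if p.1 == m then p.2 xi else 0)); last exact: ih.
by case: (p.1 == m) => //; exact: ctame_cst.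
Qed.

Lemma tcoef_bounded s : tame_list s ->
  exists2 A : R, 0 <= A & forall m xi, cabs (tcoef (sval s xi) m) <= A.
Proof.
elim: s => [_|p s ih /= [[[_ [B B0 pB] _] [_ [B' B'0 pB'] _]] st]].
  by exists 0 => // m xi; rewrite /tcoef big_nil cabs0.
have [A A0 sA] := ih st; exists (B + B' + A); first by rewrite !addr_ge0.
move=> m xi; rewrite tcoef_cons; apply: le_trans (cabsD _ _) _; apply: lerD => //.
case: ifP => _; last by rewrite cabs0 addr_ge0.
by apply: le_trans (cabs_le _) _; rewrite lerD.
Qed.

Lemma tcoef_lipschitz s : tame_list s ->
  exists2 L : R, 0 <= L & forall m xi eta,
    cabs (tcoef (sval s xi) m - tcoef (sval s eta) m) <= L * `|xi - eta|.
Proof.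
elim: s => [_|p s ih /= [[[_ _ [B B0 pB]] [_ _ [B' B'0 pB']]] st]].
  by exists 0 => // m xi eta; rewrite /tcoef !big_nil subrr cabs0 mul0r.
have [A A0 sA] := ih st; exists (B + B' + A); first by rewrite !addr_ge0.
move=> m xi eta; rewrite !tcoef_cons opprD addrACA; apply: le_trans (cabsD _ _) _.
rewrite mulrDl; apply: lerD => //.
case: ifP => _; last by rewrite subrr cabs0 mulr_ge0 ?addr_ge0.
apply: le_trans (cabs_le _) _; rewrite mulrDl; apply: lerD.
  by rewrite raddfB; exact: pB.
by rewrite raddfB; exact: pB'.
Qed.

Lemma symbol_cons (p : Z * (V -> C)) s q :
  symbol (p :: s) q = p.2 q.2 * expi (dotZ p.1 q.1) + symbol s q.
Proof. by rewrite /symbol /tfun /= big_cons. Qed.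

Lemma expi_int_period (m : int) (c : R) : expi (m%:~R * (2 * pi) + c) = expi c.
Proof.
rewrite /expi sin_int_period; congr (_ +i* _).
by rewrite -!sinDpihalf -addrA sin_int_period.
Qed.

Lemma dotZ_period (m k : Z) (x : V) :
  expi (dotZ m (x + (2 * pi) *: toZ R k)) = expi (dotZ m x).
Proof.
have -> : dotZ m (x + (2 * pi) *: toZ R k) =
    (\sum_i m ord0 i * k ord0 i)%:~R * (2 * pi) + dotZ m x.
  rewrite /dotZ rmorph_sum mulr_suml -big_split; apply: eq_bigr => i _.
  by rewrite !mxE rmorphM /=; ring.
exact: expi_int_period.
Qed.

Lemma dotZ_line (m : Z) (x v : V) (h : R) : dotZ m (x + h *: v) = dotZ m x + h * dotZ m v.
Proof.
rewrite /dotZ mulr_sumr -big_split; apply: eq_bigr => i _.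
by rewrite /= !mxE; ring.
Qed.

Lemma continuous_dotZ (m : Z) : continuous (fun q : V * V => dotZ m q.1 : R^o).
Proof.
apply: continuous_big => [|i _]; first exact: add_continuous.
move=> q; have h : (fun q : V * V => q.1 ord0 i : R^o) q' @[q' --> q] --> (q.1 ord0 i : R^o).
  exact: (continuous_comp (@cvg_fst _ _ _ _ _) (@continuous_coord R d i q.1)).
exact: (cvgM (cvg_cst _) h).
Qed.

Lemma smooth_dotZ (m : Z) (f : R -> R) g : tower f g -> smooth (fun q : V * V => f (dotZ m q.1) : R^o).
Proof.
move=> fg; apply: (@smooth_line_comp R _ (fun q : V * V => dotZ m q.1) (fun q : V * V => dotZ m q.1) f g) => //.
  exact: continuous_dotZ.
by move=> x v h; exact: dotZ_line.
Qed.

Lemma csmooth_symbol s : tame_list s -> csmooth (symbol s).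
Proof.
elim: s => [_|p s ih /= [[[p1 _ _] [p2 _ _]] st]].
  have -> : symbol [::] = (fun=> 0) :> (V * V -> C).
    by apply/funext => q; rewrite /symbol /tfun big_nil.
  by split; exact: smooth_cst.
have [s1 s2] := ih st.
have c := smooth_dotZ p.1 (tower_cos R); have si := smooth_dotZ p.1 (tower_sin R).
have q1 := @smooth_snd R V V _ p1; have q2 := @smooth_snd R V V _ p2.
split.
  have -> : (fun q => complex.Re (symbol (p :: s) q)) = (fun q => complex.Re (p.2 q.2) * cos (dotZ p.1 q.1) +
      -1 * (complex.Im (p.2 q.2) * sin (dotZ p.1 q.1)) + complex.Re (symbol s q)).
    by apply/funext => q; rewrite symbol_cons Re_D Re_M mulN1r.
  apply: smoothD => //; apply: smoothD; first exact: smoothM.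
  by apply: smoothM; [exact: smooth_cst|exact: smoothM].
have -> : (fun q => complex.Im (symbol (p :: s) q)) = (fun q => complex.Re (p.2 q.2) * sin (dotZ p.1 q.1) +
      complex.Im (p.2 q.2) * cos (dotZ p.1 q.1) + complex.Im (symbol s q)).
  by apply/funext => q; rewrite symbol_cons Im_D Im_M.
by apply: smoothD => //; apply: smoothD; exact: smoothM.
Qed.

Lemma Cc_infty_symbol s (M : R) : tame_list s ->
  (forall x xi, M < `|xi| -> symbol s (x, xi) = 0) -> Cc_infty (symbol s).
Proof.
move=> st s0; split; [exact: csmooth_symbol| |by exists M].
move=> k x xi; rewrite /symbol /tfun /=; apply: eq_bigr => q _.
by rewrite dotZ_period.
Qed.

Lemma tame_mean s : tame_list s -> tame_list (mean_symbol s).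
Proof. by move=> st; split => //; exact: tcoef_tame. Qed.

Lemma test_symbolI (xi0 : V) (r : R) s : tame_list s ->
  (forall xi x, 0 <= tfun (sval s xi) x /\ tfun (sval s xi) x <= 1) ->
  (forall p xi, p \in [seq (p.1, p.2 xi) | p <- s] -> r <= `|xi - xi0| -> p.2 = 0) ->
  test_symbol xi0 r s.
Proof.
move=> st s01 s0.
have t0 m xi : r <= `|xi - xi0| -> tcoef (sval s xi) m = 0.
  move=> rxi; rewrite /tcoef big_seq_cond big1 // => p /andP[ps _]; exact: s0 ps rxi.
have far (xi : V) : `|xi0| + r < `|xi| -> r <= `|xi - xi0|.
  move=> h; have := ler_normD (xi - xi0) xi0; rewrite subrK; lra.
split=> //; [split| exact: tcoef_bounded | exact: tcoef_lipschitz].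
- apply: (@Cc_infty_symbol _ (`|xi0| + r)) => // x xi /far rxi.
  by rewrite /symbol /tfun big_seq_cond big1 // => p /andP[ps _]; rewrite (s0 p xi) ?mul0r.
- apply: (@Cc_infty_symbol _ (`|xi0| + r)); first exact: tame_mean.
  by move=> x xi /far rxi; rewrite symbol_mean t0.
Qed.

End symbols.

(** Syntax for what atoms generate under [1 - f g], read as functions with values in [0, 1] or as
    sets. This one operation yields complements and products, and the syntax makes the family
    countable. *)
Inductive nand_term (A : Type) := NAtom of A | NOne | NNand of nand_term A & nand_term A.
Arguments NOne {A}.

Section nand_terms.
Variable A : countType.

Fixpoint nand_code (t : nand_term A) : GenTree.tree A :=
  match t with
  | NAtom a => GenTree.Leaf a
  | NOne => GenTree.Node 0 [::]
  | NNand t1 t2 => GenTree.Node 1 [:: nand_code t1; nand_code t2]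
  end.

Fixpoint nand_decode (t : GenTree.tree A) : nand_term A :=
  match t with
  | GenTree.Leaf a => NAtom a
  | GenTree.Node _ [:: t1; t2] => NNand (nand_decode t1) (nand_decode t2)
  | _ => NOne
  end.

Lemma nand_codeK : cancel nand_code nand_decode.
Proof. by elim=> //= t1 -> t2 ->. Qed.

(** Integers that code no term are sent to [NOne]. *)
Definition nand_enum (n : nat) : nand_term A := oapp nand_decode NOne (@choice.unpickle (GenTree.tree A) n).

Lemma nand_enum_surj t : exists n, nand_enum n = t.
Proof. by exists (choice.pickle (nand_code t)); rewrite /nand_enum choice.pickleK /= nand_codeK. Qed.

End nand_terms.

(** * Trigonometric terms and bump functions *)

Section trigonometric_terms.
Variables (R : realType) (d : nat) (q : 'rV[R]_d) (r : R).
Local Notation C := R[i].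
Local Notation V := 'rV[R]_d.
Local Notation Z := 'rV[int]_d.

(** Smooth functions with values in [0, 1] that separate the points of interest: cosine and sine
    locate a coordinate on the circle, and the sine of [xi - q] is injective in each coordinate
    within distance 1 of [q], while staying bounded. *)
Definition atom_val (a : 'I_d * 'I_3) (p : V * V) : R :=
  match nat_of_ord a.2 with
  | 0 => (1 + cos (p.1 ord0 a.1)) / 2
  | 1 => (1 + sin (p.1 ord0 a.1)) / 2
  | _ => (1 + sin (p.2 ord0 a.1 - q ord0 a.1)) / 2
  end.

Fixpoint term_val (t : nand_term ('I_d * 'I_3)) (p : V * V) : R :=
  match t with
  | NAtom a => atom_val a p
  | NOne => 1
  | NNand t1 t2 => 1 - term_val t1 p * term_val t2 p
  end.

(** Euler's formulas for [atom_val], one entry for each frequency in [x]. *)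
Definition atom_list (a : 'I_d * 'I_3) : seq (Z * (V -> C)) :=
  let e : Z := delta_mx ord0 a.1 in
  match nat_of_ord a.2 with
  | 0 => [:: (0, fun=> (1 / 2)%:C); (e, fun=> (1 / 4)%:C); (- e, fun=> (1 / 4)%:C)]
  | 1 => [:: (0, fun=> (1 / 2)%:C); (e, fun=> 0 +i* (- (1 / 4))); (- e, fun=> 0 +i* (1 / 4))]
  | _ => [:: (0, fun xi : V => ((1 + sin (xi ord0 a.1 - q ord0 a.1)) / 2)%:C)]
  end.

Fixpoint term_list (t : nand_term ('I_d * 'I_3)) : seq (Z * (V -> C)) :=
  match t with
  | NAtom a => atom_list a
  | NOne => [:: (0, fun=> 1)]
  | NNand t1 t2 => (0, fun=> 1) ::
      [seq (p1.1 + p2.1, fun xi => - 1 * (p1.2 xi * p2.2 xi)) | p1 <- term_list t1, p2 <- term_list t2]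
  end.

Lemma dotZ0 (x : V) : dotZ 0 x = 0.
Proof. by rewrite /dotZ big1 // => i _; rewrite !mxE mul0r. Qed.

Lemma dotZ_delta i (x : V) : dotZ (delta_mx ord0 i) x = x ord0 i.
Proof.
rewrite /dotZ (bigD1 i) //= big1 ?addr0; first by rewrite !mxE !eqxx mul1r.
by move=> j ji; rewrite !mxE (negbTE ji) andbF mul0r.
Qed.

Lemma symbol_atom a p : symbol (atom_list a) p = (atom_val a p)%:C.
Proof.
rewrite /atom_list /atom_val; case: (nat_of_ord a.2) => [|[|n]] /=;
  rewrite ?symbol_cons /= /symbol /tfun big_nil addr0 ?dotZN dotZ0 ?dotZ_delta.
- apply/eqP; rewrite eq_complex /= cosN sinN cos0 sin0; apply/andP; split; apply/eqP; by field.
- apply/eqP; rewrite eq_complex /= cosN sinN cos0 sin0; apply/andP; split; apply/eqP; by field.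
- by rewrite expi0 mulr1.
Qed.

Lemma symbol_cat (s1 s2 : seq (Z * (V -> C))) p : symbol (s1 ++ s2) p = symbol s1 p + symbol s2 p.
Proof. by rewrite /symbol /tfun /= /sval map_cat big_cat. Qed.

Lemma symbol_nand (s1 s2 : seq (Z * (V -> C))) p :
  symbol [seq (p1.1 + p2.1, fun xi => - 1 * (p1.2 xi * p2.2 xi)) | p1 <- s1, p2 <- s2] p =
  - (symbol s1 p * symbol s2 p).
Proof.
elim: s1 => [|p1 s1 ih] /=; first by rewrite /symbol /tfun /= !big_nil mul0r oppr0.
rewrite symbol_cat ih symbol_cons mulrDl opprD; congr (_ + _).
elim: s2 {ih} => [|p2 s2 ih] /=; first by rewrite /symbol /tfun /= !big_nil mulr0 oppr0.
rewrite !symbol_cons /= ih mulrDr opprD; congr (_ + _).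
by rewrite dotZD expiD; ring.
Qed.

Lemma symbol_term t p : symbol (term_list t) p = (term_val t p)%:C.
Proof.
elim: t => [a||t1 ih1 t2 ih2] /=; first exact: symbol_atom.
  by rewrite symbol_cons /= dotZ0 expi0 mulr1 /symbol /tfun big_nil addr0.
rewrite symbol_cons /= dotZ0 expi0 mulr1 symbol_nand ih1 ih2.
by rewrite rmorphB rmorphM rmorph1.
Qed.

Lemma half_unit (x : R) : -1 <= x <= 1 -> 0 <= (1 + x) / 2 <= 1.
Proof. by move=> /andP[a b]; apply/andP; split; lra. Qed.

Lemma term_val01 t p : 0 <= term_val t p <= 1.
Proof.
elim: t => [a||t1 /andP[a1 b1] t2 /andP[a2 b2]] /=.
- rewrite /atom_val; case: (nat_of_ord a.2) => [|[|n]]; apply: half_unit;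
    by rewrite ?cos_geN1 ?cos_le1 ?sin_geN1 ?sin_le1.
- by rewrite ler01 lexx.
- by rewrite subr_ge0 gerBl mulr_ge0 // andbT -[leRHS]mulr1 ler_pM.
Qed.

Lemma tame_coord (b c : R) i (f : R -> R) g : tower f g ->
  (exists2 B, 0 <= B & forall x, `|f x| <= B) ->
  (exists2 B, 0 <= B & forall x, `|g 1%N x| <= B) -> tame (fun xi : V => f (b * xi ord0 i + c)).
Proof.
move=> fg fB gB.
apply: (@tame_line R d (fun xi : V => b * xi ord0 i + c) (fun xi => b * xi ord0 i) `|b| f g) => //.
- by move=> x; exact: (cvgD (cvgM (cvg_cst b) (@continuous_coord R d i x)) (cvg_cst c)).
- by move=> x v h; rewrite !mxE; ring.
- move=> x y; have -> : b * x ord0 i + c - (b * y ord0 i + c) = b * (x - y) ord0 i by rewrite !mxE; ring.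
  by rewrite normrM ler_wpM2l // coord_le_norm.
Qed.

Lemma sin_bound : exists2 B : R, 0 <= B & forall x, `|sin x| <= B.
Proof. by exists 1 => // x; rewrite ler_norml sin_geN1 sin_le1. Qed.

Lemma tame_term t : tame_list (term_list t).
Proof.
elim: t => [a||t1 ih1 t2 ih2] /=.
- rewrite /atom_list; case: (nat_of_ord a.2) => [|[|n]] /=.
  + by split; [exact: ctame_cst|split; [exact: ctame_cst|split; [exact: ctame_cst|]]].
  + by split; [exact: ctame_cst|split; [exact: ctame_cst|split; [exact: ctame_cst|]]].
  split => //; split; last exact: tame_cst.
  have t1 : tame (fun xi : V => sin (1 * xi ord0 a.1 + - q ord0 a.1)).
    apply: tame_coord (tower_sin R) _ _; first exact: sin_bound.
    by have [B B0 sB] := sin_bound; exists B => // x; exact: sB.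
  rewrite (_ : (fun x : V => _) = (fun xi : V => 2^-1 * (1 + sin (1 * xi ord0 a.1 + - q ord0 a.1)))).
    exact: (tameM (tame_cst _ _) (tameD (tame_cst _ _) t1)).
  by apply/funext => x /=; rewrite mul1r mulrC.
- by split => //; exact: ctame_cst.
- split; first exact: ctame_cst.
  elim: (term_list t1) ih1 => [|p1 s1 ih] //= [p1t s1t].
  have cat s s' : tame_list s -> tame_list s' -> tame_list (s ++ s' : seq (Z * (V -> C))).
    by elim: s => [|p s ihs] //= [pt st] s't; split => //; exact: ihs.
  apply: cat; last exact: ih.
  elim: (term_list t2) ih2 => [|p2 s2 ih'] //= [p2t s2t]; split; last exact: ih'.
  by apply: ctameM; [exact: ctame_cst|exact: ctameM].
Qed.

(** One factor for each face of the cube of half-side [r] around [q], which is the ball of the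
    supremum norm; the product is positive exactly inside. *)
Definition bump (xi : V) : R :=
  \prod_i (flat 1 (-1 * xi ord0 i + (q ord0 i + r)) * flat 1 (1 * xi ord0 i + (r - q ord0 i))).

Lemma flat1_ge0 (x : R) : 0 <= flat 1 x.
Proof. by rewrite /flat; case: ifP => // _; rewrite hornerE mul1r expR_ge0. Qed.

Lemma flat1_le1 (x : R) : flat 1 x <= 1.
Proof.
rewrite /flat; case: ifP => // x0; rewrite hornerE mul1r -[leRHS]expR0 ler_expR.
by rewrite oppr_le0 invr_ge0 ltW.
Qed.

Lemma flat1_gt0 (x : R) : 0 < x -> 0 < flat 1 x.
Proof. by move=> x0; rewrite /flat x0 hornerE mul1r expR_gt0. Qed.

Lemma bump01 xi : 0 <= bump xi <= 1.
Proof.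
rewrite /bump; elim/big_ind: _ => [|x y /andP[x0 x1] /andP[y0 y1]|i _]; first by rewrite ler01 lexx.
  by rewrite mulr_ge0 //= -[leRHS]mulr1 ler_pM.
by rewrite mulr_ge0 ?flat1_ge0 //= -[leRHS]mulr1 ler_pM ?flat1_ge0 ?flat1_le1.
Qed.

Hypothesis r_gt0 : 0 < r.

Lemma bump_gt0 xi : `|xi - q| < r -> 0 < bump xi.
Proof.
move=> xr; apply: prodr_gt0 => i _.
have := le_lt_trans (coord_le_norm (xi - q) i) xr; rewrite !mxE ltr_norml => /andP[a b].
by rewrite mulr_gt0 // flat1_gt0 //; lra.
Qed.

Lemma bump_out xi : r <= `|xi - q| -> bump xi = 0.
Proof.
move=> xr; have [i ir] : exists i, r <= `|(xi - q) ord0 i|.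
  apply: contrapT => no; move: xr; apply/negP; rewrite -ltNge.
  rewrite [ltLHS]mx_normrE; apply: bigmax_lt => // -[a i] _ /=.
  by rewrite (ord1 a) ltNge; apply/negP => h; apply: no; exists i.
rewrite /bump (bigD1 i) //=; move: ir; rewrite !mxE ler_normr => /orP[h|h].
  rewrite (_ : flat 1 (-1 * _ + _) = 0) ?mul0r //.
  by rewrite /flat ifF //; apply/negbTE; rewrite -leNgt; lra.
rewrite (_ : flat 1 (1 * _ + _) = 0) ?mulr0 ?mul0r //.
by rewrite /flat ifF //; apply/negbTE; rewrite -leNgt; lra.
Qed.

Lemma tame_bump : tame bump.
Proof.
rewrite /bump; elim: (index_enum _) => [|i s ih].
  by rewrite (_ : (fun x => _) = fun=> 1); [exact: tame_cst|apply/funext => x; rewrite big_nil].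
rewrite (_ : (fun x => _) = fun xi : V =>
  (flat 1 (-1 * xi ord0 i + (q ord0 i + r)) * flat 1 (1 * xi ord0 i + (r - q ord0 i))) *
  \prod_(j <- s) (flat 1 (-1 * xi ord0 j + (q ord0 j + r)) * flat 1 (1 * xi ord0 j + (r - q ord0 j)))); last first.
  by apply/funext => x; rewrite big_cons.
have tc (b c : R) : tame (fun xi : V => flat 1 (b * xi ord0 i + c)).
  by apply: (tame_coord _ _ _ (tower_flat 1)); exact: flat_le.
exact: (tameM (tameM (tc _ _) (tc _ _)) ih).
Qed.

Definition sym_list t : seq (Z * (V -> C)) :=
  [seq (p.1, fun xi => (bump xi)%:C * p.2 xi) | p <- term_list t].

Lemma symbol_sym t p : symbol (sym_list t) p = (bump p.2 * term_val t p)%:C.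
Proof.
rewrite rmorphM /= -symbol_term /sym_list; elim: (term_list t) => [|a s ih] /=.
  by rewrite /symbol /tfun !big_nil mulr0.
by rewrite !symbol_cons /= ih mulrDr mulrA.
Qed.

Lemma test_symbol_sym t : test_symbol q r (sym_list t).
Proof.
apply: test_symbolI.
- rewrite /sym_list; elim: (term_list t) (tame_term t) => [|a s ih] //= [at_ st].
  split; last exact: ih.
  by apply: ctameM => //; split; [exact: tame_bump|exact: tame_cst].
- move=> xi x; have := symbol_sym t (x, xi); rewrite /symbol /= => ->.
  have /andP[b0 b1] := bump01 xi; have /andP[t0 t1] := term_val01 t (x, xi).
  rewrite -(rmorph0 (real_complex R)) -(rmorph1 (real_complex R)) !lecR.
  by rewrite mulr_ge0 // -[leRHS]mulr1 ler_pM.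
- move=> p xi ps rxi; move: ps; rewrite /sym_list -map_comp => /mapP[a _ ->] /=.
  by rewrite bump_out // mul0r.
Qed.

End trigonometric_terms.

(** * From test symbols to Borel sets *)

Section nand_closure.
Variables (R : realType) (dT : measure_display) (T : measurableType dT).
Variables (S : set T) (base : (T -> R) -> Prop).

(* Functions are only controlled on [S]; the values elsewhere are irrelevant. *)
Inductive nand_closure : (T -> R) -> Prop :=
| nand_base f : base f -> nand_closure f
| nand_limit (f : T -> R) (g : nat -> T -> R) : (forall n, nand_closure (g n)) ->
    measurable_fun setT f -> (forall x, 0 <= f x <= 1) ->
    (forall x, S x -> g n x @[n --> \oo] --> f x) -> nand_closure f.

Definition unit_valued (f : T -> R) : Prop := measurable_fun setT f /\ forall x, 0 <= f x <= 1.

Hypothesis base_unit : forall f, base f -> unit_valued f.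
Hypothesis base_one : base (fun=> 1).
Hypothesis base_nand : forall f g, base f -> base g -> base (fun x => 1 - f x * g x).

Lemma nand_unit f : nand_closure f -> unit_valued f.
Proof. by case=> [? /base_unit|? ? _ ? ?]. Qed.

Lemma unit_nand f g : unit_valued f -> unit_valued g -> unit_valued (fun x => 1 - f x * g x).
Proof.
move=> [mf f01] [mg g01]; split.
  by apply: measurable_funB; [exact: measurable_cst|exact: measurable_funM].
move=> x; have /andP[f0 f1] := f01 x; have /andP[g0 g1] := g01 x.
by rewrite subr_ge0 gerBl mulr_ge0 // andbT -[leRHS]mulr1 ler_pM.
Qed.

(** Induction on [f] with an inner induction on [g]; the operation is continuous, so limits pass
    through it one argument at a time. *)
Lemma nand_closed f g : nand_closure f -> nand_closure g -> nand_closure (fun x => 1 - f x * g x).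
Proof.
have half f' g' : base f' -> nand_closure g' -> nand_closure (fun x => 1 - f' x * g' x).
  move=> bf; elim=> [h bh|h k _ ih mh h01 kh]; first by apply: nand_base; exact: base_nand.
  have [m1 m2] : unit_valued (fun x => 1 - f' x * h x) by apply: unit_nand => //; exact: base_unit.
  apply: (nand_limit ih) => // x Sx.
  by apply: cvgB; [exact: cvg_cst|apply: cvgM; [exact: cvg_cst|exact: kh]].
move=> cf cg; elim: cf => [h bh|h k _ ih mh h01 kh]; first exact: half.
have [m1 m2] : unit_valued (fun x => 1 - h x * g x) by apply: unit_nand => //; exact: nand_unit.
apply: (nand_limit ih) => // x Sx.
by apply: cvgB; [exact: cvg_cst|apply: cvgM; [exact: kh|exact: cvg_cst]].
Qed.

Lemma nand_one : nand_closure (fun=> 1).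
Proof. exact: nand_base. Qed.

Lemma nand_compl f : nand_closure f -> nand_closure (fun x => 1 - f x).
Proof.
move=> cf; have := nand_closed cf nand_one.
by under [X in nand_closure X]eq_fun do rewrite mulr1.
Qed.

Lemma nand_mul f g : nand_closure f -> nand_closure g -> nand_closure (fun x => f x * g x).
Proof.
move=> cf cg; have := nand_compl (nand_closed cf cg).
by under [X in nand_closure X]eq_fun do rewrite subKr.
Qed.

Lemma nand_exp f n : nand_closure f -> nand_closure (fun x => f x ^+ n).
Proof.
move=> cf; elim: n => [|n ih].
  by under [X in nand_closure X]eq_fun do rewrite expr0; exact: nand_one.
by under [X in nand_closure X]eq_fun do rewrite exprS; exact: nand_mul.
Qed.

Definition nand_set (E : set T) := nand_closure (\1_E).

Lemma nand_set_compl E : nand_set E -> nand_set (~` E).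
Proof.
move=> /nand_compl; rewrite /nand_set; congr nand_closure; apply/funext => x.
by rewrite !indicE in_setC; case: (x \in E); rewrite ?subrr ?subr0.
Qed.

Lemma nand_setI E F : nand_set E -> nand_set F -> nand_set (E `&` F).
Proof.
move=> cE cF; have := nand_mul cE cF; rewrite /nand_set; congr nand_closure; apply/funext => x.
by rewrite !indicE in_setI; case: (x \in E); case: (x \in F); rewrite /= ?mulr1 ?mulr0 ?mul0r.
Qed.

Lemma nand_setT : nand_set setT.
Proof. by rewrite /nand_set indicT; exact: nand_one. Qed.

Lemma nand_set_measurable E : nand_set E -> measurable E.
Proof.
move=> /nand_unit[mE _]; have := mE measurableT [set 1] (measurable_set1 1).
rewrite setTI; congr measurable; apply/seteqP; split => x /=; rewrite indicE.
  by case: (boolP (x \in E)) => [/set_mem //|_ /eqP]; rewrite eq_sym oner_eq0.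
by move=> /mem_set ->.
Qed.

(** The indicators of the finite intersections converge pointwise. *)
Lemma nand_bigcap (F : nat -> set T) : (forall n, nand_set (F n)) -> nand_set (\bigcap_n F n).
Proof.
move=> cF; pose G n := \bigcap_(i in [set k | (k < n)%N]) F i.
have cG n : nand_set (G n).
  elim: n => [|n ih].
    rewrite /G; have -> : [set k | (k < 0)%N] = set0 by apply/seteqP; split => k.
    by rewrite bigcap_set0; exact: nand_setT.
  have -> : G n.+1 = G n `&` F n.
    apply/seteqP; split => x /=.
      by move=> h; split => [i /= ni|]; apply: h => /=; [exact: leqW|].
    by move=> [h1 h2] i /=; rewrite ltnS leq_eqVlt => /orP[/eqP ->|]; [|exact: h1].
  exact: nand_setI.
have mI : measurable (\bigcap_n F n).
  by apply: bigcapT_measurable => n; exact: nand_set_measurable.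
apply: (@nand_limit _ (fun n => \1_(G n))) => //.
- by move=> x; rewrite indicE; case: (_ \in _); rewrite /= ?lexx ler01.
- move=> x _; have [xF|xF] := pselect (forall n, F n x).
    have -> : \1_(\bigcap_n F n) x = 1 :> R by rewrite indicE mem_set // => n _; exact: xF.
    have -> : (fun n => \1_(G n) x) = fun=> 1 :> R; last exact: cvg_cst.
    by apply/funext => n; rewrite indicE mem_set // => i _; exact: xF.
  have [N NP] : exists N, ~ F N x by apply/existsNP.
  have -> : \1_(\bigcap_n F n) x = 0 :> R by rewrite indicE memNset // => h; apply: NP; exact: h.
  apply: cvg_near_cst; exists N.+1 => // n /= Nn.
  by rewrite indicE memNset // => h; apply: NP; exact: h.
Qed.

Lemma nand_sigma_algebra : sigma_algebra setT nand_set.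
Proof.
split.
- by rewrite -setCT; apply: nand_set_compl; exact: nand_setT.
- by move=> A cA; rewrite setTD; exact: nand_set_compl.
- move=> F cF; rewrite -[\bigcup_n _]setCK setC_bigcup; apply: nand_set_compl.
  by apply: nand_bigcap => n; exact: nand_set_compl.
Qed.

(** A constant sequence is a legitimate approximation of any indicator that agrees with it on
    [S]. *)
Lemma nand_set_on E F : nand_set E -> measurable F -> (forall x, S x -> E x <-> F x) -> nand_set F.
Proof.
move=> cE mF EF; apply: (@nand_limit _ (fun=> \1_E)) => //.
- by move=> x; rewrite indicE; case: (_ \in _); rewrite /= ?lexx ler01.
- move=> x Sx; have -> : \1_F x = \1_E x :> R; last exact: cvg_cst.
  rewrite !indicE; congr (_ %:R); congr nat_of_bool.
  by apply/idP/idP => /set_mem/(EF x Sx)/mem_set.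
Qed.

End nand_closure.

(** * From integrals over intervals to almost every time *)

Section interval_averages.
Variable R : realType.
Local Notation leb := (@lebesgue_measure R).

(** At a Lebesgue point, divide by the length of the interval: the quadratic term vanishes whatever
    the size of [B], which may therefore depend on the symbol. *)
Lemma ae_le_of_interval_integrals (f : R -> R) (a b c B F : R) :
  measurable_fun setT (f : measurableTypeR R -> R) -> (forall x, `|f x| <= F) ->
  (forall x y, a <= x -> x < y -> y <= b ->
    \int[leb]_(t in `[x, y]) f t <= (y - x) * c + B * (y - x) ^+ 2) ->
  {ae leb, forall t, a < t < b -> f t <= c}.
Proof.
move=> mf fF fI.
have F0 : 0 <= F by apply: le_trans (normr_ge0 _) (fF 0).
have ifin (D : set R) : measurable D -> (leb D < +oo)%E -> leb.-integrable D (EFin \o f).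
  move=> mD lD; apply: measurable_bounded_integrable => //.
    exact: measurable_funS mf.
  by exists F; split=> [|N FN x _ /=]; rewrite ?num_real // (le_trans (fF x)) // ltW.
have iab x y : leb.-integrable `[x, y] (EFin \o f).
  apply: ifin => //; rewrite lebesgue_measure_itv /=; case: ifP => _; rewrite ?ltry //.
have loc : locally_integrable setT f.
  split=> //; first exact: openT.
  move=> K _ cK; have mK : measurable K by exact: closed_measurable (compact_closed (@Rhausdorff R) cK).
  have := ifin K mK (compact_finite_measure cK).
  by move=> /integrableP[].
apply: ae_imply (lebesgue_differentiation loc) => t0; set t : R := t0 => lt /andP[at_ tb].
have [||dF F'] := @FTC1_lebesgue_pt R f (BLeft a) t b tb (iab a b) => //.
rewrite -F' derive1E.
have key : ((fun h : R => h^-1 *: (((fun y : R => \int[leb]_(t in `[a, y]) f t) \o shift t) (h *: 1)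
    - \int[leb]_(t in `[a, t]) f t)) @ (0 : R)^'+) --> 'D_1 (fun y : R => \int[leb]_(t in `[a, y]) f t) t.
  by apply: cvg_dnbhs_at_right; exact: dF.
have up : (fun h : R => c + B * h) @ (0 : R)^'+ --> c.
  have : (fun h : R => c + B * h) @ (0 : R) --> c + B * 0.
    by apply: cvgD; [exact: cvg_cst|apply: cvgM; [exact: cvg_cst|exact: cvg_id]].
  by rewrite mulr0 addr0; exact: cvg_at_right_filter.
apply: (ler_cvg_to key up).
near=> h.
have h0 : 0 < h by near: h; exact: nbhs_right_gt.
have hb : t + h <= b.
  rewrite -lerBrDl; near: h; apply: nbhs_right_le; by rewrite subr_gt0.
rewrite /= [h *: 1]mulr1 [h + t]addrC [_ *: _]mulrC ler_pdivrMr //.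
have -> : \int[leb]_(s in `[a, (t + h)]) f s - \int[leb]_(s in `[a, t]) f s = \int[leb]_(s in `[t, (t + h)]) f s.
  rewrite (@Rintegral_itvB _ f (BLeft a) (BRight (t + h)) t) //.
    rewrite Rintegral_itv_obnd_cbnd //.
    by apply: integrableS (iab t (t + h)) => //; exact: subset_itv_oc_cc.
  by rewrite bnd_simp ltW.
  by rewrite bnd_simp lerDl ltW.
apply: le_trans (fI t (t + h) (ltW at_) _ hb) _; first by rewrite ltrDl.
by rewrite le_eqVlt; apply/orP; left; apply/eqP; ring.
Unshelve. all: by end_near.
Qed.

(** The line is covered by countably many intervals of length [delta], whose left ends are the
    multiples of [delta / 2]. *)
Lemma ae_of_intervals (P : R -> Prop) (delta : R) : 0 < delta ->
  (forall a, {ae leb, forall t, a < t < a + delta -> P t}) -> {ae leb, forall t, P t}.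
Proof.
move=> d0 Pa; have d2 : 0 < delta / 2 by rewrite divr_gt0.
pose q (n : nat) : R := oapp (fun z : int => z%:~R * (delta / 2)) 0 (@choice.unpickle int n).
have := ae_foralln (fun n => Pa (q n)); apply: ae_imply => t tP.
(* One less than the floor, so that [t] is strictly inside the interval even when it is a multiple
   of [delta / 2]. *)
pose z : int := Num.floor (t / (delta / 2)) - 1.
have := tP (choice.pickle z); apply; rewrite /q choice.pickleK /=.
have h1 := floor_le (t / (delta / 2)); have h2 := floorD1_gt (t / (delta / 2)).
move: h1 h2; rewrite ler_pdivlMr // ltr_pdivrMr // /z intrB rmorph1 intrD rmorph1 => h1 h2.
by apply/andP; split; lra.
Qed.

Lemma ae_forall_countable dT (T : measurableType dT) (m : {measure set T -> \bar R}) (A : Type)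
    (e : nat -> A) (P : A -> T -> Prop) : (forall a, exists n, e n = a) ->
  (forall a, {ae m, forall t, P a t}) -> {ae m, forall t, forall a, P a t}.
Proof.
move=> eS Pa; apply: ae_imply (ae_foralln (fun n => Pa (e n))) => t tP a.
by have [n <-] := eS a.
Qed.

Lemma measurable_Rintegral_kernel dX dY (X : measurableType dX) (Y : measurableType dY)
    (k : R.-fker X ~> Y) (f : Y -> R) (F : R) :
  measurable_fun setT f -> (forall y, 0 <= f y <= F) ->
  measurable_fun setT (fun x => \int[k x]_y f y).
Proof.
move=> mf f0; apply: measurableT_comp => //.
apply: (@measurable_fun_integral_kernel _ _ _ _ _ (fun x => k x)).
- by move=> U mU; exact: measurable_kernel.
- by move=> y; rewrite lee_fin; case/andP: (f0 y).
- by apply/measurable_EFinP.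
Qed.

End interval_averages.

(** * Superlevel sets, and stability of inequalities under limits *)

Section nand_consequences.
Variables (R : realType) (dT : measure_display) (T : measurableType dT).
Variables (S : set T) (base : (T -> R) -> Prop).
Hypothesis base_unit : forall f, base f -> unit_valued f.
Hypothesis base_one : base (fun=> 1).
Hypothesis base_nand : forall f g, base f -> base g -> base (fun x => 1 - f x * g x).
Local Notation cl := (nand_closure S base).

(** Bernoulli's inequality for [1 + y], together with [(1 - y) * (1 + y) <= 1]. *)
Lemma pow_one_sub_le (y : R) m : 0 <= y <= 1 -> (1 - y) ^+ m * (1 + m%:R * y) <= 1.
Proof.
move=> /andP[y0 y1]; have b : 1 + m%:R * y <= (1 + y) ^+ m.
  elim: m => [|m ih]; first by rewrite mul0r addr0 expr0.
  rewrite exprS -natr1 mulrDl mul1r; apply: le_trans (ler_wpM2l _ ih); last by rewrite addr_ge0.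
  have : 0 <= m%:R * y * y by rewrite !mulr_ge0.
  by lra.
apply: (@le_trans _ _ ((1 - y) ^+ m * (1 + y) ^+ m)).
  by rewrite ler_wpM2l // exprn_ge0 // subr_ge0.
by rewrite -exprMn exprn_ile1 //; nra.
Qed.

Lemma pow_one_sub_ge (y : R) m : 0 <= y <= 1 -> 1 - m%:R * y <= (1 - y) ^+ m.
Proof.
move=> /andP[y0 y1]; elim: m => [|m ih]; first by rewrite mul0r subr0 expr0.
rewrite exprS -natr1 mulrDl mul1r; apply: le_trans (ler_wpM2l _ ih); last by rewrite subr_ge0.
have : 0 <= m%:R * y * y by rewrite !mulr_ge0.
by lra.
Qed.

Lemma cvg_of_harmonic (u : nat -> R) (l K : R) : 0 <= K ->
  (forall n, `|u n - l| <= K / n.+1%:R) -> u n @[n --> \oo] --> l.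
Proof.
move=> K0 uK; apply/cvgrPdist_le => e e0; exists (Num.trunc (K / e)) => // n /= nN.
rewrite distrC; apply: le_trans (uK n) _; rewrite ler_pdivrMr ?ltr0n // mulrC -ler_pdivrMr //.
by apply: le_trans (ltW (truncnS_gt _)) _; rewrite ler_nat.
Qed.

(* [1 - (1 - f^n)^m] with [m ~ c^-n / n] tends to the indicator of [f > c], since
   [m f^n] tends to infinity for [f > c] and to [0] for [f <= c]. *)
Lemma nand_superlevel (f : T -> R) (c : R) : cl f -> 0 < c -> nand_set S base [set x | c < f x].
Proof.
move=> cf c0; have [mf f01] := nand_unit base_unit cf.
pose m n := Num.trunc (c ^- n.+1 / n.+1%:R).
have cn n : 0 < c ^+ n.+1 by rewrite exprn_gt0.
have mle n : (m n)%:R <= c ^- n.+1 / n.+1%:R.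
  by rewrite truncn_le divr_ge0 // invr_ge0 ltW.
have mgt n : c ^- n.+1 / n.+1%:R <= (m n)%:R + 1.
  by rewrite natr1 ltW // truncnS_gt.
pose h n x := 1 - (1 - f x ^+ n.+1) ^+ m n.
have ch n : cl (h n).
  by do 2!(apply: (nand_compl base_unit base_one base_nand); apply: (nand_exp base_unit base_one base_nand)).
have y01 n x : 0 <= f x ^+ n.+1 <= 1.
  by have /andP[f0 f1] := f01 x; rewrite exprn_ge0 // exprn_ile1.
have mS : measurable [set x | c < f x].
  rewrite -[X in measurable X]setTI (_ : [set x | _] = f @^-1` `]c, +oo[); first exact: mf.
  by apply/seteqP; split => x /=; rewrite in_itv /= andbT.
apply: (nand_limit (g := h) ch) => //.
  by move=> x; rewrite indicE; case: (_ \in _); rewrite /= ?lexx ler01.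
move=> x _; have /andP[f0 f1] := f01 x; have [fc|cf'] := leP (f x) c.
  have -> : \1_[set x | c < f x] x = 0 :> R by rewrite indicE memNset //= => /(le_lt_trans fc); rewrite ltxx.
  apply: (@cvg_of_harmonic _ _ 1) => // n; rewrite subr0 /h.
  have g := pow_one_sub_ge (m n) (y01 n x); have /andP[y0 y1] := y01 n x.
  have e1 : (1 - f x ^+ n.+1) ^+ m n <= 1 by rewrite exprn_ile1 ?subr_ge0 // gerBl.
  rewrite ger0_norm ?subr_ge0 //; apply: (@le_trans _ _ ((m n)%:R * f x ^+ n.+1)); first lra.
  apply: le_trans (ler_wpM2r y0 (mle n)) _; rewrite mulrAC ler_wpM2r ?invr_ge0 //.
  by rewrite mulrC ler_pdivrMr // mul1r ler_pXn2r // nnegrE ltW.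
have -> : \1_[set x | c < f x] x = 1 :> R by rewrite indicE mem_set.
have q1 : 1 < f x / c by rewrite ltr_pdivlMr // mul1r.
(* The square root doubles the exponent: [(f x / c) ^+ n.+1] is the square of [s ^+ n.+1], at least
   [(n.+1 * a) ^+ 2] by Bernoulli's inequality, and this still grows linearly after the division by
   [n.+1] in [m n]. *)
pose s := Num.sqrt (f x / c); pose a := s - 1.
have s2 : s ^+ 2 = f x / c by rewrite sqr_sqrtr // ltW // (lt_trans ltr01).
have s1 : 1 < s by rewrite -(@ltr_pXn2r _ 2) ?nnegrE ?sqrtr_ge0 // expr1n s2.
have a0 : 0 < a by rewrite subr_gt0.
have a2 : 0 < a ^+ 2 by rewrite exprn_gt0.
apply: (@cvg_of_harmonic _ _ (a ^- 2)); first by rewrite invr_ge0 ltW.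
move=> n; rewrite /h addrAC subrr add0r normrN.
have /andP[y0 y1] := y01 n x; set y := f x ^+ n.+1 in y0 y1 *.
have e0 : 0 <= (1 - y) ^+ m n by rewrite exprn_ge0 // subr_ge0.
rewrite ger0_norm //.
have grow : n.+1%:R * a ^+ 2 <= 1 + (m n)%:R * y.
  have b : 1 + n.+1%:R * a <= s ^+ n.+1.
    elim: (n.+1) => [|k ih]; first by rewrite mul0r addr0 expr0.
    rewrite exprS -natr1 mulrDl mul1r; apply: le_trans (ler_wpM2l _ ih); last by rewrite ltW // (lt_trans ltr01).
    have -> : s = 1 + a by rewrite /a addrC subrK.
    have : 0 <= k%:R * a * a by rewrite !mulr_ge0 // ltW.
    by lra.
  have b2 : (n.+1%:R * a) ^+ 2 <= y * c ^- n.+1.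
    rewrite -exprVn -exprMn -s2 -exprM mulnC exprM ler_pXn2r ?nnegrE ?mulr_ge0 ?(ltW a0) //.
      by apply: le_trans b; rewrite lerDr.
    by rewrite exprn_ge0 // ltW // (lt_trans ltr01).
  have b3 : (c ^- n.+1 / n.+1%:R) * y <= (m n)%:R * y + y by rewrite -[X in _ + X]mul1r -mulrDl ler_wpM2r.
  have b4 : n.+1%:R * a ^+ 2 <= (c ^- n.+1 / n.+1%:R) * y.
    rewrite mulrAC ler_pdivlMr ?ltr0n // [leRHS]mulrC; apply: le_trans b2.
    by rewrite exprMn expr2 mulrAC.
  apply: le_trans b4 _; apply: le_trans b3 _; rewrite addrC lerD2r //.
rewrite ler_pdivlMr ?ltr0n //; rewrite -(ler_pM2r a2) mulVf ?gt_eqF // -mulrA.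
apply: le_trans (pow_one_sub_le (m n) (y01 n x)); rewrite -/y.
by rewrite ler_wpM2l.
Qed.

(** The sets [B] with this property form a sigma-algebra, so the rays []c, +oo[] suffice. As [f] is
    nonnegative, the preimage is everything for [c < 0], and a countable union of superlevel sets at
    positive heights for [c = 0]. *)
Lemma nand_preimage (f : T -> R) (B : set R) : cl f -> measurable B -> nand_set S base (f @^-1` B).
Proof.
move=> cf mB; have [mf f01] := nand_unit base_unit cf.
have sa := nand_sigma_algebra S base_unit base_one base_nand.
have [s0 sC sU] := sa.
pose G : set (set R) := [set A | nand_set S base (f @^-1` A)].
have saG : sigma_algebra setT G.
  split.
  - by rewrite /G /= preimage_set0.
  - by move=> A GA; rewrite /G /= setTD preimage_setC -setTD; exact: sC.
  - by move=> F GF; rewrite /G /= preimage_bigcup; exact: sU.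
have mB' := eq_ind _ (fun N : set (set R) => N B) mB _ (RGenOInfty.measurableE R).
suff sub : <<s @RGenOInfty.G R >> `<=` G by exact: sub mB'.
apply: smallest_sub => // _ [c ->]; rewrite /G /=.
have pos (b : R) : 0 < b -> nand_set S base (f @^-1` `]b, +oo[).
  move=> b0; rewrite (_ : f @^-1` _ = [set x | b < f x]); first exact: nand_superlevel.
  by apply/seteqP; split => x /=; rewrite in_itv /= andbT.
have [c0|c0|c0] := ltrgt0P c; first exact: pos.
  rewrite (_ : f @^-1` _ = setT); last first.
    apply/seteqP; split => x //= _; rewrite in_itv /= andbT (lt_le_trans c0) //.
    by case/andP: (f01 x).
  exact: nand_setT.
rewrite (_ : f @^-1` _ = \bigcup_n f @^-1` `](n.+1%:R^-1 : R), +oo[).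
  by apply: sU => n; apply: pos; rewrite invr_gt0.
apply/seteqP; split => x /=.
  rewrite in_itv /= andbT c0 => fx; exists (Num.trunc (f x)^-1) => //=.
  by rewrite in_itv /= andbT invf_plt ?posrE ?ltr0n // truncnS_gt.
move=> [n _ /=]; rewrite !in_itv /= !andbT c0; apply: lt_trans.
by rewrite invr_gt0.
Qed.

(** An inequality between functionals that are continuous under the admissible limits passes from
    the generators to the closure. For this, [K] and [e] have to be common to all generators. *)
Lemma nand_inequality (I1 I2 : (T -> R) -> R) (K e : R) :
  (forall f g, (forall n, unit_valued (g n)) -> unit_valued f ->
    (forall x, S x -> g n x @[n --> \oo] --> f x) ->
    I1 (g n) @[n --> \oo] --> I1 f /\ I2 (g n) @[n --> \oo] --> I2 f) ->
  (forall f, base f -> I1 f <= K * I2 f + e) -> forall f, cl f -> I1 f <= K * I2 f + e.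
Proof.
move=> cont bI f; elim=> [g|g k ck ih mg g01 kg]; first exact: bI.
have uk n : unit_valued (k n) by apply: (nand_unit base_unit (ck n)).
have [c1 c2] := cont g k uk (conj mg g01) kg.
apply: (ler_cvg_to c1 (_ : K * I2 (k n) + e @[n --> \oo] --> _)); last by apply: nearW => n; exact: ih.
by apply: cvgD; [apply: cvgM; [exact: cvg_cst|exact: c2]|exact: cvg_cst].
Qed.

End nand_consequences.

Section bounded_convergence.
Variables (R : realType) (dT : measure_display) (T : measurableType dT).

(** Dominated convergence: pointwise convergence is known on [S] only, and almost everywhere outside
    the weight vanishes. *)
Lemma weighted_convergence (m : {measure set T -> \bar R}) (S : set T) (w f : T -> R) (g : nat -> T -> R) :
  m.-integrable setT (EFin \o w) ->
  {ae m, forall x, S x \/ w x = 0} ->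
  (forall n, unit_valued (g n)) -> unit_valued f ->
  (forall x, S x -> g n x @[n --> \oo] --> f x) ->
  \int[m]_x (w x * g n x) @[n --> \oo] --> \int[m]_x (w x * f x).
Proof.
move=> iw Sw ug [mf f01] gf.
have mw : measurable_fun setT w by move/integrableP: iw => [/measurable_EFinP].
have [|||||/= ic _ cv] := @dominated_convergence _ _ _ m _ measurableT
  (fun n x => (w x * g n x)%:E) (fun x => (w x * f x)%:E) (fun x => `|(w x)%:E|%E).
- by move=> n; apply/measurable_EFinP; apply: measurable_funM => //; case: (ug n).
- by apply/measurable_EFinP; exact: measurable_funM.
- move: Sw; apply: filterS => x Sx _; apply: cvg_EFin; first by near=> n.
  case: Sx => [Sx|->]; first by apply: cvgM; [exact: cvg_cst|exact: gf].
  by rewrite mul0r; under eq_fun do rewrite mul0r; exact: cvg_cst.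
- exact: integrable_abse.
- apply: aeW => x n _ /=; rewrite lee_fin normrM -[leRHS]mulr1 ler_wpM2l //.
  by case: (ug n) => _ /(_ x) /andP[g0 g1]; rewrite ger0_norm.
rewrite /Rintegral; apply: fine_cvg; rewrite fineK //.
by apply: integrable_fin_num.
Unshelve. all: by end_near.
Qed.

End bounded_convergence.

(** * Generation of the Borel sets by half-spaces *)

Section coordinate_sigma_algebras.
Variables (R : realType) (d : nat).
Local Notation V := 'rV[R]_d.

Lemma real_sigma_algebra (M : set (set R)) : sigma_algebra setT M ->
  (forall c : R, M [set x | x <= c]) -> measurable `<=` M.
Proof.
move=> saM Mc B mB; have [_ MC _] := saM.
have := eq_ind _ (fun N : set (set R) => N B) mB _ (RGenOInfty.measurableE R).
apply: smallest_sub => // _ [c ->]; have := MC _ (Mc c); congr M.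
apply/seteqP; split => x /=; first by move=> [_ /negP]; rewrite -ltNge in_itv /= andbT.
by rewrite in_itv /= andbT => cx; split=> //; apply/negP; rewrite -ltNge.
Qed.

Lemma preimage_sigma_algebra (T U : Type) (f : T -> U) (M : set (set T)) :
  sigma_algebra setT M -> sigma_algebra setT [set A | M (f @^-1` A)].
Proof.
move=> [M0 MC MU]; split => /=.
- by rewrite preimage_set0.
- by move=> A MA; rewrite setTD preimage_setC -setTD; exact: MC.
- by move=> F MF; rewrite preimage_bigcup; exact: MU.
Qed.

Lemma row_sigma_algebra (M : set (set V)) : sigma_algebra setT M ->
  (forall i (c : R), M [set x | x ord0 i <= c]) -> measurable `<=` M.
Proof.
move=> saM Mc; apply: smallest_sub => // _ [i [j [A [mA ->]]]].
rewrite (ord1 i); have sa := preimage_sigma_algebra (fun x : V => x ord0 j) saM.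
exact: (real_sigma_algebra sa (fun c => Mc j c) mA).
Qed.

Lemma pair_sigma_algebra (M : set (set (V * V))) : sigma_algebra setT M ->
  (forall i (c : R), M [set p : V * V | p.1 ord0 i <= c]) ->
  (forall i (c : R), M [set p : V * V | p.2 ord0 i <= c]) -> measurable `<=` M.
Proof.
move=> saM M1 M2; apply: smallest_sub => // A [[B mB <-]|[B mB <-]]; rewrite setTI.
- exact: (row_sigma_algebra (preimage_sigma_algebra fst saM) M1 mB).
- exact: (row_sigma_algebra (preimage_sigma_algebra snd saM) M2 mB).
Qed.

End coordinate_sigma_algebras.

Section indicator_terms.
Variables (R : realType) (dT : measure_display) (T : measurableType dT) (A : Type).
Variable X : A -> T -> R.
Hypothesis mX : forall a, measurable_fun setT (X a).

(** Finite Boolean combinations of half-spaces with rational bounds, in the same syntax as the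
    trigonometric terms. *)
Fixpoint term_set (t : nand_term (A * rat)) : set T :=
  match t with
  | NAtom a => [set x | X a.1 x <= ratr a.2]
  | NOne => setT
  | NNand t1 t2 => ~` (term_set t1 `&` term_set t2)
  end.

Lemma measurable_term_set t : measurable (term_set t).
Proof.
elim: t => [[a c]||t1 m1 t2 m2] /=; last 2 first.
- exact: measurableT.
- by apply: measurableC; exact: measurableI.
rewrite -[X in measurable X]setTI (_ : [set x | _] = X a @^-1` `]-oo, ratr c]); first exact: mX.
by apply/seteqP; split => x /=; rewrite in_itv.
Qed.

Definition indicator_base (f : T -> R) := exists t, f = \1_(term_set t).

Lemma indicator_unit f : indicator_base f -> unit_valued f.
Proof.
move=> [t ->]; split; first exact: measurable_indic (measurable_term_set t).
by move=> x; rewrite indicE; case: (_ \in _); rewrite /= ?lexx ler01.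
Qed.

Lemma indicator_one : indicator_base (fun=> 1).
Proof. by exists NOne; rewrite /= indicT. Qed.

Lemma indicator_nand f g : indicator_base f -> indicator_base g ->
  indicator_base (fun x => 1 - f x * g x).
Proof.
move=> [t1 ->] [t2 ->]; exists (NNand t1 t2); apply/funext => x /=.
rewrite !indicE in_setC in_setI.
by case: (x \in _); case: (x \in _); rewrite /= ?mulr1 ?mulr0 ?mul0r ?subr0 ?subrr.
Qed.

(** A half-space with real bound is the intersection of those with larger rational bounds; the
    indices of the other rationals contribute [setT]. *)
Lemma nand_set_coordinate S a (c : R) : nand_set S indicator_base [set x | X a x <= c].
Proof.
have [s0 sC sU] := nand_sigma_algebra S indicator_unit indicator_one indicator_nand.
pose Q (z : rat) : set T := if c < ratr z then [set x | X a x <= ratr z] else setT.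
rewrite (_ : [set x | _] = \bigcap_n Q (oapp id 0 (@choice.unpickle rat n))).
  apply: (nand_bigcap indicator_unit indicator_one indicator_nand) => n; rewrite /Q.
  case: ifP => _; last exact: (nand_setT _ indicator_one).
  by apply: nand_base; exists (NAtom (a, oapp id 0 (@choice.unpickle rat n))).
apply/seteqP; split => x /=.
  by move=> xc n _; rewrite /Q; case: ifP => // cz; rewrite /= (le_trans xc) // ltW.
move=> h; rewrite leNgt; apply/negP => cx.
have [z /=] := rat_in_itvoo cx; rewrite in_itv /= => /andP[cz zx].
have := h (choice.pickle z) I; rewrite /Q choice.pickleK /= cz /= leNgt zx.
by [].
Qed.

End indicator_terms.

Section arcs.
Variable R : realType.

Lemma cos_le_iff (x c : R) : 0 <= x <= pi -> 0 <= c <= pi -> (cos c <= cos x) = (x <= c).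
Proof.
by move=> xp cp; rewrite leNgt ltr_cos ?in_itv // -leNgt.
Qed.

(* The initial arcs of the circle are determined by the cosine and the sign of the sine. *)
Lemma arc_lower (x c : R) : 0 <= x < 2 * pi -> 0 <= c <= pi ->
  (x <= c) = (cos c <= cos x) && (0 <= sin x).
Proof.
move=> /andP[x0 x2] /andP[c0 cp]; have [xp|px] := leP x pi.
  by rewrite sin_ge0_pi ?x0 // andbT cos_le_iff ?x0 ?c0.
have -> : (x <= c) = false by apply/negbTE; rewrite -ltNge (le_lt_trans cp).
have -> : (0 <= sin x) = false; last by rewrite andbF.
apply/negbTE; rewrite -ltNge -[x](subrK pi) sinDpi oppr_lt0 sin_gt0_pi //.
by apply/andP; split; lra.
Qed.

(** Past [pi] it is the complementary arc that is described, by a negative sine and a larger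
    cosine. *)
Lemma arc_upper (x c : R) : 0 <= x < 2 * pi -> pi < c < 2 * pi ->
  (c < x) = (cos c < cos x) && (sin x < 0).
Proof.
move=> /andP[x0 x2] /andP[cp c2]; have [xp|px] := leP x pi.
  have -> : (c < x) = false by apply/negbTE; rewrite -leNgt (le_trans xp) // ltW.
  have -> : (sin x < 0) = false; last by rewrite andbF.
  by apply/negbTE; rewrite -leNgt sin_ge0_pi // x0.
have -> : (sin x < 0).
  by rewrite -[x](subrK pi) sinDpi oppr_lt0 sin_gt0_pi //; apply/andP; split; lra.
have cE (y : R) : cos y = - cos (y - pi) by rewrite -{1}[y](subrK pi) cosDpi.
rewrite andbT (cE x) (cE c) ltrN2 ltr_cos ?in_itv /= ?ltrD2r //; apply/andP; split; lra.
Qed.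

Lemma sin_le_iff (x c : R) : - 1 < x < 1 -> - 1 < c < 1 -> (sin x <= sin c) = (x <= c).
Proof.
have p2 : 1 <= pi / 2 :> R by have := pihalf_ge1 R; lra.
move=> /andP[x1 x2] /andP[c1 c2].
by rewrite leNgt ltr_sin -?leNgt // in_itv /=; apply/andP; split; lra.
Qed.

End arcs.

Section torus_cell_measure.
Variable R : realType.

Lemma measurable_cell d : measurable (@torus_cell R d).
Proof.
rewrite (_ : @torus_cell R d = \bigcap_(i in [set: 'I_d]) [set x : 'rV[R]_d | circle_cell (x ord0 i)]).
  apply: fin_bigcap_measurable => // i _.
  by apply: sub_sigma_algebra; exists ord0, i, (@circle_cell R); split => //; exact: measurable_itv.
by apply/seteqP; split => x /= h i; [move=> _|]; exact: h.
Qed.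

Lemma torus_cell_full d : torus_measure R d (~` @torus_cell R d) = 0%E.
Proof.
elim: d => [|d ih].
  by rewrite /= diracE memNset //= => h; apply: h => -[].
rewrite /= /torus_step /pushforward.
apply/eqP; rewrite eq_le measure_ge0 andbT.
pose A : set (measurableTypeR R * 'rV[R]_d) := (~` @circle_cell R) `*` setT.
pose B : set (measurableTypeR R * 'rV[R]_d) := setT `*` (~` @torus_cell R d).
have mc : measurable (~` @circle_cell R) by apply: measurableC; exact: measurable_itv.
have mt : measurable (~` @torus_cell R d) by apply: measurableC; exact: measurable_cell.
have mA : measurable A by exact: measurableX.
have mB : measurable B by exact: measurableX.
have sub : @cons_row R d @^-1` (~` @torus_cell R d.+1) `<=` A `|` B.
  move=> [x y] /= nc; have [xc|] := pselect (circle_cell x); last by left.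
  right; split => // yc; apply: nc => i; rewrite /cons_row /=.
  case: (unliftP ord0 i) => [j ->|->].
    have -> : row_mx (const_mx x : 'rV_1) y ord0 (lift ord0 j) = y ord0 j.
      have -> : lift ord0 j = rshift 1 j by apply: val_inj.
      exact: row_mxEr.
    exact: yc.
  have -> : row_mx (const_mx x : 'rV_1) y ord0 ord0 = x.
    have -> : (ord0 : 'I_d.+1) = lshift d (ord0 : 'I_1) by exact: val_inj.
    by apply: etrans (row_mxEl _ _ _ _) _; rewrite mxE.
  exact: xc.
have mpre : measurable (@cons_row R d @^-1` (~` @torus_cell R d.+1)).
  rewrite -[X in measurable X]setTI; apply: measurable_cons_row => //.
  by apply: measurableC; exact: measurable_cell.
have le := le_measure (@circle_measure R \x torus_measure R d)%E (mem_set mpre)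
  (mem_set (measurableU _ _ mA mB)) sub.
apply: (le_trans le).
apply: le_trans (measureU2 _ mA mB) _.
have c0 : @circle_measure R (~` @circle_cell R) = 0%E.
  by rewrite /circle_measure /mfrestr /mrestr setICl measure0.
have eA : (@circle_measure R \x torus_measure R d)%E A = 0%E.
  by rewrite product_measure1E // [X in (X * _)%E]c0 mul0e.
have eB : (@circle_measure R \x torus_measure R d)%E B = 0%E.
  by rewrite product_measure1E // [X in (_ * X)%E]ih mule0.
change ((@circle_measure R \x torus_measure R d)%E A + (@circle_measure R \x torus_measure R d)%E B <= 0)%E.
by rewrite eA eB adde0.
Qed.

Lemma torus_mass d : torus_measure R d setT = ((2 * pi) ^+ d)%:E.
Proof.
have := @torus_cos R d 0 0; rewrite eqxx cos0 mulr1 => <-.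
rewrite -[LHS]mul1e -integral_cst //; apply: eq_integral => x _.
by rewrite /dotZ big1 ?addr0 ?cos0 // => i _; rewrite !mxE mul0r.
Qed.

End torus_cell_measure.

Section mean_value.
Variables (R : realType) (d : nat).
Local Notation V := 'rV[R]_d.
Local Notation haar := (torus_measure R d).

Lemma measurable_flat (p : {poly R}) : measurable_fun setT (flat p : R -> R).
Proof.
apply: continuous_measurable_fun => x; apply: differentiable_continuous.
by apply/derivable1_diffP; have [] := derive_flat p x.
Qed.

Lemma measurable_fst_coord i : measurable_fun setT (fun p : V * V => p.1 ord0 i).
Proof. exact: (measurableT_comp (measurable_coord i) measurable_fst). Qed.

Lemma measurable_snd_coord i : measurable_fun setT (fun p : V * V => p.2 ord0 i).
Proof. exact: (measurableT_comp (measurable_coord i) measurable_snd). Qed.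

Lemma measurable_bump (q : V) r : measurable_fun setT (bump q r).
Proof.
rewrite /bump; elim: (index_enum _) => [|i s ih].
  by under eq_fun do rewrite big_nil; exact: measurable_cst.
under eq_fun do rewrite big_cons.
apply: measurable_funM => //; apply: measurable_funM;
  apply: (measurableT_comp (measurable_flat 1)); apply: measurable_funD => //;
  by apply: measurable_funM => //; exact: measurable_coord.
Qed.

Lemma measurable_atom (q : V) a : measurable_fun setT (atom_val q a).
Proof.
have msin : measurable_fun setT (@sin R) by apply: continuous_measurable_fun; exact: continuous_sin.
have mcos : measurable_fun setT (@cos R) by apply: continuous_measurable_fun; exact: continuous_cos.
rewrite /atom_val; case: (nat_of_ord a.2) => [|[|n]];
  apply: measurable_funM => //; apply: measurable_funD => //.
- exact: (measurableT_comp mcos (measurable_fst_coord _)).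
- exact: (measurableT_comp msin (measurable_fst_coord _)).
- apply: (measurableT_comp msin); apply: measurable_funB => //; exact: measurable_snd_coord.
Qed.

Lemma measurable_term (q : V) t : measurable_fun setT (term_val q t).
Proof.
elim: t => [a||t1 ih1 t2 ih2] /=; first exact: measurable_atom.
  exact: measurable_cst.
by apply: measurable_funB => //; exact: measurable_funM.
Qed.

(** The zeroth coefficient is the average in [x] of the real function represented by the symbol. *)
Lemma mean_term (q : V) r t xi : complex.Re (tcoef (sval (sym_list q r t) xi) 0) =
  (2 * pi) ^- d * \int[haar]_x (bump q r xi * term_val q t (x, xi)).
Proof.
have := cintegral_trig (sval (sym_list q r t) xi).
rewrite -/(tcoef _ 0) => /(congr1 (@complex.Re R)).
have -> : (fun x : V => \sum_(p <- sval (sym_list q r t) xi) p.2 * expi (dotZ p.1 x)) =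
   (fun x => (bump q r xi * term_val q t (x, xi))%:C).
  by apply/funext => x; have := symbol_sym q r t (x, xi).
rewrite /cintegral [LHS]/= Re_M /= mul0r subr0 => ->.
by rewrite mulKf // expf_neq0 // mulf_neq0 // gt_eqF // pi_gt0.
Qed.

End mean_value.

(** * Borel sets reached by the trigonometric terms *)

Section test_term_sets.
Variables (R : realType) (d : nat) (q : 'rV[R]_d) (r : R).
Local Notation V := 'rV[R]_d.
Hypothesis r_le1 : r <= 1.

Definition test_base (f : V * V -> R) := exists t, f = term_val q t.
Definition test_domain : set (V * V) := [set p | torus_cell p.1 /\ `|p.2 - q| < r].

Lemma test_unit f : test_base f -> unit_valued f.
Proof. by move=> [t ->]; split; [exact: measurable_term|exact: term_val01]. Qed.

Lemma test_one : test_base (fun=> 1).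
Proof. by exists NOne. Qed.

Lemma test_nand f g : test_base f -> test_base g -> test_base (fun x => 1 - f x * g x).
Proof. by move=> [t1 ->] [t2 ->]; exists (NNand t1 t2). Qed.

(** Half-spaces suffice. For a torus coordinate they are arcs, cut out by the cosine and the sign of
    the sine; for a frequency coordinate, the sine is increasing on the range allowed by [r <= 1]. A
    half-space that contains or misses the whole test domain is compared with [setT] or its
    complement. *)
Lemma test_nand_set E : measurable E -> nand_set test_domain test_base E.
Proof.
have sa := nand_sigma_algebra test_domain test_unit test_one test_nand.
have mset (f : V * V -> R) c : measurable_fun setT f -> measurable [set p | f p <= c].
  move=> mf; rewrite -[X in measurable X]setTI (_ : [set p | _] = f @^-1` `]-oo, c]); first exact: mf.
  by apply/seteqP; split => x /=; rewrite in_itv.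
have pre i (k : 'I_3) (B : set R) : measurable B ->
    nand_set test_domain test_base (atom_val q (i, k) @^-1` B).
  move=> mB; apply: (nand_preimage test_unit test_one test_nand) => //.
  by apply: nand_base; exists (NAtom (i, k)).
have inI := @nand_setI _ _ _ test_domain _ test_unit test_one test_nand.
have inC := @nand_set_compl _ _ _ test_domain _ test_unit test_one test_nand.
have inT := @nand_setT _ _ _ test_domain _ test_one.
have onS := @nand_set_on _ _ _ test_domain test_base.
apply: (pair_sigma_algebra sa) => i c.
- have mE : measurable [set p : V * V | p.1 ord0 i <= c] by apply: mset; exact: measurable_fst_coord.
  have cellP (p : V * V) : test_domain p -> 0 <= p.1 ord0 i < 2 * pi.
    by move=> [/(_ i)]; rewrite /circle_cell /= in_itv.
  have [c0|c0] := ltP c 0.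
    apply: (onS (~` setT)) => //; first exact: inC.
    move=> p /cellP/andP[p0 _]; split; first by move=> /(_ I).
    by move=> /= pc; have := le_lt_trans (le_trans p0 pc) c0; rewrite ltxx.
  have cosE (z : R) : (((1 + cos c) / 2 <= (1 + z) / 2) = (cos c <= z)) *
                      (((1 + cos c) / 2 < (1 + z) / 2) = (cos c < z)).
    by rewrite ler_pM2r ?invr_gt0 // lerD2l ltr_pM2r ?invr_gt0 // ltrD2l.
  have sinE (z : R) : ((1 / 2 <= (1 + z) / 2) = (0 <= z)) * (((1 + z) / 2 < 1 / 2) = (z < 0)).
    by rewrite ler_pM2r ?invr_gt0 // lerDl ltr_pM2r ?invr_gt0 // gtrDl.
  have [cp|pc] := leP c pi.
    apply: (onS (atom_val q (i, inord 0) @^-1` `[(1 + cos c) / 2, +oo[ `&`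
                 atom_val q (i, inord 1) @^-1` `[1 / 2, +oo[)) => //.
      by apply: inI; apply: pre.
    move=> p /cellP pS; rewrite /= !in_itv /= !andbT /atom_val !inordK //= cosE sinE.
    by rewrite (arc_lower pS (c := c)) ?c0 //; split => [[-> ->]|/andP[]].
  have [c2|c2] := ltP c (2 * pi); last first.
    apply: (onS setT) => //= p /cellP/andP[_ p2]; split => // _.
    by rewrite ltW // (lt_le_trans p2).
  apply: (onS (~` (atom_val q (i, inord 0) @^-1` `](1 + cos c) / 2, +oo[ `&`
                 atom_val q (i, inord 1) @^-1` `]-oo, (1 / 2)[))) => //.
    by apply: inC; apply: inI; apply: pre.
  move=> p /cellP pS; rewrite /= !in_itv /= !andbT /atom_val !inordK //= cosE sinE.
  by rewrite leNgt (arc_upper pS (c := c)) ?pc //; split => [h|/negP h]; [apply/negP => /andP|move=> h'; apply: h; apply/andP].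
- have mE : measurable [set p : V * V | p.2 ord0 i <= c] by apply: mset; exact: measurable_snd_coord.
  have ballP (p : V * V) : test_domain p -> - 1 < p.2 ord0 i - q ord0 i < 1.
    move=> [_ pr]; have := le_lt_trans (coord_le_norm (p.2 - q) i) pr.
    by rewrite !mxE => /lt_le_trans/(_ r_le1); rewrite ltr_norml.
  have [c1|c1] := leP (c - q ord0 i) (-1).
    apply: (onS (~` setT)) => //; first exact: inC.
    move=> p /ballP/andP[p1 _]; split; first by move=> /(_ I).
    by move=> /= pc; have : false by lra.
  have [c2|c2] := ltP (c - q ord0 i) 1; last first.
    apply: (onS setT) => //= p /ballP/andP[_ p2]; split => // _; lra.
  apply: (onS (atom_val q (i, inord 2) @^-1` `]-oo, (1 + sin (c - q ord0 i)) / 2])) => //.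
    exact: pre.
  move=> p /ballP pS; rewrite /= in_itv /= /atom_val inordK //=.
  rewrite ler_pM2r ?invr_gt0 // lerD2l sin_le_iff ?c1 // lerD2r.
  by [].
Qed.

End test_term_sets.

(** * The inequality for Borel sets at almost every time *)

Section pointwise_inequality.
Variables (R : realType) (d : nat).
Local Notation V := 'rV[R]_d.
Local Notation C := R[i].
Local Notation Z := 'rV[int]_d.
Local Notation haar := (torus_measure R d).
Local Notation leb := (@lebesgue_measure R).

Variable mu : R.-fker (measurableTypeR R) ~> (V * V)%type.
Variable mb : {finite_measure set V -> \bar R}.
Hypothesis mu_cell : forall t, mu t (~` (@torus_cell R d `*` setT)) = 0%E.
Hypothesis marginal : {ae leb, forall t, forall B, measurable B -> pushforward (mu t) snd B = mb B}.

Local Notation nu := (haar \x mb)%E.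

Variables (q : V) (r : R).
Hypothesis r_gt0 : 0 < r.
Hypothesis r_le1 : r <= 1.
Let mean (a : V * V -> C) t : R := complex.Re (cintegral (mu t) setT a).

Hypothesis estimate : forall e, 0 < e -> exists2 delta, 0 < delta & forall s0, exists Q : nat,
  forall s, test_symbol q r s -> exists B, forall a b, s0 <= a -> a < b -> b <= s0 + delta ->
  \int[leb]_(t in `[a, b]) mean (symbol s) t <=
  2 * Q%:R * (\int[leb]_(t in `[a, b]) mean (symbol (mean_symbol s)) t) +
  (b - a) * e + B * (b - a) ^+ 2.

Lemma kernel_bound : exists2 F : R, 0 <= F & forall t, (mu t setT <= F%:E)%E.
Proof.
have [F FP] := measure_uub mu; exists F; last by move=> t; exact: ltW.
by have := ltW (FP 0); rewrite -lee_fin; apply: le_trans.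
Qed.

Lemma integrable_unit dT (T : measurableType dT) (m : {measure set T -> \bar R}) f :
  (m setT < +oo)%E -> unit_valued f -> m.-integrable setT (EFin \o f).
Proof.
move=> mfin [mf f01]; apply: measurable_bounded_integrable => //.
exists 1; split=> [|B B1 x _ /=]; rewrite ?num_real //.
by have /andP[f0 f1] := f01 x; rewrite ger0_norm // (le_trans f1) // ltW.
Qed.

Lemma kernel_finite t : (mu t setT < +oo)%E.
Proof. by have [F F0 FP] := kernel_bound; apply: le_lt_trans (FP t) _; rewrite ltry. Qed.

Lemma nu_finite : (nu setT < +oo)%E.
Proof.
rewrite -setXTT product_measure1E //.
by rewrite lte_mul_pinfty ?fin_num_measure // -ge0_fin_numE ?fin_num_measure.
Qed.

Lemma Rintegral_unit_le (f : V * V -> R) F t : unit_valued f -> (mu t setT <= F%:E)%E ->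
  0 <= \int[mu t]_p f p <= F.
Proof.
move=> uf muF; have [mf f01] := uf.
have i0 : (0 <= \int[mu t]_p (f p)%:E)%E.
  by apply: integral_ge0 => p _; rewrite lee_fin; case/andP: (f01 p).
have i1 : (\int[mu t]_p (f p)%:E <= F%:E)%E.
  apply: le_trans muF; rewrite -[leRHS](mul1e) -integral_cst //.
  apply: ge0_le_integral => //.
  - by move=> p _; rewrite lee_fin; case/andP: (f01 p).
  - exact/measurable_EFinP.
  - by move=> p _; rewrite lee_fin; case/andP: (f01 p).
rewrite /Rintegral; move: i0 i1; case: (integral _ _ _) => [x| |] //=; rewrite ?lee_fin ?leye_eq //.
by move=> -> ->.
Qed.

Let phi t : V * V -> R := fun p => bump q r p.2 * term_val q t p.
Let alpha t (xi : V) : R := complex.Re (tcoef (sval (sym_list q r t) xi) 0).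

Lemma unit_phi t : unit_valued (phi t).
Proof.
split.
  apply: measurable_funM; last exact: measurable_term.
  exact: (measurableT_comp (measurable_bump q r) measurable_snd).
move=> p; have /andP[b0 b1] := bump01 q r p.2; have /andP[t0 t1] := term_val01 q t p.
by rewrite mulr_ge0 //= -[leRHS]mulr1 ler_pM.
Qed.

Lemma measurable_phi_x t xi : measurable_fun setT (fun x => phi t (x, xi)).
Proof. by case: (unit_phi t) => mf _; exact: (measurableT_comp mf (measurable_pair2 xi)). Qed.

Lemma haar_phi t xi : (\int[haar]_x (phi t (x, xi))%:E)%E = ((2 * pi) ^+ d * alpha t xi)%:E.
Proof.
have p0 : (2 * pi) ^+ d != 0 :> R by rewrite expf_neq0 // mulf_neq0 // gt_eqF // pi_gt0.
rewrite /alpha mean_term mulVKf // /Rintegral fineK //.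
apply: integrable_fin_num => //; apply: (@bounded_integrable R _ _ haar _ 1).
  exact: measurable_phi_x.
move=> x; have [_ /(_ (x, xi)) /andP[f0 f1]] := unit_phi t.
by rewrite -/(phi t (x, xi)) ger0_norm.
Qed.

Lemma alpha01 t : unit_valued (alpha t).
Proof.
have p0 : 0 < (2 * pi) ^+ d :> R by rewrite exprn_gt0 // mulr_gt0 // pi_gt0.
split.
  have m1 : measurable_fun setT (fun xi => \int[haar]_x (phi t (x, xi))%:E)%E.
    apply: (measurable_fun_fubini_tonelli_G (m1 := haar) (fun p => (phi t p)%:E)).
      by apply/measurable_EFinP; case: (unit_phi t).
    by move=> p; rewrite lee_fin; case: (unit_phi t) => _ /(_ p) /andP[].
  rewrite (_ : alpha t = fun xi => (2 * pi) ^- d * fine (\int[haar]_x (phi t (x, xi))%:E)%E).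
    by apply: measurable_funM => //; exact: measurableT_comp m1.
  by apply/funext => xi; rewrite haar_phi /= mulKf // gt_eqF.
move=> xi; have hp := haar_phi t xi.
have i0 : (0 <= \int[haar]_x (phi t (x, xi))%:E)%E.
  by apply: integral_ge0 => x _; rewrite lee_fin; case: (unit_phi t) => _ /(_ (x, xi)) /andP[].
have i1 : (\int[haar]_x (phi t (x, xi))%:E <= haar setT)%E.
  rewrite -[leRHS]mul1e -integral_cst //; apply: ge0_le_integral => //.
  - by move=> x _; rewrite lee_fin; case: (unit_phi t) => _ /(_ (x, xi)) /andP[].
  - by apply/measurable_EFinP; exact: measurable_phi_x.
  - by move=> x _; rewrite lee_fin; case: (unit_phi t) => _ /(_ (x, xi)) /andP[].
move: i0 i1; rewrite hp torus_mass !lee_fin => i0 i1.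
by rewrite -(pmulr_rge0 _ p0) i0 /= -(ler_pM2l p0) mulr1.
Qed.

(** A function of the frequency alone is integrated by the marginal, and Tonelli's theorem restores
    the average in [x]: this is where the product of [haar] and [mb] appears. *)
Lemma alpha_marginal t tau : (forall B, measurable B -> pushforward (mu t) snd B = mb B) ->
  (\int[mu t]_p (alpha tau p.2)%:E = ((2 * pi) ^- d)%:E * \int[nu]_p (phi tau p)%:E)%E.
Proof.
move=> mt; have [ma a01] := alpha01 tau; have [mp p01] := unit_phi tau.
have p0 : 0 < (2 * pi) ^+ d :> R by rewrite exprn_gt0 // mulr_gt0 // pi_gt0.
have a0 xi : (0 <= (alpha tau xi)%:E)%E by rewrite lee_fin; case/andP: (a01 xi).
rewrite -(@ge0_integral_pushforward _ _ _ _ R snd measurable_snd (mu t) setT (fun xi => (alpha tau xi)%:E)) //;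
  last by apply/measurable_EFinP.
rewrite (eq_measure_integral mb); last by move=> B mB _; exact: mt.
have -> : (\int[nu]_p (phi tau p)%:E = \int[mb]_xi (((2 * pi) ^+ d)%:E * (alpha tau xi)%:E))%E.
  rewrite (fubini_tonelli1 (fun p => (phi tau p)%:E)); last 2 first.
  - by apply/measurable_EFinP.
  - by move=> p; rewrite lee_fin; case/andP: (p01 p).
  rewrite (fubini_tonelli (m1 := haar) (m2 := mb) (fun p => (phi tau p)%:E)).
  - by apply: eq_integral => xi _; rewrite haar_phi EFinM.
  - by apply/measurable_EFinP.
  - by move=> p; rewrite lee_fin; case/andP: (p01 p).
rewrite ge0_integralZl_EFin ?(ltW p0) //; last by apply/measurable_EFinP.
by rewrite muleA -EFinM mulVf ?mul1e // gt_eqF.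
Qed.

(** For each [k] the estimate gives one [Q] for each window of length [delta], common to all terms;
    the exceptional times of countably many terms, windows and values of [k] are put together. The
    constant is [2 * Q] divided by the volume of the torus. *)
Lemma term_inequality : {ae leb, forall t, forall k : nat, exists2 K : R, 0 <= K & forall tau,
  \int[mu t]_p phi tau p <= K * (\int[nu]_p phi tau p) + k.+1%:R^-1}.
Proof.
have [F F0 FP] := kernel_bound.
have p0 : 0 < (2 * pi) ^+ d :> R by rewrite exprn_gt0 // mulr_gt0 // pi_gt0.
have ualpha tau : unit_valued (fun p : V * V => alpha tau p.2).
  have [ma a01] := alpha01 tau; split; last by move=> p; exact: a01.
  exact: (measurableT_comp ma measurable_snd).
have main k : {ae leb, forall t, exists Q : nat, forall tau,
   \int[mu t]_p phi tau p - 2 * Q%:R * (\int[mu t]_p alpha tau p.2) <= k.+1%:R^-1}.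
  have k0 : 0 < k.+1%:R^-1 :> R by rewrite invr_gt0.
  have [delta d0 dP] := estimate k0.
  apply: (ae_of_intervals d0) => a; have [Q QP] := dP a.
  have all tau : {ae leb, forall t, a < t < a + delta ->
      \int[mu t]_p phi tau p - 2 * Q%:R * (\int[mu t]_p alpha tau p.2) <= k.+1%:R^-1}.
    have [B BP] := QP _ (test_symbol_sym q r_gt0 tau).
    have m1 : measurable_fun setT (fun t : measurableTypeR R => \int[mu t]_p phi tau p).
      have [mf f01] := unit_phi tau; exact: (measurable_Rintegral_kernel _ mf f01).
    have m2 : measurable_fun setT (fun t : measurableTypeR R => \int[mu t]_p alpha tau p.2).
      have [mf f01] := ualpha tau; exact: (measurable_Rintegral_kernel _ mf f01).
    have Q0 : 0 <= 2 * Q%:R :> R by rewrite mulr_ge0.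
    apply: (@ae_le_of_interval_integrals _ _ _ _ _ B (F + 2 * Q%:R * F)).
    - by apply: measurable_funB => //; exact: measurable_funM.
    - move=> t; have /andP[x0 x1] := Rintegral_unit_le (unit_phi tau) (FP t).
      have /andP[y0 y1] := Rintegral_unit_le (ualpha tau) (FP t).
      apply: le_trans (ler_normB _ _) _; apply: lerD; rewrite ?ger0_norm ?mulr_ge0 //.
      by rewrite ler_wpM2l.
    - move=> x y ax xy yb; have := BP x y ax xy yb.
      have -> : mean (symbol (sym_list q r tau)) = fun t => \int[mu t]_p phi tau p.
        by apply/funext => t; rewrite /mean /cintegral /=; apply: eq_Rintegral => p _; rewrite symbol_sym.
      have -> : mean (symbol (mean_symbol (sym_list q r tau))) = fun t => \int[mu t]_p alpha tau p.2.
        by apply/funext => t; rewrite /mean /cintegral /=; apply: eq_Rintegral => p _; rewrite symbol_mean.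
      have fin_ (g : R -> R) : measurable_fun setT (g : measurableTypeR R -> R) ->
          (forall t, 0 <= g t <= F) -> leb.-integrable `[x, y] (EFin \o g).
        have lD : (leb `[x, y] < +oo)%E by rewrite lebesgue_measure_itv /=; case: ifP => _; rewrite ?ltry.
        move=> mg g01; apply: measurable_bounded_integrable => //.
        - exact: measurable_funS mg.
        - exists F; split=> [|N FN z _ /=]; rewrite ?num_real //.
          by have /andP[g0 g1] := g01 z; rewrite ger0_norm // (le_trans g1) // ltW.
      have i1 := fin_ _ m1 (fun t => Rintegral_unit_le (unit_phi tau) (FP t)).
      have i2 := fin_ _ m2 (fun t => Rintegral_unit_le (ualpha tau) (FP t)).
      rewrite RintegralB //; last by apply: integrableZR.
      rewrite RintegralZl // => le; rewrite lerBlDl addrA; exact: le.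
  have := ae_forall_countable (m := leb) (@nand_enum_surj _) all.
  by apply: ae_imply => t tP at_; exists Q => tau; exact: tP.
apply: ae_imply2 (ae_foralln main) marginal => t tP mt k.
have [Q QP] := tP k; exists (2 * Q%:R * (2 * pi) ^- d).
  by rewrite !mulr_ge0 // invr_ge0 ltW.
move=> tau; have e2 : \int[mu t]_p alpha tau p.2 = (2 * pi) ^- d * \int[nu]_p phi tau p.
  transitivity (fine (((2 * pi) ^- d)%:E * \int[nu]_p (phi tau p)%:E)%E).
    exact: (congr1 (@fine R) (alpha_marginal tau mt)).
  rewrite fineM //.
  by apply: integrable_fin_num => //; apply: integrable_unit; [exact: nu_finite|exact: unit_phi].
by have := QP tau; rewrite lerBlDr e2 mulrA [leRHS]addrC.
Qed.

(** The terms generate all Borel sets on the test domain. Outside it either the weight [bump]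
    vanishes or the point is off the cell, which is null for both measures. *)
Lemma set_inequality : {ae leb, forall t, forall k : nat, exists2 K : R, 0 <= K & forall E, measurable E ->
  \int[mu t]_p (bump q r p.2 * \1_E p) <= K * (\int[nu]_p (bump q r p.2 * \1_E p)) + k.+1%:R^-1}.
Proof.
apply: ae_imply term_inequality => t tP k; have [K K0 KP] := tP k; exists K => // E mE.
have ub : unit_valued (fun p : V * V => bump q r p.2).
  split; first exact: (measurableT_comp (measurable_bump q r) measurable_snd).
  by move=> p; exact: bump01.
have off (m : {measure set (V * V)%type -> \bar R}) : m (~` (@torus_cell R d `*` setT)) = 0%E ->
    {ae m, forall p, test_domain q r p \/ bump q r p.2 = 0}.
  move=> m0; exists (~` (@torus_cell R d `*` setT)); split => //.
    by apply: measurableC; apply: measurableX => //; exact: measurable_cell.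
  move=> p /= np [cp _]; apply: np; have [pr|rp] := ltP `|p.2 - q| r; first by left.
  by right; exact: bump_out.
have nu0 : nu (~` (@torus_cell R d `*` setT)) = 0%E.
  rewrite (_ : ~` _ = (~` @torus_cell R d) `*` setT).
    have mc : measurable (~` @torus_cell R d) by apply: measurableC; exact: measurable_cell.
    by rewrite product_measure1E // [X in (X * _)%E](torus_cell_full R d) mul0e.
  by apply/seteqP; split => p /=; [move=> h; split => // c; apply: h|move=> [h _] [c _]].
refine (@nand_inequality R _ _ (test_domain q r) (test_base q) (@test_unit R d q)
  (fun f => \int[mu t]_p (bump q r p.2 * f p)) (fun f => \int[nu]_p (bump q r p.2 * f p)) K k.+1%:R^-1
  _ _ (\1_E) (@test_nand_set R d q r r_le1 E mE)).
- move=> f g ug uf gf; split; apply: weighted_convergence gf => //.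
  + by apply: integrable_unit => //; exact: kernel_finite.
  + exact: off.
  + by apply: integrable_unit => //; exact: nu_finite.
  + exact: off.
- by move=> f [tau ->]; exact: KP.
Qed.

End pointwise_inequality.

(** * Absolute continuity of the conditional measures *)

Section disintegration.
Variables (R : realType) (d : nat).
Local Notation V := 'rV[R]_d.
Local Notation haar := (torus_measure R d).
Local Notation leb := (@lebesgue_measure R).

Variable mu : R.-fker (measurableTypeR R) ~> (V * V)%type.
Variable mb : {finite_measure set V -> \bar R}.
Variable muxi : R.-sfker (measurableTypeR R * V)%type ~> V.
Hypothesis disint : is_disintegration mu mb muxi.

Lemma measurable_inner (f : V * V -> R) : measurable_fun setT f -> (forall p, 0 <= f p) ->
  measurable_fun setT (fun y : measurableTypeR R * V => \int[muxi y]_x (f (x, y.2))%:E)%E.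
Proof.
move=> mf f0.
apply: (measurable_fun_integral_sfinite_kernel (fun z : (measurableTypeR R * V) * V => (f (z.2, z.1.2))%:E)).
  by move=> z; rewrite lee_fin.
apply/measurable_EFinP; apply: (measurableT_comp mf); apply/measurable_fun_pairP; split.
  exact: measurable_snd.
exact: (measurableT_comp measurable_snd measurable_fst).
Qed.

Lemma int1 dT (T : measurableType dT) (m : {measure set T -> \bar R}) :
  (\int[m]_x (1 : R)%:E = m setT)%E.
Proof. exact: etrans (integral_cst m measurableT 1%:E) (mul1e _). Qed.

(** Testing with [theta] the indicator of a Borel set of times identifies the two sides as functions
    of [t]; this is done on bounded intervals, where the left side is integrable. *)
Lemma ae_disintegration (f : V * V -> R) : unit_valued f ->
  {ae leb, forall t, (\int[mu t]_p (f p)%:E = \int[mb]_xi \int[muxi (t, xi)]_x (f (x, xi))%:E)%E}.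
Proof.
move=> [mf f01]; have f0 p : 0 <= f p by case/andP: (f01 p).
have [F F0 FP] := kernel_bound mu.
pose u t : \bar R := (\int[mu t]_p (f p)%:E)%E.
pose v t : \bar R := (\int[mb]_xi \int[muxi (t, xi)]_x (f (x, xi))%:E)%E.
have mu_ : measurable_fun setT (u : measurableTypeR R -> \bar R).
  apply: (@measurable_fun_integral_kernel _ _ _ _ _ (fun x => mu x)).
  - by move=> A mA; exact: measurable_kernel.
  - by move=> y; rewrite lee_fin.
  - by apply/measurable_EFinP.
have mv : measurable_fun setT (v : measurableTypeR R -> \bar R).
  apply: (measurable_fun_fubini_tonelli_F (m2 := mb)
    (fun y : measurableTypeR R * V => \int[muxi y]_x (f (x, y.2))%:E)%E).
    exact: measurable_inner.
  by move=> y; apply: integral_ge0 => x _; rewrite lee_fin.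
have u0 t : (0 <= u t)%E by apply: integral_ge0 => p _; rewrite lee_fin.
have v0 t : (0 <= v t)%E.
  by apply: integral_ge0 => xi _; apply: integral_ge0 => x _; rewrite lee_fin.
have uF t : (u t <= F%:E)%E.
  apply: le_trans (FP t); rewrite -[leRHS]mul1e -integral_cst //.
  apply: ge0_le_integral => //.
  - by move=> p _; rewrite lee_fin.
  - by apply/measurable_EFinP.
  - by move=> p _; rewrite lee_fin; case/andP: (f01 p).
pose D n : set R := [set` `[(- n%:R : R), n%:R]].
have mD n : measurable (D n) by exact: measurable_itv.
have lD n : (leb (D n) < +oo)%E.
  by rewrite /D lebesgue_measure_itv /=; case: ifP => _; rewrite ?ltry.
have on n : ae_eq leb (D n) u v.
  apply: (@integral_ae_eq _ (measurableTypeR R) R leb (D n) (mD n) v u).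
  - apply/integrableP; split; first exact: measurable_funS mu_.
    apply: (@le_lt_trans _ _ (\int[leb]_(t in D n) (cst F%:E t))%E).
      rewrite (eq_integral u); last by move=> t _; rewrite gee0_abs.
      have muD : measurable_fun (D n) u by exact: measurable_funTS.
      by apply: ge0_le_integral; try exact: (mD n).
    rewrite (integral_cst leb (mD n) F%:E); apply: lte_mul_pinfty => //.
    exact: lD.
  - exact: measurable_funS mv.
  - move=> E ED mE.
    have iE : leb.-integrable setT (EFin \o (\1_E : R -> R)).
      apply/integrableP; split.
        by apply/measurable_EFinP; exact: measurable_indic.
      under eq_integral do rewrite gee0_abs ?lee_fin //.
      rewrite integral_indic // setIT; apply: le_lt_trans (lD n).
      by apply: le_measure => //; try (by []); rewrite inE; try exact: mE; exact: (mD n).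
    have bf : exists M : R, forall p, `|f p| <= M.
      by exists 1 => p; rewrite ger0_norm //; case/andP: (f01 p).
    have := disint iE mf bf; rewrite -/u -/v.
    have conv (w : R -> \bar R) : (\int[leb]_t ((\1_E t)%:E * w t) = \int[leb]_(t in E) w t)%E.
      rewrite [RHS]integral_mkcond; apply: eq_integral => t _.
      by rewrite /patch indicE; case: (t \in E); rewrite ?mul1e ?mul0e.
    by rewrite !conv.
have := ae_foralln on; apply: ae_imply => t tP.
apply: (tP (Num.trunc `|t|).+1).
by rewrite /D /= in_itv /= -ler_norml ltW // truncnS_gt.
Qed.

Definition pair_coord (a : 'I_d + 'I_d) (p : V * V) : R :=
  match a with inl i => p.1 ord0 i | inr i => p.2 ord0 i end.

Lemma measurable_pair_coord a : measurable_fun setT (pair_coord a).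
Proof. by case: a => i; [exact: measurable_fst_coord|exact: measurable_snd_coord]. Qed.

Lemma pair_nand_set S E : measurable E -> nand_set S (indicator_base pair_coord) E.
Proof.
have sa := nand_sigma_algebra S (indicator_unit measurable_pair_coord)
  (indicator_one pair_coord) (@indicator_nand _ _ _ _ pair_coord).
apply: (pair_sigma_algebra sa) => i c.
  exact: (nand_set_coordinate measurable_pair_coord S (inl i) c).
exact: (nand_set_coordinate measurable_pair_coord S (inr i) c).
Qed.

Definition row_coord (i : 'I_d) (x : V) : R := x ord0 i.

Lemma row_nand_set S E : measurable E -> nand_set S (indicator_base row_coord) E.
Proof.
have mr : forall i, measurable_fun setT (row_coord i) by move=> i; exact: measurable_coord.
have sa := nand_sigma_algebra S (indicator_unit mr)
  (indicator_one row_coord) (@indicator_nand _ _ _ _ row_coord).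
apply: (row_sigma_algebra sa) => i c.
exact: (nand_set_coordinate mr S i c).
Qed.

Variables (w : V -> R).
Hypothesis mw : measurable_fun setT w.
Hypothesis w01 : forall xi, 0 <= w xi <= 1.

Let inner t (f : V * V -> R) xi : R := \int[muxi (t, xi)]_x f (x, xi).

(** One null set of times for a countable family of sets, before the extension to all Borel sets;
    the weight depends on the frequency alone and leaves the inner integral. *)
Lemma ae_term_formula : {ae leb, forall t, forall tau, let f : V * V -> R := \1_(term_set pair_coord tau) in
  (\int[mu t]_p (w p.2 * f p)%:E =
   \int[mb]_xi ((w xi)%:E * \int[muxi (t, xi)]_x (f (x, xi))%:E))%E}.
Proof.
apply: (ae_forall_countable (@nand_enum_surj _)) => tau.
have [mf f01] : unit_valued (\1_(term_set pair_coord tau) : V * V -> R).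
  by apply: (indicator_unit measurable_pair_coord); exists tau.
have uf : unit_valued (fun p : V * V => w p.2 * \1_(term_set pair_coord tau) p).
  split; first by apply: measurable_funM => //; exact: (measurableT_comp mw measurable_snd).
  move=> p; have /andP[a b] := w01 p.2; have /andP[c e] := f01 p.
  by rewrite mulr_ge0 //= -[leRHS]mulr1 ler_pM.
apply: ae_imply (ae_disintegration uf) => t e /=; apply: etrans e _.
apply: eq_integral => xi _.
transitivity (\int[muxi (t, xi)]_x ((w xi)%:E * (\1_(term_set pair_coord tau) (x, xi))%:E))%E.
  by apply: eq_integral => x _; rewrite EFinM.
have m1 : measurable_fun setT (fun x => (\1_(term_set pair_coord tau) (x, xi) : R)%:E).
  by apply/measurable_EFinP; exact: (measurableT_comp mf (measurable_pair2 xi)).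
have p1 x : setT x -> (0 <= (\1_(term_set pair_coord tau) (x, xi) : R)%:E)%E.
  by rewrite lee_fin; case/andP: (f01 (x, xi)).
by rewrite ge0_integralZl_EFin //; case/andP: (w01 xi).
Qed.

Definition section_finite t :=
  {ae mb, forall xi, w xi = 0 \/ (muxi (t, xi) setT < +oo)%E} /\
  mb.-integrable setT (fun xi => (w xi * fine (muxi (t, xi) setT))%:E).

Lemma measurable_inner_section t f : unit_valued f -> measurable_fun setT (inner t f).
Proof.
move=> [mf f01]; apply: measurableT_comp => //.
have := measurable_inner mf (fun p => proj1 (andP (f01 p))).
by move=> m; exact: (measurableT_comp m (measurable_pair1 t)).
Qed.

(** The whole space is a term, which shows that the weighted masses of [muxi] are integrable. They
    dominate the inner integrals, so both sides of the formula are continuous under bounded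
    pointwise limits, and equality extends from terms to Borel sets as two inequalities with [K = 1]
    and no error. *)
Lemma ae_section_formula : {ae leb, forall t, section_finite t /\ forall E, measurable E ->
  mb.-integrable setT (fun xi => (w xi * inner t (\1_E) xi)%:E) /\
  \int[mu t]_p (w p.2 * \1_E p) = \int[mb]_xi (w xi * inner t (\1_E) xi)}.
Proof.
apply: ae_imply ae_term_formula => t tP.
have w0 xi : 0 <= w xi by case/andP: (w01 xi).
have uw : unit_valued (fun p : V * V => w p.2).
  by split; [exact: (measurableT_comp mw measurable_snd)|move=> p; exact: w01].
have mm : measurable_fun setT (fun xi => muxi (t, xi) setT).
  exact: (measurableT_comp (measurable_kernel muxi setT measurableT) (measurable_pair1 t)).
have fin1 : (\int[mb]_xi ((w xi)%:E * muxi (t, xi) setT) < +oo)%E.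
  have := tP NOne; rewrite /= indicT => e.
  have -> : (\int[mb]_xi ((w xi)%:E * muxi (t, xi) setT) = \int[mu t]_p (w p.2 * 1)%:E)%E.
    rewrite e; apply: eq_integral => xi _; congr (_ * _)%E.
    by rewrite int1.
  under eq_integral do rewrite mulr1.
  rewrite ltey; have := integrable_fin_num measurableT (integrable_unit (kernel_finite mu t) uw).
  by rewrite fin_numE => /andP[].
have mwm : measurable_fun setT (fun xi => ((w xi)%:E * muxi (t, xi) setT)%E).
  by apply: emeasurable_funM => //; apply/measurable_EFinP.
have iwm : mb.-integrable setT (fun xi => ((w xi)%:E * muxi (t, xi) setT)%E).
  apply/integrableP; split => //; under eq_integral do rewrite gee0_abs ?mule_ge0 ?lee_fin //.
  exact: fin1.
have aefin : {ae mb, forall xi, w xi = 0 \/ (muxi (t, xi) setT < +oo)%E}.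
  have := integrable_ae measurableT iwm; apply: ae_imply => xi /(_ I) h.
  have [->|wn] := eqVneq (w xi) 0; [by left|right].
  rewrite ltey; apply/eqP => muoo; move: h; rewrite muoo gt0_muley ?lte_fin ?lt0r ?wn ?w0 //.
have aeE (f : V * V -> R) : unit_valued f -> {ae mb, forall xi, setT xi ->
    ((w xi)%:E * \int[muxi (t, xi)]_x (f (x, xi))%:E)%E = (w xi * inner t f xi)%:E}.
  move=> [mf f01]; apply: ae_imply aefin => xi [->|fin] _; first by rewrite mul0e mul0r.
  rewrite EFinM; congr (_ * _)%E; rewrite /inner /Rintegral fineK //.
  have i0 : (0 <= \int[muxi (t, xi)]_x (f (x, xi))%:E)%E.
    by apply: integral_ge0 => x _; rewrite lee_fin; case/andP: (f01 (x, xi)).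
  rewrite ge0_fin_numE //; apply: le_lt_trans fin; rewrite -[leRHS]mul1e -integral_cst //.
  apply: ge0_le_integral => //.
  - by move=> x _; rewrite lee_fin; case/andP: (f01 (x, xi)).
  - by apply/measurable_EFinP; exact: (measurableT_comp mf (measurable_pair2 xi)).
  - by move=> x _; rewrite lee_fin; case/andP: (f01 (x, xi)).
have mJ f : unit_valued f -> measurable_fun setT (fun xi => w xi * inner t f xi).
  by move=> uf; apply: measurable_funM => //; exact: measurable_inner_section.
have one : unit_valued (fun=> 1 : R) by split => // p; rewrite ler01 lexx.
have iJ1 : mb.-integrable setT (fun xi => (w xi * inner t (fun=> 1) xi)%:E).
  have mJ1 : measurable_fun setT (fun xi => (w xi * inner t (fun=> 1) xi)%:E).
    by apply/measurable_EFinP; exact: mJ.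
  have J0 xi : (0 <= (w xi * inner t (fun=> 1) xi)%:E)%E.
    by rewrite lee_fin mulr_ge0 //; apply: Rintegral_ge0 => x _.
  apply/integrableP; split => //.
  under eq_integral do rewrite gee0_abs //.
  apply: le_lt_trans fin1; rewrite le_eqVlt; apply/orP; left; apply/eqP.
  apply: ge0_ae_eq_integral => //.
    by move=> xi _; rewrite mule_ge0 ?lee_fin.
  have := aeE _ (one _ _); apply: ae_imply => xi h _.
  by rewrite -h //; congr (_ * _)%E; rewrite int1.
have in1 xi : inner t (fun=> 1) xi = fine (muxi (t, xi) setT).
  by rewrite /inner /Rintegral int1.
split.
  by split => //; rewrite (_ : (fun xi => _) = (fun xi => (w xi * inner t (fun=> 1) xi)%:E)) //;
     apply/funext => xi; rewrite in1.
have contI f g : (forall n, unit_valued (g n)) -> unit_valued f ->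
    (forall x, setT x -> g n x @[n --> \oo] --> f x) ->
    mb.-integrable setT (fun xi => (w xi * inner t f xi)%:E) /\
    \int[mb]_xi (w xi * inner t (g n) xi) @[n --> \oo] --> \int[mb]_xi (w xi * inner t f xi).
  move=> ug uf gf.
  have [|||||/= ic _ cv] := @dominated_convergence _ _ _ mb _ measurableT
    (fun n xi => (w xi * inner t (g n) xi)%:E) (fun xi => (w xi * inner t f xi)%:E)
    (fun xi => (w xi * inner t (fun=> 1) xi)%:E).
  - by move=> n; apply/measurable_EFinP; exact: mJ.
  - by apply/measurable_EFinP; exact: mJ.
  - apply: ae_imply aefin => xi fin _; apply: cvg_EFin; first by near=> n.
    case: fin => [->|fin].
      by rewrite mul0r; under eq_fun do rewrite mul0r; exact: cvg_cst.
    apply: cvgM; first exact: cvg_cst.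
    have e k : inner t k xi = \int[muxi (t, xi)]_x (1 * k (x, xi)).
      by rewrite /inner; apply: eq_Rintegral => x _; rewrite mul1r.
    rewrite (e f); under eq_fun do rewrite e.
    apply: weighted_convergence.
    + apply/integrableP; split; first exact/measurable_EFinP.
      by under eq_integral do rewrite /= normr1; rewrite int1.
    + by apply: aeW => x; left.
    + move=> n; have [m1 m2] := ug n; split; last by move=> x; exact: m2.
      exact: (measurableT_comp m1 (measurable_pair2 xi)).
    + have [m1 m2] := uf; split; last by move=> x; exact: m2.
      exact: (measurableT_comp m1 (measurable_pair2 xi)).
    + by move=> x _; exact: gf.
  - exact: iJ1.
  - apply: ae_imply aefin => xi fin n _; rewrite lee_fin normrM (ger0_norm (w0 xi)).
    case: fin => [->|fin]; first by rewrite !mul0r.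
    have [mg g01] := ug n; apply: ler_wpM2l => //.
    have h0 : 0 <= inner t (g n) xi.
      by apply: Rintegral_ge0 => x _; case/andP: (g01 (x, xi)).
    rewrite ger0_norm // /inner; apply: le_Rintegral => //.
    + apply: measurable_bounded_integrable => //.
        exact: (measurableT_comp mg (measurable_pair2 xi)).
      exists 1; split=> [|B B1 x _ /=]; rewrite ?num_real //.
      by have /andP[a b] := g01 (x, xi); rewrite ger0_norm // (le_trans b) // ltW.
    + apply/integrableP; split; first exact/measurable_EFinP.
      by under eq_integral do rewrite /= normr1; rewrite int1.
    + by move=> x _; case/andP: (g01 (x, xi)).
  split; first exact: ic.
  by rewrite /Rintegral; apply: fine_cvg; rewrite fineK // integrable_fin_num.
have cont f g a b c := (contI f g a b c).2.
have iJ f (uf : unit_valued f) := (contI f (fun=> f) (fun=> uf) uf (fun x _ => cvg_cst _)).1.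
have cont1 f g : (forall n, unit_valued (g n)) -> unit_valued f ->
    (forall x, setT x -> g n x @[n --> \oo] --> f x) ->
    \int[mu t]_p (w p.2 * g n p) @[n --> \oo] --> \int[mu t]_p (w p.2 * f p).
  move=> ug uf gf; apply: weighted_convergence gf => //.
    by apply: integrable_unit => //; exact: kernel_finite.
  by apply: aeW => x; left.
have base_eq f : indicator_base pair_coord f ->
    \int[mu t]_p (w p.2 * f p) = \int[mb]_xi (w xi * inner t f xi).
  move=> [tau ->]; have := tP tau => /= e; rewrite /Rintegral e; congr fine.
  have uf : unit_valued (\1_(term_set pair_coord tau) : V * V -> R).
    by apply: (indicator_unit measurable_pair_coord); exists tau.
  have [mf f01] := uf.
  apply: ae_eq_integral => //.
  - apply: emeasurable_funM; first by apply/measurable_EFinP.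
    have := measurable_inner mf (fun p => proj1 (andP (f01 p))).
    by move=> m; exact: (measurableT_comp m (measurable_pair1 t)).
  - by apply/measurable_EFinP; exact: mJ.
  - exact: aeE.
move=> E mE; have cE := pair_nand_set setT mE.
have unit_ := indicator_unit measurable_pair_coord.
split; first by apply: iJ; exact: (nand_unit unit_ cE).
apply/eqP; rewrite eq_le; apply/andP; split.
- have := @nand_inequality R _ _ setT (indicator_base pair_coord) unit_
    (fun f => \int[mu t]_p (w p.2 * f p)) (fun f => \int[mb]_xi (w xi * inner t f xi)) 1 0
    _ _ _ cE.
  rewrite mul1r addr0; apply.
    by move=> f g ug uf gf; split; [exact: cont1|exact: cont].
  by move=> f bf; rewrite mul1r addr0 base_eq.
- have := @nand_inequality R _ _ setT (indicator_base pair_coord) unit_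
    (fun f => \int[mb]_xi (w xi * inner t f xi)) (fun f => \int[mu t]_p (w p.2 * f p)) 1 0
    _ _ _ cE.
  rewrite mul1r addr0; apply.
    by move=> f g ug uf gf; split; [exact: cont|exact: cont1].
  by move=> f bf; rewrite mul1r addr0 base_eq.
Unshelve. all: by end_near.
Qed.

End disintegration.

(** * The bad parameters and absolute continuity *)

Section absolute_continuity.
Variables (R : realType) (d : nat).
Local Notation V := 'rV[R]_d.
Local Notation haar := (torus_measure R d).
Local Notation leb := (@lebesgue_measure R).

Variable mu : R.-fker (measurableTypeR R) ~> (V * V)%type.
Variable mb : {finite_measure set V -> \bar R}.
Variable muxi : R.-sfker (measurableTypeR R * V)%type ~> V.
Local Notation nu := (haar \x mb)%E.
Local Notation cell n := (term_set (@row_coord R d) (nand_enum _ n)).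

Lemma measurable_row_set n : measurable (cell n).
Proof. by apply: measurable_term_set => i; exact: measurable_coord. Qed.

(** Here [cell] enumerates the Boolean combinations of rational half-spaces. *)
Let exceeds (l n j : nat) (y : measurableTypeR R * V) : Prop :=
  ((n%:R * fine (haar (cell j)) + l.+1%:R^-1)%:E < muxi y (cell j))%E.

Lemma measurable_exceeds l n j : measurable [set y | exceeds l n j y].
Proof.
rewrite -[X in measurable X]setTI; apply: emeasurable_fun_o_infty => //.
by apply: measurable_kernel; exact: measurable_row_set.
Qed.

Variables (w : V -> R).
Hypothesis mw : measurable_fun setT w.
Hypothesis w01 : forall xi, 0 <= w xi <= 1.

(* The parameters at which [muxi] is not uniformly controlled by [haar]. *)
Definition bad_set (l : nat) : set (measurableTypeR R * V) :=
  [set y | 0 < w y.2 /\ forall n, exists j, exceeds l n j y].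

Lemma measurable_bad_set l : measurable (bad_set l).
Proof.
rewrite (_ : bad_set l = [set y | 0 < w y.2] `&`
    \bigcap_n \bigcup_j [set y | exceeds l n j y]); last first.
  apply/seteqP; split => y /=; first by move=> [w0 h]; split => // n _; have [j] := h n; exists j.
  by move=> [w0 h]; split => // n; have [j _] := h n I; exists j.
apply: measurableI.
  rewrite -[X in measurable X]setTI (_ : [set y | _] = (w \o snd) @^-1` `]0, +oo[).
    exact: (measurableT_comp mw measurable_snd).
  by apply/seteqP; split => y /=; rewrite in_itv /= andbT.
apply: bigcapT_measurable => n; apply: bigcupT_measurable => j; exact: measurable_exceeds.
Qed.

Hypothesis inequality : {ae leb, forall t, forall k : nat, exists2 K : R, 0 <= K & forall E, measurable E ->
  \int[mu t]_p (w p.2 * \1_E p) <= K * (\int[nu]_p (w p.2 * \1_E p)) + k.+1%:R^-1}.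
Hypothesis disint : is_disintegration mu mb muxi.

(** For each bad [xi] select a set that violates the bound with some [n >= K], and assemble the
    selections into one Borel set [E] of the product. The inequality for [E] then bounds [e] times
    the weighted mass of the bad frequencies by [k.+1%:R^-1], with [k] arbitrary. *)
Lemma ae_bad_section l : {ae leb, forall t, mb (xsection (bad_set l) t) = 0%E}.
Proof.
have w0 xi : 0 <= w xi by case/andP: (w01 xi).
apply: ae_imply2 inequality (ae_section_formula disint mw w01) => t ineq [[aefin iJ] formula].
pose e : R := l.+1%:R^-1.
have e0 : 0 < e by rewrite invr_gt0.
pose B := xsection (bad_set l) t.
have mB : measurable B by apply: measurable_xsection; exact: measurable_bad_set.
have uB : unit_valued (fun xi => w xi * \1_B xi).
  split; first by apply: measurable_funM => //; exact: measurable_indic.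
  move=> xi; rewrite indicE; have /andP[a b] := w01 xi.
  by case: (_ \in _); rewrite ?mulr1 ?mulr0 ?a ?b ?lexx ?ler01.
have mbfin : (mb setT < +oo)%E by rewrite -ge0_fin_numE ?fin_num_measure.
have iB := integrable_unit mbfin uB.
have Y0 : 0 <= \int[mb]_xi (w xi * \1_B xi).
  by apply: Rintegral_ge0 => xi _; have [_ /(_ xi)/andP[]] := uB.
have small k : e * \int[mb]_xi (w xi * \1_B xi) <= k.+1%:R^-1.
  have [K K0 KP] := ineq k; pose n := (Num.trunc K).+1.
  have Kn : K <= n%:R by exact: ltW (truncnS_gt _).
  pose Dj j := [set xi : V | exceeds l n j (t, xi)].
  have mD j : measurable (Dj j).
    have := measurable_xsection t (measurable_exceeds l n j).
    rewrite (_ : xsection _ t = Dj j) //.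
    by apply/seteqP; split => xi; rewrite /xsection /= inE.
  (* The frequencies whose first violating index is [j]: taking the first one makes the selection
     measurable. *)
  pose Fj j := Dj j `\` \bigcup_(i in [set i | (i < j)%N]) Dj i.
  have mF j : measurable (Fj j).
    by apply: measurableD => //; apply: bigcup_measurable => i _.
  pose E : set (V * V) := \bigcup_j (cell j `*` Fj j).
  have mE : measurable E.
    by apply: bigcupT_measurable => j; apply: measurableX => //; exact: measurable_row_set.
  have Funiq i j xi : Fj i xi -> Fj j xi -> i = j.
    move=> [di ni] [dj nj]; case: (ltngtP i j) => // ij.
      by exfalso; apply: nj; exists i.
    by exfalso; apply: ni; exists j.
  have Esec j xi : Fj j xi -> (fun x => \1_E (x, xi) : R) = \1_(cell j).
    move=> fj; apply/funext => x; rewrite !indicE; congr (_ %:R); congr nat_of_bool.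
    apply/idP/idP => /set_mem.
      by move=> [i _ [xi_ fi]]; apply: mem_set; rewrite (Funiq _ _ _ fj fi).
    by move=> xj; apply: mem_set; exists j.
  have Enone xi : (forall j, ~ Fj j xi) -> (fun x => \1_E (x, xi) : R) = fun=> 0.
    by move=> no; apply/funext => x; rewrite indicE memNset // => -[j _ [_ /no]].
  pose hE xi : R := \int[haar]_x \1_E (x, xi).
  have uE : unit_valued (\1_E : V * V -> R).
    split; first exact: measurable_indic.
    by move=> p; rewrite indicE; case: (_ \in _); rewrite /= ?lexx ler01.
  have uwE : unit_valued (fun p : V * V => w p.2 * \1_E p).
    split; first by apply: measurable_funM; [exact: (measurableT_comp mw measurable_snd)|exact: measurable_indic].
    move=> p; rewrite indicE; have /andP[a b] := w01 p.2.
    by case: (_ \in _); rewrite ?mulr1 ?mulr0 ?a ?b ?lexx ?ler01.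
  have ind_fin (m : {measure set V -> \bar R}) j : \int[m]_x (\1_(cell j) x : R) = fine (m (cell j)).
    by rewrite /Rintegral integral_indic // ?setIT //; exact: measurable_row_set.
  have zero_int (m : {measure set V -> \bar R}) : \int[m]_x (0 : R) = 0.
    by rewrite /Rintegral integral0.
  have first_ xi j : Dj j xi -> exists i, Fj i xi.
    elim/ltn_ind: j => j ih dj; have [[i /= ij di]|no] := pselect (exists2 i, (i < j)%N & Dj i xi).
      exact: ih ij di.
    by exists j; split => // -[i /= ij di]; apply: no; exists i.
  have pt : {ae mb, forall xi, w xi * (n%:R * hE xi + e * \1_B xi) <=
      w xi * \int[muxi (t, xi)]_x \1_E (x, xi)}.
    apply: ae_imply aefin => xi [->|fin]; first by rewrite !mul0r.
    apply: ler_wpM2l => //; rewrite /hE.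
    have [[j fj]|no] := pselect (exists j, Fj j xi).
      rewrite (Esec _ _ fj) !ind_fin.
      have dj : exceeds l n j (t, xi) by case: fj.
      have cfin : (muxi (t, xi) (cell j) < +oo)%E.
        by apply: le_lt_trans fin; apply: le_measure; rewrite ?inE //; exact: measurable_row_set.
      have le : n%:R * fine (haar (cell j)) + e <= fine (muxi (t, xi) (cell j)).
        rewrite -lee_fin fineK ?ge0_fin_numE //; exact: ltW dj.
      apply: le_trans le; rewrite lerD2l; rewrite indicE; by case: (_ \in _); rewrite /= ?mulr1 ?mulr0 // ltW.
    have no' j : ~ Fj j xi by move=> fj; apply: no; exists j.
    rewrite (Enone _ no') !zero_int mulr0 add0r indicE memNset ?mulr0 //.
    rewrite /B /xsection /= inE => -[_ /(_ n)[j dj]].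
    by have [i fi] := first_ _ _ dj; exact: no' fi.
  have X_eq : \int[nu]_p (w p.2 * \1_E p) = \int[mb]_xi (w xi * hE xi).
    have p0 p : (0 <= (w p.2 * \1_E p)%:E)%E by rewrite lee_fin; have [_ /(_ p)/andP[]] := uwE.
    have mp : measurable_fun setT (fun p : V * V => (w p.2 * \1_E p)%:E).
      by apply/measurable_EFinP; case: uwE.
    rewrite /Rintegral (fubini_tonelli1 (fun p => (w p.2 * \1_E p)%:E)) //.
    rewrite (fubini_tonelli (m1 := haar) (m2 := mb) (fun p => (w p.2 * \1_E p)%:E)) //.
    congr fine; apply: eq_integral => xi _.
    transitivity (\int[haar]_x ((w xi)%:E * (\1_E (x, xi))%:E))%E.
      by apply: eq_integral => x _; rewrite EFinM.
    have mEx : measurable_fun setT (fun x => (\1_E (x, xi) : R)%:E).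
      by apply/measurable_EFinP; exact: (measurableT_comp (proj1 uE) (measurable_pair2 xi)).
    rewrite ge0_integralZl_EFin //.
      rewrite EFinM /hE /Rintegral fineK //; apply: integrable_fin_num => //.
      apply: integrable_unit; first by rewrite -ge0_fin_numE ?fin_num_measure.
      split; first by apply/measurable_EFinP.
      by move=> x; have [_ /(_ (x, xi))] := uE.
  have haar_fin : (haar setT < +oo)%E by rewrite -ge0_fin_numE ?fin_num_measure.
  have hE01 xi : 0 <= hE xi <= fine (haar setT).
    apply/andP; split; first by apply: Rintegral_ge0 => x _; have [_ /(_ (x, xi))/andP[]] := uE.
    have [[j fj]|no] := pselect (exists j, Fj j xi); last first.
      by rewrite /hE Enone ?zero_int ?fine_ge0 // => j fj; apply: no; exists j.
    rewrite /hE (Esec _ _ fj) ind_fin; apply: fine_le; rewrite ?fin_num_measure //.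
      exact: measurable_row_set.
    by apply: le_measure; rewrite ?inE //; exact: measurable_row_set.
  have mhE : measurable_fun setT hE.
    apply: measurableT_comp => //.
    apply: (measurable_fun_fubini_tonelli_G (m1 := haar) (fun p => (\1_E p : R)%:E)).
      by apply/measurable_EFinP; case: uE.
    by move=> p; rewrite lee_fin; have [_ /(_ p)/andP[]] := uE.
  have iX : mb.-integrable setT (EFin \o (fun xi => w xi * hE xi)).
    apply: measurable_bounded_integrable => //; first exact: measurable_funM.
    exists (fine (haar setT)); split=> [|b b1 xi _ /=]; rewrite ?num_real //.
    have /andP[h0 h1] := hE01 xi; have /andP[a0 a1] := w01 xi.
    rewrite ger0_norm ?mulr_ge0 // (le_trans _ (ltW b1)) // -[leRHS]mul1r.
    by rewrite ler_pM.
  have mI : measurable_fun setT (fun xi => \int[muxi (t, xi)]_x (\1_E (x, xi) : R)).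
    exact: measurable_inner_section.
  have iI : mb.-integrable setT (EFin \o (fun xi => w xi * \int[muxi (t, xi)]_x (\1_E (x, xi) : R))).
    exact: (formula E mE).1.
  have le1 : \int[mb]_xi (n%:R * (w xi * hE xi) + e * (w xi * \1_B xi)) <=
      \int[mb]_xi (w xi * \int[muxi (t, xi)]_x (\1_E (x, xi) : R)).
    rewrite /Rintegral; apply: fine_le.
    - by apply: integrable_fin_num => //; apply: integrableDR => //; exact: integrableZR.
    - exact: integrable_fin_num iI.
    apply: ae_ge0_le_integral => //.
    - move=> xi _; have /andP[h0 _] := hE01 xi; have [_ /(_ xi)/andP[b0 _]] := uB.
      by rewrite lee_fin addr_ge0 // mulr_ge0 ?mulr_ge0 // ltW.
    - apply/measurable_EFinP; apply: measurable_funD; apply: measurable_funM => //.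
        exact: measurable_funM.
      by case: uB.
    - move=> xi _; rewrite lee_fin mulr_ge0 //.
      by apply: Rintegral_ge0 => x _; have [_ /(_ (x, xi))/andP[]] := uE.
    - by apply/measurable_EFinP; exact: measurable_funM.
    - apply: ae_imply pt => xi le _; rewrite lee_fin; apply: le_trans le.
      by rewrite le_eqVlt; apply/orP; left; apply/eqP; ring.
  have := KP E mE; rewrite (formula E mE).2 X_eq => le2.
  have := le_trans le1 le2.
  rewrite RintegralD //; last 2 first.
  - exact: integrableZR.
  - exact: integrableZR.
  rewrite !RintegralZl //.
  have X0 : 0 <= \int[mb]_xi (w xi * hE xi).
    by apply: Rintegral_ge0 => xi _; rewrite mulr_ge0 //; case/andP: (hE01 xi).
  have : K * \int[mb]_xi (w xi * hE xi) <= n%:R * \int[mb]_xi (w xi * hE xi) by rewrite ler_wpM2r.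
  set X := \int[_]_(_ in _) _; set Y := \int[_]_(_ in _) _; set k1 := k.+1%:R^-1.
  move=> a b; rewrite -(lerD2l (n%:R * X)); apply: le_trans b _; exact: lerD.
have Yz : \int[mb]_xi (w xi * \1_B xi) = 0.
  apply/eqP; rewrite eq_le Y0 andbT leNgt; apply/negP => Yp.
  have eY : 0 < e * \int[mb]_xi (w xi * \1_B xi) by rewrite mulr_gt0.
  have := small (Num.trunc (e * \int[mb]_xi (w xi * \1_B xi))^-1).
  by rewrite leNgt invf_plt ?posrE ?ltr0n // truncnS_gt.
have mwB : measurable_fun setT (fun xi => (w xi * \1_B xi)%:E).
  by apply/measurable_EFinP; case: uB.
have i0 : (\int[mb]_xi `|(w xi * \1_B xi)%:E| = 0)%E.
  transitivity (\int[mb]_xi (w xi * \1_B xi)%:E)%E.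
    by apply: eq_integral => xi _; rewrite gee0_abs // lee_fin; have [_ /(_ xi)/andP[]] := uB.
  by rewrite -[LHS]fineK ?integrable_fin_num //; congr EFin.
have ae0 := (ae_eq_integral_abs mb measurableT mwB).1 i0.
apply/negligibleP => //; move: ae0; apply: negligibleS => xi Bxi /(_ I) /= [] /eqP.
rewrite indicE mem_set // mulr1; have := Bxi; rewrite /B /xsection /= inE => -[wp _].
by rewrite gt_eqF.
Qed.

(** By Tonelli's theorem the bad set is null for the product measure, so almost all its sections in
    the other variable are null too. *)
Lemma ae_bad_swap l : {ae mb, forall xi, {ae leb, forall t, ~ bad_set l (t, xi)}}.
Proof.
have mN := measurable_bad_set l.
have z : (\int[mb]_xi leb (ysection (bad_set l) xi) = 0)%E.
  have := indic_fubini_tonelli leb mb mN.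
  rewrite indic_fubini_tonelli_FE // indic_fubini_tonelli_GE // => <-.
  rewrite (ae_eq_integral (fun=> 0%E)) ?integral0 //.
    exact: measurable_fun_xsection.
  by apply: ae_imply (ae_bad_section l) => t h _.
have my : measurable_fun setT (fun xi => leb (ysection (bad_set l) xi)).
  exact: measurable_fun_ysection.
have z' : (\int[mb]_xi `|leb (ysection (bad_set l) xi)| = 0)%E.
  by under eq_integral do rewrite gee0_abs //.
have := (ae_eq_integral_abs mb measurableT my).1 z'.
apply: ae_imply => xi /(_ I) /= l0.
exists (ysection (bad_set l) xi); split => //; first exact: measurable_ysection.
by move=> t /= h; rewrite /ysection /= inE; apply: contrapT.
Qed.

(** For each [l] one [n] serves the whole countable Boolean algebra, hence all Borel sets by
    [nand_inequality]; a [haar]-null set then has measure at most [l.+1%:R^-1] for every [l]. *)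
Lemma dominated_of_good y : (forall l, ~ bad_set l y) -> 0 < w y.2 -> muxi y `<< haar.
Proof.
move=> good wy.
have unit_ := indicator_unit (fun i => measurable_coord (R := R) i : measurable_fun setT (@row_coord R d i)).
have bound l : exists n, forall j, (muxi y (cell j) <= (n%:R * fine (haar (cell j)) + l.+1%:R^-1)%:E)%E.
  have := good l; rewrite /bad_set /= => /not_andP[//|/existsNP[n h]].
  by exists n => j; rewrite leNgt; apply/negP => lt; apply: h; exists j.
have fin : (muxi y setT < +oo)%E.
  (* The whole space belongs to the family, so its bound gives finiteness. *)
  have [n nP] := bound 0%N; have [j jE] := nand_enum_surj (@NOne ('I_d * rat)).
  by have := nP j; rewrite jE /=; move/le_lt_trans; apply; rewrite ltry.
have hfin : (haar setT < +oo)%E by rewrite -ge0_fin_numE ?fin_num_measure.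
have int_ind (m : {measure set V -> \bar R}) A : measurable A -> \int[m]_x (1 * \1_A x) = fine (m A) :> R.
  move=> mA; rewrite -(setIT A) -integral_indic // /Rintegral setIT; congr fine.
  by apply: eq_integral => x _; rewrite mul1r.
have one (m : {measure set V -> \bar R}) : (m setT < +oo)%E -> m.-integrable setT (EFin \o (fun=> 1 : R)).
  by move=> mf; apply: integrable_unit => //; split => // x; rewrite ler01 lexx.
have all l A : measurable A -> exists n : nat, fine (muxi y A) <= n%:R * fine (haar A) + l.+1%:R^-1.
  move=> mA; have [n nP] := bound l; exists n.
  have := @nand_inequality R _ _ setT (indicator_base (@row_coord R d)) unit_
    (fun f => \int[muxi y]_x (1 * f x)) (fun f => \int[haar]_x (1 * f x)) n%:R l.+1%:R^-1 _ _ (\1_A)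
    (row_nand_set setT mA).
  rewrite !int_ind //; apply.
  - move=> f g ug uf gf; split; apply: weighted_convergence gf => //.
    + exact: one.
    + by apply: aeW => x; left.
    + exact: one.
    + by apply: aeW => x; left.
  - move=> f [tau ->]; have [j <-] := nand_enum_surj tau.
    rewrite !int_ind //; try exact: measurable_row_set.
    rewrite -lee_fin fineK ?ge0_fin_numE //; apply: le_lt_trans fin.
    by apply: le_measure; rewrite ?inE //; exact: measurable_row_set.
apply/null_content_dominatesP => // A mA hA0.
have Afin : (muxi y A < +oo)%E by apply: le_lt_trans fin; apply: le_measure; rewrite ?inE.
rewrite -[LHS]fineK ?ge0_fin_numE //; congr EFin; apply/eqP.
rewrite eq_le fine_ge0 // andbT leNgt; apply/negP => p.
have [n] := all (Num.trunc (fine (muxi y A))^-1) A mA.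
rewrite hA0 /= mulr0 add0r leNgt invf_plt ?posrE ?ltr0n // truncnS_gt.
by [].
Qed.

End absolute_continuity.

(** * Countably many balls, and conclusion *)

Section final_argument.
Variables (R : realType) (d : nat).
Local Notation V := 'rV[R]_d.
Local Notation C := R[i].
Local Notation haar := (torus_measure R d).
Local Notation leb := (@lebesgue_measure R).

Lemma ae_lebesgue_ex (P : R -> Prop) : {ae leb, forall t, P t} -> exists t, P t.
Proof.
move=> [N [mN N0 NP]]; apply: contrapT => no.
have : (leb `[0%R, 1%R]%classic <= leb N)%E.
  apply: le_measure; rewrite ?inE //.
  by move=> t _; apply: NP => /= p; apply: no; exists t.
by rewrite N0 lebesgue_measure_itv /= lte_fin ltr01 oppr0 adde0 lee_fin ler10.
Qed.

(** It is the marginal of [mu t] for at least one [t], and the values of a finite kernel are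
    finite. *)
Lemma marginal_finite (mu : R.-fker (measurableTypeR R) ~> (V * V)%type)
    (mb : {measure set V -> \bar R}) : is_xi_marginal mu mb -> fin_num_fun mb.
Proof.
move=> /ae_lebesgue_ex[t tP]; apply: lty_fin_num_fun.
rewrite -tP // /pushforward preimage_setT; exact: kernel_finite.
Qed.

Section finite_marginal.
Variable m : {measure set V -> \bar R}.
Hypothesis m_fin : fin_num_fun m.

Definition as_finite_measure : set V -> \bar R := m.
HB.instance Definition _ := Measure.on as_finite_measure.
HB.instance Definition _ := Measure_isFinite.Build _ _ _ as_finite_measure m_fin.
Definition finite_measure_of : {finite_measure set V -> \bar R} := as_finite_measure.

End finite_marginal.

Lemma interval_test (a b : R) (f : R -> C) :
  complex.Re (cintegral leb setT (fun t => (\1_(`[a, b]%classic) t)%:C * f t)) =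
  \int[leb]_(t in `[a, b]) complex.Re (f t).
Proof.
rewrite /cintegral /= [RHS]Rintegral_mkcond.
apply: eq_Rintegral => t _; rewrite /patch indicE.
case: (t \in _); case: (f t) => x y /=; first by rewrite mul1r mul0r subr0.
by rewrite !mul0r subr0.
Qed.

Lemma integrable_interval (a b : R) :
  leb.-integrable setT (EFin \o (\1_(`[a, b]%classic) : R -> R)).
Proof.
have fin : (leb `[a, b]%classic < +oo)%E.
  by rewrite lebesgue_measure_itv /=; case: ifP => _; rewrite ?ltry.
apply/integrableP; split; first by apply/measurable_EFinP; exact: measurable_indic.
under eq_integral do rewrite gee0_abs ?lee_fin //.
by rewrite integral_indic // setIT.
Qed.

(** Among all tests only those with [theta] the indicator of a segment are retained, and only their
    real parts. *)
Lemma Mtilde_ultrafilter (h0 : R) (S : R -> R -> operator R d)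
    (mu : R.-fker (measurableTypeR R) ~> (V * V)%type) : Mtilde h0 S mu ->
  exists (h : nat -> R) (u : nat -> V -> C) (U : set_system nat),
    [/\ forall n, 0 < h n < h0, forall n, L2 (u n) /\ L2norm (u n) = 1, UltraFilter U,
        forall e, 0 < e -> U [set n | h n <= e] &
        forall a b (f : V * V -> C), Cc_infty f -> forall e, 0 < e ->
          U [set n | `|\int[leb]_(t in `[a, b])
                complex.Re (wigner (h n) (S (h n) (t / h n) (u n)) f)
            - \int[leb]_(t in `[a, b]) complex.Re (cintegral (mu t) setT f)| < e]].
Proof.
move=> [_ [h [u [hP h_cvg uP acc]]]].
pose P (q : (R -> R) * (V * V -> C)) := leb.-integrable setT (EFin \o q.1) /\ Cc_infty q.2.
pose A n (q : (R -> R) * (V * V -> C)) := cintegral leb setT (fun t =>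
  (q.1 t)%:C * wigner (h n) (S (h n) (t / h n) (u n)) q.2).
pose B (q : (R -> R) * (V * V -> C)) := cintegral leb setT (fun t =>
  (q.1 t)%:C * cintegral (mu t) setT q.2).
have [|U [uU UD UN]] := @accumulation_ultrafilter R _ P (fun n q => complex.Re `|A n q - B q|).
  move=> m q qP e e0 N.
  exact: (acc m (fun i => (q i).1) (fun i => (q i).2) (fun i => proj1 (qP i)) (fun i => proj2 (qP i)) e e0 N).
exists h, u, U; split=> // [e e0|a b f fC e e0].
  have [N _ NP] : \forall n \near \oo, h n <= e.
    by have /cvgrPdist_le /(_ e e0) := h_cvg; apply: filterS => n; rewrite sub0r normrN; apply: le_trans; exact: ler_norm.
  by apply: filterS (UN N) => n /= Nn; exact: NP.
have := UD (\1_(`[a, b]%classic) : R -> R, f) (conj (integrable_interval a b) fC) e e0.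
apply: filterS => n /=; apply: le_lt_trans.
rewrite -(interval_test a b (fun t => wigner (h n) (S (h n) (t / h n) (u n)) f)).
rewrite -(interval_test a b (fun t => cintegral (mu t) setT f)).
have := Re_le_cabs (A n (\1_(`[a, b]%classic) : R -> R, f) - B (\1_(`[a, b]%classic) : R -> R, f)).
by rewrite raddfB.
Qed.

Lemma rational_row (xi : V) (r : R) : 0 < r -> exists q : 'rV[rat]_d, `|xi - map_mx ratr q| < r.
Proof.
move=> r0.
have ex i : {q : rat | `|xi ord0 i - ratr q| < r}.
  have lt : xi ord0 i - r < xi ord0 i + r by lra.
  apply: cid; have [q] := rat_in_itvoo lt; rewrite in_itv /= => /andP[q1 q2].
  by exists q; rewrite ltr_norml; apply/andP; split; lra.
exists (\row_i proj1_sig (ex i)).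
apply: (le_lt_trans (_ : _ <= \big[Num.max/0]_i `|xi ord0 i - ratr (proj1_sig (ex i))|)).
  rewrite [leLHS]/Num.norm /= mx_normrE; apply/bigmax_leP; split; first exact: bigmax_ge_id.
  move=> [i j] _ /=; rewrite !mxE (ord1 i).
  exact: (le_bigmax _ (fun j => `|xi ord0 j - ratr (proj1_sig (ex j))|) j).
apply/bigmax_ltP; split => // i _; exact: (proj2_sig (ex i)).
Qed.

Section conclusion.
Variables (mu : R.-fker (measurableTypeR R) ~> (V * V)%type).
Variable mb : {finite_measure set V -> \bar R}.
Variable muxi : R.-sfker (measurableTypeR R * V)%type ~> V.
Hypothesis disint : is_disintegration mu mb muxi.
Variables (H : V -> R).
Hypothesis smH : smooth (H : V -> R^o).
Hypothesis inequality : forall (q : V) (r : R), 0 < r -> r <= 1 -> monotone_gradient H q (2 * r) ->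
  {ae leb, forall t, forall k : nat, exists2 K : R, 0 <= K & forall E, measurable E ->
    \int[mu t]_p (bump q r p.2 * \1_E p) <=
    K * (\int[(haar \x mb)%E]_p (bump q r p.2 * \1_E p)) + k.+1%:R^-1}.

(** The exceptional frequencies have to form a single null set, so only balls with rational centre
    and radius [k.+1%:R^-1] are used: every [xi] with definite Hessian lies in one whose double has
    a monotone gradient, and off the null set of that ball almost every time is good. *)
Lemma definite_absolutely_continuous : {ae mb, forall xi, definite (hessian H xi) ->
  {ae leb, forall t, muxi (t, xi) `<< haar}}.
Proof.
pose center (z : 'rV[rat]_d * nat) : V := map_mx ratr z.1.
pose rad (z : 'rV[rat]_d * nat) : R := z.2.+1%:R^-1.
have rad0 z : 0 < rad z by rewrite invr_gt0.
have rad1 z : rad z <= 1 by rewrite invf_le1 // ler1n.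
have good n : {ae mb, forall xi, forall l z, choice.unpickle n = Some z ->
    monotone_gradient H (center z) (2 * rad z) ->
    {ae leb, forall t, ~ bad_set muxi (bump (center z) (rad z)) l (t, xi)}}.
  case E : (choice.unpickle n) => [z|]; last by apply: aeW.
  have [mono|no] := pselect (monotone_gradient H (center z) (2 * rad z)); last first.
    by apply: aeW => xi l _ [<-].
  have : {ae mb, forall xi, forall l,
      {ae leb, forall t, ~ bad_set muxi (bump (center z) (rad z)) l (t, xi)}}.
    apply/ae_foralln => l; apply: (ae_bad_swap _ _ (inequality (rad0 z) (rad1 z) mono) disint).
      exact: measurable_bump.
    by move=> xi; exact: bump01.
  by apply: ae_imply => xi h l _ [<-] _; exact: h.
have := ae_foralln good; apply: ae_imply => xi all xi_def.
have [rho rho0 mono] := definite_monotone smH xi_def.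
(* One radius for the distance from [xi] to the rational centre, two for the doubled ball. *)
have [k kP] : exists k : nat, 3 * k.+1%:R^-1 < rho.
  exists (Num.trunc (3 / rho)); rewrite -ltr_pdivlMr ?invr_gt0 // invrK mulrC.
  by rewrite -ltr_pdivrMr // truncnS_gt.
have k0 : 0 < k.+1%:R^-1 :> R by rewrite invr_gt0.
have [q qP] := rational_row xi k0.
have mono' : monotone_gradient H (center (q, k)) (2 * rad (q, k)).
  apply: mono => eta etaP; apply: le_lt_trans kP.
  rewrite (_ : eta - xi = (eta - center (q, k)) - (xi - center (q, k))); last first.
    by rewrite opprB addrA subrK.
  apply: le_trans (ler_normB _ _) _.
  have -> : 3 * k.+1%:R^-1 = 2 * k.+1%:R^-1 + k.+1%:R^-1 :> R by ring.
  by apply: lerD; exact: ltW.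
have bp : 0 < bump (center (q, k)) (rad (q, k)) xi by exact: bump_gt0.
have := ae_foralln (fun l => all (choice.pickle (q, k)) l (q, k) (choice.pickleK _) mono').
by apply: ae_imply => t tP; exact: (dominated_of_good (w := bump (center (q, k)) (rad (q, k))) tP bp).
Qed.

End conclusion.

End final_argument.

Theorem theorem1p8 (R : realType) (d : nat)
    (H : 'rV[R]_d -> R) (H_smooth : smooth (H : 'rV[R]_d -> R^o))
    (V : R * ('rV[R]_d * 'rV[R]_d) -> R[i])
    (V_smooth : csmooth V)
    (V_periodic : forall t, torus_periodic (fun x xi => V (t, (x, xi))))
    (V_bounded : exists M : R, forall p, `|V p| <= M%:C)
    (h0 : R) (h0_gt0 : 0 < h0)
    (Vh : R -> R -> operator R d)
    (Vh_admissible : admissible_perturbation h0 Vh)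
    (Vh_Op : forall h t, 0 < h < h0 -> is_Op h (fun p => V (t, p)) (Vh h t))
    (S : R -> R -> operator R d)
    (S_propagator : forall h, 0 < h < h0 -> propagator H h (Vh h) (S h))
    (mu : R.-fker (measurableTypeR R) ~> ('rV[R]_d * 'rV[R]_d)%type)
    (mu_Mtilde : Mtilde h0 S mu)
    (mubar : {measure set 'rV[R]_d -> \bar R})
    (mubar_marginal : is_xi_marginal mu mubar)
    (muxi : R.-sfker (measurableTypeR R * 'rV[R]_d)%type ~> 'rV[R]_d)
    (muxi_disintegration : is_disintegration mu mubar muxi) :
  {ae mubar, forall xi, definite (hessian H xi) ->
    {ae (@lebesgue_measure R), forall t, muxi (t, xi) `<< torus_measure R d}}.
Proof.
have mb_fin := marginal_finite mubar_marginal.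
pose mb := finite_measure_of mb_fin.
have mu_cell := proj1 mu_Mtilde.
have [hs [u [U [hsP uP uU U_small U_weak]]]] := Mtilde_ultrafilter mu_Mtilde.
have [VhB _ _ [M VhM]] := Vh_admissible.
(* The common bound is made nonnegative, as the estimates require. *)
have VhM' h : 0 < h < h0 -> {ae (@lebesgue_measure R), forall t, opnorm (Vh h t) <= `|M|}.
  by move=> hP; apply: ae_imply (VhM h hP) => t /le_trans; apply; exact: ler_norm.
apply: (@definite_absolutely_continuous R d mu mb muxi muxi_disintegration H H_smooth).
move=> q r r0 r1 gradH.
apply: (set_inequality mu_cell (mb := mb) mubar_marginal r0 r1).
move=> e e0; exact: (local_estimate (normr_ge0 M) (fun h t hP => proj1 (VhB h t hP)) VhM'
  S_propagator hsP uP uU U_small U_weak r0 gradH e0).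
Qed.
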